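(* Let $G$ be a unimodular locally compact group and $U$ a compact open subgroup such that $(G,U)$ is a Gelfand pair. The following are equivalent: (a) All $*$-spherical functions for $\mathcal{H}(G,U)$ are bounded. (b) The universal $C^*$-completion $C^*(G,U)$ of $\mathcal{H}(G,U)$ exists and the canonical surjection $C^*(G,U)\to C^*(L^1(G,U))$ is an isomorphism.
   Context: Let $G$ be a unimodular locally compact group, $U$ a compact open subgroup, and $\mu$ the Haar measure on $G$ with $\mu(U)=1$. The Hecke algebra $\mathcal{H}(G,U)$ is the $*$-algebra of compactly supported $U$-biinvariant functions $f:G\to\mathbb{C}$ with convolution $(f_1*f_2)(g)=\int_G f_1(h)f_2(h^{-1}g)\,d\mu(h)$ and involution $f^*(g)=\overline{f(g^{-1})}$. $L^1(G,U)$ is the Banach $*$-algebra of $U$-biinvariant functions in $L^1(G)$, which is the completion of $\mathcal{H}(G,U)$ in the $L^1$-norm. The pair $(G,U)$ is a Gelfand pair if $L^1(G,U)$ is commutative. $C^*(L^1(G,U))$ denotes the enveloping $C^*$-algebra of the Banach $*$-algebra $L^1(G,U)$. The universal $C^*$-completion $C^*(G,U)$ of $\mathcal{H}(G,U)$ is said to exist if $\sup_\pi\|\pi(f)\|<\infty$ for every $f\in\mathcal{H}(G,U)$, where $\pi$ runs over all $*$-representations of $\mathcal{H}(G,U)$ by bounded operators on Hilbert spaces; $C^*(G,U)$ is then the completion of $\mathcal{H}(G,U)$ in the norm given by this supremum. When it exists, the canonical surjection $C^*(G,U)\to C^*(L^1(G,U))$ is the $*$-homomorphism extending the inclusion $\mathcal{H}(G,U)\subset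 L^1(G,U)$. A spherical function for $\mathcal{H}(G,U)$ is a continuous function $\omega:G\to\mathbb{C}$ such that $\omega(e)=1$; $\omega(u_1gu_2)=\omega(g)$ for all $g\in G$, $u_1,u_2\in U$; and $\int_U\omega(g_1ug_2)\,d\mu(u)=\omega(g_1)\omega(g_2)$ for all $g_1,g_2\in G$. It is a $*$-spherical function if moreover $\omega(g^{-1})=\overline{\omega(g)}$ for all $g\in G$. *)

(* Defs.v *)
From HB Require Import structures.
From mathcomp Require Import all_boot all_order all_algebra.
From mathcomp Require Import sesquilinear complex.
From mathcomp Require Import all_classical all_reals all_analysis.

Set Implicit Arguments.
Unset Strict Implicit.
Unset Printing Implicit Defensive.

Import Order.TTheory GRing.Theory Num.Theory.
Import numFieldNormedType.Exports.

Local Open Scope classical_set_scope.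
Local Open Scope ring_scope.

(* The base point is arbitrary and unused: it is only there because the
   library builds generated sigma-algebras on pointed types. *)
HB.mixin Record isTopologicalGroup G of Topological G & Group G := {
  mulg_continuous : continuous (fun x : G * G => (x.1 * x.2)%g) ;
  invg_continuous : continuous (fun x : G => (x^-1)%g)
}.

#[short(type="topologicalGroupType")]
HB.structure Definition TopologicalGroup :=
  {G of PointedTopological G & Group G & isTopologicalGroup G}.

Definition borel (G : topologicalGroupType) := g_sigma_algebraType (@open G).

Section Haar.
Variables (R : realType) (G : topologicalGroupType).
Local Open Scope ereal_scope.

(* Regularity is part of the definition: without it uniqueness up to scaling
   fails for groups that are not sigma-compact. *)
Record haar_measure (mu : {measure set (borel G) -> \bar R}) : Prop := {
  haar_neq0 : mu setT != 0 ;
  haar_left_invariant : forall (g : G) (A : set (borel G)),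
    measurable A -> mu [set (g * x)%g | x in A] = mu A ;
  haar_compact : forall K : set G, compact K -> mu K < +oo ;
  haar_outer_regular : forall A : set (borel G), measurable A ->
    mu A = ereal_inf [set mu O | O in [set O : set G | open O /\ A `<=` O]] ;
  haar_inner_regular : forall O : set G, open O ->
    mu O = ereal_sup [set mu K | K in [set K : set G | compact K /\ K `<=` O]]
}.

Definition unimodular := forall mu : {measure set (borel G) -> \bar R},
  haar_measure mu -> forall (g : G) (A : set (borel G)),
  measurable A -> mu [set (x * g)%g | x in A] = mu A.

End Haar.

Definition subgroup (G : topologicalGroupType) (U : set G) :=
  [/\ U 1%g, (forall x y, U x -> U y -> U (x * y)%g)
           & (forall x, U x -> U (x^-1)%g)].

Section CStar.
Variable R : realType.
Local Notation C := R[i].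

Record hilbertType := HilbertType {
  hilbert_sort :> completeNormedModType C ;
  hdot : {dot hilbert_sort for Num.conj} ;
  hdot_norm : forall v : hilbert_sort, `|v| ^+ 2 = hdot v v
}.

(* Norms take values in C, hence the real part. *)
Definition opnorm (H : hilbertType) (T : H -> H) : \bar R :=
  ereal_sup [set (complex.Re `|T v|)%:E | v in [set v : H | `|v| <= 1]].

Record cstarAlgebra := CstarAlgebra {
  cstar_sort :> completeNormedModType C ;
  cmul : cstar_sort -> cstar_sort -> cstar_sort ;
  cstar : cstar_sort -> cstar_sort ;
  cmulA : associative cmul ;
  cmulDl : left_distributive cmul +%R ;
  cmulDr : right_distributive cmul +%R ;
  cmulZl : forall (c : C) a b, cmul (c *: a) b = c *: cmul a b ;
  cmulZr : forall (c : C) a b, cmul a (c *: b) = c *: cmul a b ;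
  cstarK : involutive cstar ;
  cstarD : {morph cstar : a b / a + b} ;
  cstarZ : forall (c : C) a, cstar (c *: a) = c^* *: cstar a ;
  cstarM : forall a b, cstar (cmul a b) = cmul (cstar b) (cstar a) ;
  cnormM : forall a b, `|cmul a b| <= `|a| * `|b| ;
  cnorm_star : forall a, `|cmul (cstar a) a| = `|a| ^+ 2
}.

Definition star_hom (A B : cstarAlgebra) (phi : {linear A -> B}) :=
  {morph phi : a b / cmul a b} /\ {morph phi : a / cstar a}.

End CStar.

Section Hecke.
Variables (R : realType) (G : topologicalGroupType).
Variables (mu : {measure set (borel G) -> \bar R}) (U : set G).
Local Notation C := R[i].
Implicit Types (f : G -> C) (A : set (G -> C)).

Definition cintegral (D : set G) f : C :=
  Complex (\int[mu]_(x in (D : set (borel G))) complex.Re (f x))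
          (\int[mu]_(x in (D : set (borel G))) complex.Im (f x)).

Definition convolution f1 f2 : G -> C :=
  fun g => cintegral setT (fun h => f1 h * f2 (h^-1 * g)%g).

Definition invol f : G -> C := fun g => (f (g^-1)%g)^*.

Definition biinvariant f := forall g u1 u2, U u1 -> U u2 ->
  f (u1 * g * u2)%g = f g.

Definition hecke : set (G -> C) :=
  [set f | biinvariant f /\ compact (closure [set g | f g != 0])].

(* No quotient by null functions is needed: cosets of the open subgroup U have
   positive measure, so U-biinvariant functions that agree almost everywhere
   are equal. *)
Definition L1 : set (G -> C) :=
  [set f | [/\ biinvariant f,
    mu.-integrable setT (fun x : borel G => (complex.Re (f x))%:E)
  & mu.-integrable setT (fun x : borel G => (complex.Im (f x))%:E)]].

Definition gelfand_pair := forall f1 f2, L1 f1 -> L1 f2 ->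
  convolution f1 f2 = convolution f2 f1.

(* In what follows A stands for one of the *-algebras hecke and L1, with the
   product convolution and the involution invol; maps out of A are total functions
   whose values outside A are irrelevant. *)

Definition star_rep A (H : hilbertType R) (pi : (G -> C) -> {linear H -> H}) :=
  [/\ forall f, A f -> (opnorm (pi f) < +oo)%E,
      forall f1 f2, A f1 -> A f2 ->
        forall v, pi (fun g => f1 g + f2 g) v = pi f1 v + pi f2 v,
      forall (c : C) f, A f -> forall v, pi (fun g => c * f g) v = c *: pi f v,
      forall f1 f2, A f1 -> A f2 ->
        forall v, pi (convolution f1 f2) v = pi f1 (pi f2 v)
    & forall f, A f ->
        forall v w, hdot H (pi f v) w = hdot H v (pi (invol f) w)].

Definition rep_norm A f : \bar R := ereal_sup [set x | exists (H : hilbertType R)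
  (pi : (G -> C) -> {linear H -> H}), star_rep A pi /\ x = opnorm (pi f)].

Record cstar_completion A := CstarCompletion {
  completion_alg :> cstarAlgebra R ;
  completion_emb : (G -> C) -> completion_alg ;
  completion_embD : forall f1 f2, A f1 -> A f2 ->
    completion_emb (fun g => f1 g + f2 g)
      = completion_emb f1 + completion_emb f2 ;
  completion_embZ : forall (c : C) f, A f ->
    completion_emb (fun g => c * f g) = c *: completion_emb f ;
  completion_embM : forall f1 f2, A f1 -> A f2 ->
    completion_emb (convolution f1 f2)
      = cmul (completion_emb f1) (completion_emb f2) ;
  completion_emb_star : forall f, A f ->
    completion_emb (invol f) = cstar (completion_emb f) ;
  completion_norm : forall f, A f ->
    (complex.Re `|completion_emb f|)%:E = rep_norm A f ;
  completion_dense : dense [set completion_emb f | f in A]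
}.

Definition universal_completion_exists :=
  forall f, hecke f -> (rep_norm hecke f < +oo)%E.

(* The completion of hecke is C*(G,U), that of L1 is the enveloping C*-algebra
   of L1: *-representations of a Banach *-algebra are automatically
   contractive, so the latter needs no continuity condition on pi.  Completions
   are unique up to a unique compatible *-isomorphism and *-homomorphisms of
   C*-algebras are continuous, so phi is determined by its values on hecke. *)
Definition canonical_surjection_iso :=
  exists (CH : cstar_completion hecke) (CL : cstar_completion L1)
         (phi : {linear CH -> CL}),
  [/\ star_hom phi,
      forall f, hecke f -> phi (completion_emb CH f) = completion_emb CL f
    & bijective phi].

Definition spherical (omega : G -> C) :=
  [/\ continuous (omega : G -> C^o),
      omega 1%g = 1,
      biinvariant omega
    & forall g1 g2, cintegral U (fun u => omega (g1 * u * g2)%g)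
                    = omega g1 * omega g2].

Definition star_spherical (omega : G -> C) :=
  spherical omega /\ forall g, omega (g^-1)%g = (omega g)^*.

End Hecke.

(* Main.v *)
(** A *-spherical function [w] defines the *-character [f |-> \int f w] of the
    Hecke algebra, and every unital *-character arises this way.  A bounded
    spherical function satisfies [|w| <= 1] because [chi_w] is multiplicative and
    the L1-norm submultiplicative.

    (a) => (b).  On a commutative unital *-algebra, a seminorm [p] with
    [p(x* x) = p(x)^2] is pointwise a supremum of moduli of *-characters (no
    completeness is needed): localising [p] at the peak set of [x* x] and then
    passing to a minimal C*-seminorm gives a multiplicative one, whose Hausdorff
    quotient is [C].  Hence both [f |-> |pi f|], for a representation [pi] of the
    Hecke algebra or of L1, and the two universal norms are governed by
    [sup_w |chi_w f|] with [|w| <= 1], and both completions are the uniform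
    closure of the spherical transforms.

    (b) => (a).  If [|chi_w f| > |f|_1] for some Hecke function [f], normalise
    to [chi_w f = 1].  The Neumann series makes [1 - f] invertible in L1, hence
    in C*(L1), hence in C*(G,U), to which [chi_w] extends; but [chi_w(1 - f) = 0].
    So [|chi_w| <= |.|_1], which evaluated on double cosets gives [|w| <= 1]. *)

From HB Require Import structures.
Require Import Defs.
From mathcomp Require Import all_boot all_order all_algebra.
From mathcomp Require Import complex.
From mathcomp Require Import all_classical all_reals all_analysis.
From mathcomp Require Import ring lra.
From mathcomp Require Import finmap measurable_realfun.
Set Implicit Arguments.
Unset Strict Implicit.
Unset Printing Implicit Defensive.
Import Order.TTheory GRing.Theory Num.Theory.
Import numFieldNormedType.Exports.
Local Open Scope classical_set_scope.
Local Open Scope ring_scope.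

(** Two obstacles shape the argument. [G] need not be sigma-compact, so [mu] need not be
    sigma-finite and Fubini's theorem is not at hand. But most integrands are right [U]-invariant,
    hence constant on cosets of measure 1: their integrals are sums over coset representatives,
    finite sums for Hecke functions, and exchanging integrals becomes exchanging sums. Secondly, the
    Hecke algebra is not complete, so spectral theory does not apply to it; the identity
    [q(x* x) = q(x)^2] must produce characters by itself. Minimality of [q] makes multiplication by
    each self-adjoint element of seminorm 1 isometric, whence [q] is multiplicative, and then
    additive on squares of self-adjoint elements. As C*-algebras carry no unit here, invertibility
    of [1 - h] is expressed by a quasi-inverse [z = h + h * z], an equation that homomorphisms
    transport. It serves twice: to deduce boundedness from the isomorphism, and to bound every
    representation of L1 by the L1-norm, which allows the universal norm of L1 to be computed on the
    dense Hecke algebra. *)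

Section Modulus.
Variable R : realType.
Local Notation C := R[i].
Implicit Types c d : C.

(** Norms over [R[i]] are themselves complex numbers; estimates go through this real-valued
    modulus. *)
Definition cabs c : R := complex.Re `|c|.

Lemma cabsE c : (cabs c)%:C%C = `|c|.
Proof. by rewrite /cabs RRe_real // realE normr_ge0. Qed.

Lemma Re_le c d : c <= d -> complex.Re c <= complex.Re d.
Proof. by rewrite lecE => /andP[]. Qed.

Lemma cabs_ge0 c : 0 <= cabs c.
Proof. by apply: (@Re_le 0). Qed.

Lemma cabsM c d : cabs (c * d) = cabs c * cabs d.
Proof. by apply: complexI; rewrite rmorphM /= !cabsE normrM. Qed.

Lemma cabsD c d : cabs (c + d) <= cabs c + cabs d.
Proof. by rewrite -lecR rmorphD /= !cabsE ler_normD. Qed.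

Lemma cabsN c : cabs (- c) = cabs c.
Proof. by rewrite /cabs normrN. Qed.

Lemma cabsB c d : cabs (c - d) = cabs (d - c).
Proof. by rewrite -cabsN opprB. Qed.

Lemma cabs_real (r : R) : cabs r%:C%C = `|r|.
Proof. by rewrite /cabs normc_def /= expr0n /= addr0 sqrtr_sqr. Qed.

Lemma cabs0 : cabs 0 = 0. Proof. by rewrite /cabs normr0. Qed.
Lemma cabs1 : cabs 1 = 1. Proof. by rewrite /cabs normr1. Qed.

Lemma cabs_conj c : cabs c^* = cabs c.
Proof. by rewrite /cabs norm_conjC. Qed.

Lemma cabs_eq0 c : (cabs c == 0) = (c == 0).
Proof.
rewrite -[RHS]normr_eq0 -cabsE; apply/eqP/eqP => [->//|].
by move=> /(congr1 (@complex.Re _)).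
Qed.

Lemma Re_le_cabs c : `|complex.Re c| <= cabs c.
Proof. by rewrite -lecR cabsE normc_ge_Re. Qed.

Lemma Im_le_cabs c : `|complex.Im c| <= cabs c.
Proof.
rewrite /cabs normc_def /= -[leLHS]sqrtr_sqr; apply: ler_wsqrtr.
by rewrite lerDr sqr_ge0.
Qed.

Lemma cabs_le_ReIm c : cabs c <= `|complex.Re c| + `|complex.Im c|.
Proof.
rewrite {1}[c]complexE (le_trans (cabsD _ _)) // cabsM !cabs_real lerD2l.
by rewrite /cabs normc_def /= expr0n /= add0r expr1n sqrtr1 mul1r.
Qed.

Lemma conjCE c : c^* = conjc c. Proof. by []. Qed.

Lemma ReIm_conj c : complex.Re c^* = complex.Re c /\ complex.Im c^* = - complex.Im c.
Proof. by rewrite conjCE; case: c. Qed.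

Lemma conjR (r : R) : (r%:C%C)^* = r%:C%C :> C.
Proof. by rewrite conjCE conjc_real. Qed.

End Modulus.

(** * Characters from C*-seminorms *)

Section GelfandTheory.
Variable R : realType.
Local Notation C := R[i].
Variable A : comAlgType C.
Variable star : A -> A.
Hypothesis starD : {morph star : x y / x + y}.
Hypothesis starM : {morph star : x y / x * y}.
Hypothesis starZ : forall c x, star (c *: x) = c^* *: star x.
Hypothesis starK : involutive star.

Record cstar_seminorm (q : A -> R) : Prop := CstarSeminorm {
  csn_ge0 : forall x, 0 <= q x ;
  csnD : forall x y, q (x + y) <= q x + q y ;
  csnZ : forall c x, q (c *: x) = cabs c * q x ;
  csnM : forall x y, q (x * y) <= q x * q y ;
  csn_star : forall x, q (star x * x) = q x ^+ 2 ;
  csn1 : q 1 = 1 }.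

(** Serves both for localisation, where the index is an exponent, and for chains in Zorn's lemma.
    Most axioms let the index change because products and squares shift the exponent; for the same
    reason the C*-identity comes as two inequalities. *)
Lemma cstar_seminorm_inf (I : Type) (i0 : I) (F : I -> A -> R) :
  (forall i x, 0 <= F i x) ->
  (forall i j x y, exists k, F k (x + y) <= F i x + F j y) ->
  (forall i c x, F i (c *: x) = cabs c * F i x) ->
  (forall i j x y, exists k, F k (x * y) <= F i x * F j y) ->
  (forall i x, exists k, F k x ^+ 2 <= F i (star x * x)) ->
  (forall i x, exists k, F k (star x * x) <= F i x ^+ 2) ->
  (forall i, F i 1 = 1) ->
  cstar_seminorm (fun x => inf (range (F^~ x))).
Proof.
move=> F0 FD FZ FM FS1 FS2 F1.
have lb0 x : has_lbound (range (F^~ x)) by exists 0 => _ [i _ <-].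
have ne x : range (F^~ x) !=set0 by exists (F i0 x), i0.
have inf_le i x : inf (range (F^~ x)) <= F i x.
  by apply: ge_inf => //; exists i.
have le_infP a x : (forall i, a <= F i x) -> a <= inf (range (F^~ x)).
  by move=> h; apply: lb_le_inf => // _ [i _ <-].
have inf0 x : 0 <= inf (range (F^~ x)) by apply: (le_infP).
split=> //.
- move=> x y; rewrite -lerBlDr; apply: (le_infP) => i.
  rewrite lerBlDr -lerBlDl; apply: (le_infP) => j; rewrite lerBlDl.
  by have [k] := FD i j x y; apply: le_trans.
- move=> c x; have [->|c0] := eqVneq c 0.
    rewrite cabs0 mul0r; apply: le_anti; rewrite inf0 andbT.
    by rewrite (le_trans (inf_le i0 _)) // FZ cabs0 mul0r.
  have c1 : 0 < cabs c by rewrite lt_def cabs_ge0 cabs_eq0 c0.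
  apply: le_anti; apply/andP; split.
    rewrite -ler_pdivrMl //; apply: (le_infP) => i.
    by rewrite ler_pdivrMl // -FZ.
  by apply: (le_infP) => i; rewrite FZ ler_pM2l.
- move=> x y.
  have h i j : inf (range (F^~ (x * y))) <= F i x * F j y.
    by have [k] := FM i j x y; apply: le_trans.
  have h2 j : inf (range (F^~ (x * y))) <= inf (range (F^~ x)) * F j y.
    have [Fj0|Fj0] := eqVneq (F j y) 0.
      by rewrite Fj0 mulr0 (le_trans (h i0 j)) // Fj0 mulr0.
    have Fj : 0 < F j y by rewrite lt_def Fj0 F0.
    by rewrite -ler_pdivrMr //; apply: (le_infP) => i; rewrite ler_pdivrMr.
  have [z0|z0] := eqVneq (inf (range (F^~ x))) 0.
    by rewrite z0 mul0r (le_trans (h2 i0)) // z0 mul0r.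
  have ip : 0 < inf (range (F^~ x)) by rewrite lt_def z0 inf0.
  by rewrite -ler_pdivrMl //; apply: (le_infP) => i; rewrite ler_pdivrMl.
- move=> x; apply: le_anti; apply/andP; split.
    rewrite -[leLHS]sqr_sqrtr // ler_sqr ?nnegrE ?sqrtr_ge0 //.
    apply: (le_infP) => i; rewrite -[leRHS]ger0_norm // -sqrtr_sqr.
    by apply: ler_wsqrtr; have [k] := FS2 i x; apply: le_trans.
  apply: (le_infP) => i; have [k] := FS1 i x; apply: le_trans.
  by rewrite ler_sqr ?nnegrE.
- apply: le_anti; rewrite -{1}(F1 i0) inf_le.
  by apply: (le_infP) => i; rewrite F1.
Qed.

Lemma star1 : star 1 = 1.
Proof. by rewrite -[LHS]mul1r -[X in X * _]starK -starM mulr1 starK. Qed.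

Lemma star_nat n : star n%:R = n%:R.
Proof.
elim: n => [|n IH]; first by rewrite mulr0n -(scale0r (1 : A)) starZ conjC0 !scale0r.
by rewrite -natr1 starD IH star1.
Qed.

Lemma starN x : star (- x) = - star x.
Proof. by rewrite -scaleN1r starZ rmorphN1 scaleN1r. Qed.

Section Seminorm.
Variable q : A -> R.
Hypothesis qP : cstar_seminorm q.

Lemma csnX x n : q (x ^+ n) <= q x ^+ n.
Proof.
elim: n => [|n IH]; first by rewrite !expr0 csn1.
rewrite !exprS (le_trans (csnM qP _ _)) // ler_wpM2l //; exact: csn_ge0.
Qed.

Lemma csn0 : q 0 = 0.
Proof. by rewrite -(scale0r 0) csnZ // cabs0 mul0r. Qed.

Lemma csnN x : q (- x) = q x.
Proof. by rewrite -scaleN1r csnZ // cabsN cabs1 mul1r. Qed.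

Lemma csnB x y : q (x - y) <= q x + q y.
Proof. by rewrite (le_trans (csnD qP _ _)) // csnN. Qed.

Lemma csn_starE x : q (star x) = q x.
Proof.
suff h y : q y <= q (star y) by apply: le_anti; rewrite h -{2}[x]starK h.
have [->|y0] := eqVneq (q y) 0; first exact: csn_ge0.
have yp : 0 < q y by rewrite lt_def y0 csn_ge0.
by rewrite -(ler_pM2r yp) -expr2 -csn_star // csnM.
Qed.

(** For self-adjoint [b] the C*-identity computes the seminorm of a square exactly, hence of
    repeated squares; the other powers are reached by monotonicity in [cstar_seminorm_localize]. *)
Lemma csn_exp2 b k : star b = b -> q (b ^+ (2 ^ k)) = q b ^+ (2 ^ k).
Proof.
move=> bb; elim: k => [|k IH]; first by rewrite !expn0 !expr1.
rewrite expnSr !exprM -IH -csn_star //; congr (q (_ * _)).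
elim: (2 ^ k)%N => [|n IHn]; first by rewrite !expr0 star1.
by rewrite !exprS starM bb -IHn.
Qed.

Lemma csn_scalar (c : C) : q c%:A = cabs c.
Proof. by rewrite csnZ // csn1 // mulr1. Qed.

(* [inf_n q(f b^n)] is the supremum of [f] over the peak set of [b]. *)
Lemma cstar_seminorm_localize b : star b = b -> q b = 1 ->
  let q' := fun x => inf (range (fun n => q (x * b ^+ n))) in
  [/\ cstar_seminorm q', (forall x, q' x <= q x),
      forall x, q' (b * x) = q' x &
      forall c, (forall x, q (c * x) = q x) -> forall x, q' (c * x) = q' x].
Proof.
move=> bb qb q'.
have qbX n : q (b ^+ n) <= 1 by rewrite (le_trans (csnX _ _)) // qb expr1n.
have anti x n m : q (x * b ^+ (n + m)) <= q (x * b ^+ n).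
  rewrite exprD mulrA (le_trans (csnM qP _ _)) //.
  by rewrite ler_piMr // csn_ge0.
have lb0 x : has_lbound (range (fun n => q (x * b ^+ n))).
  by exists 0 => _ [i _ <-]; exact: csn_ge0.
have inf_le i x : q' x <= q (x * b ^+ i).
  by apply: ge_inf => //; exists i.
have le_infP a x : (forall i, a <= q (x * b ^+ i)) -> a <= q' x.
  move=> h; apply: lb_le_inf => [|_ [i _ <-]//].
  by exists (q (x * b ^+ 0)), 0%N.
have starbX n : star (b ^+ n) = b ^+ n.
  by elim: n => [|n IHn]; rewrite ?expr0 ?star1 // !exprS starM bb IHn.
split.
- apply: (@cstar_seminorm_inf nat 0%N (fun n x => q (x * b ^+ n))).
  + by move=> *; exact: csn_ge0.
  + move=> i j x y; exists (i + j)%N; rewrite mulrDl.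
    rewrite (le_trans (csnD qP _ _)) // lerD // ?anti //.
    by rewrite addnC anti.
  + by move=> i c x; rewrite -scalerAl csnZ.
  + move=> i j x y; exists (i + j)%N.
    by rewrite exprD mulrACA csnM.
  + move=> i x; exists i; rewrite -csn_star // starM starbX.
    by rewrite mulrACA -exprD anti.
  + move=> i x; exists (i + i)%N; rewrite -csn_star // starM starbX.
    by rewrite [leRHS](_ : _ = q (star x * x * b ^+ (i + i))) // mulrACA exprD.
  (* [q (b ^+ n)] decreases in [n] and equals 1 at the larger exponent [2 ^ n], so it equals 1 at
     [n]. *)
  + move=> n; rewrite mul1r; apply: le_anti; rewrite qbX /=.
    rewrite -(expr1n _ (2 ^ n)) -qb -csn_exp2 //.
    have /subnKC <- : (n <= 2 ^ n)%N by rewrite ltnW // ltn_expl.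
    by have := anti 1 n (2 ^ n - n)%N; rewrite !mul1r.
- by move=> x; rewrite (le_trans (inf_le 0%N _)) // expr0 mulr1.
(* Multiplying by [b] shifts the decreasing sequence by one, which leaves its infimum unchanged. *)
- move=> x; apply: le_anti; apply/andP; split.
    apply: (le_infP) => i; rewrite (le_trans (inf_le i _)) //.
    by rewrite [b * x]mulrC -mulrA -exprS -addn1 anti.
  apply: (le_infP) => i; rewrite (le_trans (inf_le i.+1 _)) //.
  by rewrite exprS mulrCA mulrA.
- move=> c qc x; rewrite /q'.
  suff -> : (fun n => q (c * x * b ^+ n)) = (fun n => q (x * b ^+ n)) by [].
  by apply/funext => n; rewrite -mulrA qc.
Qed.

(** What minimality provides: localising [q] at [b] gives a seminorm below [q], hence equal to it,
    and this one is invariant under [b]. *)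
Hypothesis q_min : forall b, star b = b -> q b = 1 ->
  forall x, q (b * x) = q x.

Let csnMsa b x : star b = b -> q (b * x) = q b * q x.
Proof.
move=> bb; have [qb0|qb0] := eqVneq (q b) 0.
  apply: le_anti; rewrite csnM // qb0 mul0r csn_ge0 //.
have qb : 0 < q b by rewrite lt_def qb0 csn_ge0.
have := @q_min ((q b)^-1%:C%C *: b); rewrite starZ bb conjR.
rewrite csnZ // cabs_real ger0_norm ?invr_ge0 ?csn_ge0 // mulVf //.
move=> /(_ erefl erefl x); rewrite -scalerAl csnZ // cabs_real.
rewrite ger0_norm ?invr_ge0 ?csn_ge0 // => <-.
by rewrite mulVKf.
Qed.

(** By the C*-identity the squares of both sides are seminorms of products of self-adjoint elements,
    to which [csnMsa] applies. *)
Let csn_mul x y : q (x * y) = q x * q y.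
Proof.
apply/eqP; rewrite -(eqrXn2 (n := 2)) ?mulr_ge0 ?csn_ge0 // exprMn.
have hx : q (star x * x) = q x ^+ 2 by rewrite csn_star.
rewrite -!csn_star // starM mulrACA (csnMsa (b := star x * x)) //.
by rewrite starM starK mulrC.
Qed.

(* The lower bound comes from
   [(x^2 + y^2)^2 = (x^2 - y^2)^2 + (2 x y)^2] and [q b^2 <= q (a^2 + b^2)]. *)
Let csn_sqr2 x y : star x = x -> star y = y -> q x = 1 -> q y = 1 ->
  q (x ^+ 2 + y ^+ 2) = 2.
Proof.
move=> xx yy qx qy; apply: le_anti; apply/andP; split.
  by rewrite (le_trans (csnD qP _ _)) // !expr2 !csn_mul qx qy; lra.
have sq_le (a b : A) : star a = a -> star b = b ->
    q (b ^+ 2) <= q (a ^+ 2 + b ^+ 2).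
  (* [a ^+ 2 + b ^+ 2] is [star z * z], of seminorm [q z ^+ 2], and [2 i b = z - star z] gives
     [q b <= q z]. *)
  move=> aa bb; pose z := a + 'i *: b.
  have zz : star z = a - 'i *: b.
    by rewrite starD starZ aa bb conjCi scaleNr.
  have -> : a ^+ 2 + b ^+ 2 = star z * z.
    by rewrite zz /z -subr_sqr exprZn sqrCi scaleN1r opprK.
  have -> : q (b ^+ 2) = q b ^+ 2 by rewrite expr2 csn_mul.
  rewrite csn_star // ler_sqr ?nnegrE ?csn_ge0 //.
  have : q (2%:R * 'i *: b) <= q z + q z.
    have -> : 2%:R * 'i *: b = z - star z.
      by rewrite zz /z -scalerA scaler_nat; ring.
    by rewrite -{2}(csn_starE z) csnB.
  rewrite csnZ // cabsM; have -> : cabs (2%:R : C) = 2.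
    by rewrite -(rmorph_nat (real_complex R)) /= cabs_real normr_nat.
  have -> : cabs ('i : C) = 1 by rewrite /cabs normCi.
  lra.
have s2 : q (2%:R * (x * y)) = 2.
  rewrite !csn_mul qx qy; rewrite -[2%:R]/(1 *+ 2) -scaler_nat csn_scalar.
  by rewrite -(rmorph_nat (real_complex R)) /= cabs_real normr_nat; lra.
rewrite -ler_sqr ?nnegrE ?csn_ge0 // -[X in _ <= X]csn_mul.
have -> : (x ^+ 2 + y ^+ 2) * (x ^+ 2 + y ^+ 2) =
   (x ^+ 2 - y ^+ 2) ^+ 2 + (2%:R * (x * y)) ^+ 2 :> A by ring.
have -> : 2 ^+ 2 = q ((2%:R * (x * y)) ^+ 2) by rewrite [in RHS]expr2 csn_mul s2.
apply: sq_le.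
  by rewrite starD starN !expr2 !starM xx yy.
by rewrite !starM xx yy star_nat.
Qed.

(** The smaller coefficient is raised to the larger: [t (x^2 + y^2)] has seminorm [2 t] and differs
    from the given combination by [(t - s) x^2], which leaves at least [s + t]. *)
Let csn_sqrD s t x y : 0 <= s -> 0 <= t -> star x = x -> star y = y ->
  q x = 1 -> q y = 1 ->
  q (s%:C%C *: x ^+ 2 + t%:C%C *: y ^+ 2) = s + t.
Proof.
move=> s0 t0 xx yy qx qy; wlog st : s t x y s0 t0 xx yy qx qy / s <= t.
  move=> h; have [st|/ltW st] := leP s t; first exact: h.
  by rewrite addrC h // addrC.
have qx2 : q (x ^+ 2) = 1 by rewrite expr2 csn_mul qx mulr1.
have qy2 : q (y ^+ 2) = 1 by rewrite expr2 csn_mul qy mulr1.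
apply: le_anti; apply/andP; split.
  rewrite (le_trans (csnD qP _ _)) // !csnZ // !cabs_real !ger0_norm //.
  by rewrite qx2 qy2 !mulr1.
have e : t%:C%C *: (x ^+ 2 + y ^+ 2) =
    (s%:C%C *: x ^+ 2 + t%:C%C *: y ^+ 2) + (t - s)%:C%C *: x ^+ 2.
  by rewrite addrAC -scalerDl -rmorphD /= [s + _]addrC subrK scalerDr.
have := csnD qP (s%:C%C *: x ^+ 2 + t%:C%C *: y ^+ 2) ((t - s)%:C%C *: x ^+ 2).
rewrite -e !csnZ // csn_sqr2 // !cabs_real qx2 !ger0_norm ?subr_ge0 //.
lra.
Qed.

Let csn_sqrD_gen x y : star x = x -> star y = y ->
  q (x ^+ 2 + y ^+ 2) = q x ^+ 2 + q y ^+ 2.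
Proof.
move=> xx yy.
have q2 z : q (z ^+ 2) = q z ^+ 2 by rewrite expr2 csn_mul -expr2.
have triv z w : q z = 0 -> q (z ^+ 2 + w ^+ 2) = q z ^+ 2 + q w ^+ 2.
  move=> z0; rewrite z0 expr0n add0r; apply: le_anti; apply/andP; split.
    by rewrite (le_trans (csnD qP _ _)) // !q2 z0 expr0n add0r.
  rewrite -q2 -{1}(addKr (z ^+ 2) (w ^+ 2)) addrC.
  by rewrite (le_trans (csnB _ _)) // q2 z0 expr0n addr0.
have [x0|x0] := eqVneq (q x) 0; first exact: triv.
have [y0|y0] := eqVneq (q y) 0; first by rewrite addrC triv // addrC.
have norm z : q z != 0 -> star z = z -> exists2 w, star w = w /\ q w = 1 &
    z ^+ 2 = (q z ^+ 2)%:C%C *: w ^+ 2.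
  move=> z0 zz; exists ((q z)^-1%:C%C *: z).
    rewrite starZ conjR zz csnZ // cabs_real ger0_norm ?invr_ge0 ?csn_ge0 //.
    by rewrite mulVf.
  rewrite exprZn scalerA -rmorphXn -rmorphM /= -exprMn divff // expr1n.
  by rewrite scale1r.
have [v [vv qv] ->] := norm _ x0 xx; have [w [ww qw] ->] := norm _ y0 yy.
by rewrite csn_sqrD // sqr_ge0.
Qed.

(* If [q b = 1], then [(1 + b^2)^2 = (1 - b^2)^2 + (2 b)^2] forces
   [q (1 - b^2) = 0], so [b] is [1] or [-1] modulo the kernel of [q]. *)
Let sa_real a : star a = a -> exists r : R, q (a - r%:C%C%:A) = 0.
Proof.
move=> aa; have [a0|a0] := eqVneq (q a) 0; first by exists 0; rewrite scale0r subr0.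
have ap : 0 < q a by rewrite lt_def a0 csn_ge0.
suff h (b : A) : star b = b -> q b = 1 -> q ((b - 1) * (b + 1)) = 0.
  have := h ((q a)^-1%:C%C *: a); rewrite starZ conjR aa csnZ // cabs_real.
  rewrite ger0_norm ?invr_ge0 ?csn_ge0 // mulVf // csn_mul.
  move=> /(_ erefl erefl)/eqP; rewrite mulf_eq0.
  have e : (q a)%:C%C *: ((q a)^-1%:C%C *: a) = a.
    by rewrite scalerA -rmorphM divff //= scale1r.
  move=> /orP[/eqP h1|/eqP h1]; [exists (q a)|exists (- q a)].
    by rewrite -{1}e -scalerBr csnZ // h1 mulr0.
  by rewrite rmorphN scaleNr opprK -{1}e -scalerDr csnZ // h1 mulr0.
move=> bb qb.
have s1 : star (b ^+ 2) = b ^+ 2 by rewrite expr2 starM bb.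
have q2 : q (1 + b ^+ 2) = 2.
  by have := csn_sqr2 star1 bb (csn1 qP) qb; rewrite expr1n.
have qq : q (2%:R * b) = 2.
  rewrite csn_mul qb mulr1 -[2%:R]/(1 *+ 2) -scaler_nat csn_scalar.
  by rewrite -(rmorph_nat (real_complex R)) /= cabs_real normr_nat.
have := @csn_sqrD_gen (1 - b ^+ 2) (2%:R * b).
rewrite starD starN star1 s1 starM bb star_nat => /(_ erefl erefl).
have -> : (1 - b ^+ 2) ^+ 2 + (2%:R * b) ^+ 2 = (1 + b ^+ 2) * (1 + b ^+ 2).
  by ring.
rewrite csn_mul q2 qq => h.
have {h} : q (1 - b ^+ 2) ^+ 2 = 0 by lra.
move/eqP; rewrite sqrf_eq0 => /eqP h.
by rewrite -h -csnN; congr (q _); ring.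
Qed.

Let csn_value x : exists c : C, q (x - c%:A) = 0.
Proof.
have i2 : (2%:R : C) != 0 by rewrite pnatr_eq0.
pose a := 2%:R^-1 *: (x + star x); pose b := (2%:R^-1 * 'i) *: (star x - x).
have aa : star a = a.
  by rewrite starZ starD starK addrC fmorphV /= conjC_nat.
have bb : star b = b.
  rewrite starZ starD starN starK rmorphM /= conjCi fmorphV /= conjC_nat.
  by rewrite mulrN scaleNr -scalerN opprB.
have -> : x = a + 'i *: b.
  rewrite /a /b scalerA mulrCA -expr2 sqrCi mulrN1 scaleNr -scalerBr.
  have -> : x + star x - (star x - x) = (2%:R : C) *: x by rewrite scaler_nat; ring.
  by rewrite scalerA mulVf // scale1r.
have [r ha] := sa_real aa; have [s hb] := sa_real bb.
exists (r%:C%C + 'i * s%:C%C); rewrite scalerDl -scalerA opprD addrACA -scalerBr.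
apply: le_anti; rewrite csn_ge0 // andbT (le_trans (csnD qP _ _)) //.
by rewrite ha csnZ // hb mulr0 addr0.
Qed.

(** By [csn_value] the quotient by the kernel of [q] is the line of scalars. The scalar attached to
    [x] is unique because [q] is the modulus on scalars, and every law of a character follows from
    this uniqueness. *)
Lemma csn_character_ex : exists chi : {rmorphism A -> C},
  [/\ forall c x, chi (c *: x) = c * chi x, forall x, chi (star x) = (chi x)^*
    & forall x, cabs (chi x) = q x].
Proof.
have [f fP] := choice csn_value.
have fE x c : q (x - c%:A) = 0 -> f x = c.
  move=> h; apply/eqP; rewrite -subr_eq0 -cabs_eq0 -csn_scalar scalerBl.
  apply/eqP/le_anti; rewrite csn_ge0 // andbT.
  have -> : (f x)%:A - c%:A = (x - c%:A) - (x - (f x)%:A) by ring.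
  by rewrite (le_trans (csnB _ _)) // h fP addr0.
have fD x y : f (x + y) = f x + f y.
  apply: fE; apply: le_anti; rewrite csn_ge0 // andbT scalerDl opprD addrACA.
  by rewrite (le_trans (csnD qP _ _)) // !fP addr0.
have fZ c x : f (c *: x) = c * f x.
  by apply: fE; rewrite -scalerA -scalerBr csnZ // fP mulr0.
have f1 : f 1 = 1 by apply: fE; rewrite scale1r subrr csn0.
have fM x y : f (x * y) = f x * f y.
  apply: fE; apply: le_anti; rewrite csn_ge0 // andbT.
  have -> : x * y - (f x * f y)%:A = x * (y - (f y)%:A) + (f y)%:A * (x - (f x)%:A).
    have -> : (f x * f y)%:A = (f x)%:A * (f y)%:A :> A by rewrite mulr_algl scalerA.
    by ring.
  rewrite (le_trans (csnD qP _ _)) // !csn_mul !fP !mulr0 addr0 //.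
have fS x : f (star x) = (f x)^*.
  by apply: fE; rewrite -{1}star1 -starZ -starN -starD csn_starE fP.
have fabs x : cabs (f x) = q x.
  rewrite -csn_scalar; apply: le_anti; apply/andP; split.
    have -> : (f x)%:A = x - (x - (f x)%:A) by ring.
    by rewrite (le_trans (csnB _ _)) // fP addr0.
  by rewrite -{1}[x](subrK (f x)%:A) (le_trans (csnD qP _ _)) // fP add0r.
have fB : zmod_morphism f.
  by move=> x y; rewrite fD -scaleN1r fZ mulN1r.
pose M1 := GRing.isZmodMorphism.Build A C f fB.
have fMM : monoid_morphism f by split.
pose M2 := GRing.isMonoidMorphism.Build A C f fMM.
by exists (HB.pack_for {rmorphism A -> C} f M1 M2).
Qed.

End Seminorm.

(** Invariance under [b] is kept during the descent: it forces [q b = q 1 = 1], so the minimal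
    seminorm cannot vanish on the element at which [p] was localised. *)
Lemma zorn_seminorm (p : A -> R) (b : A) : cstar_seminorm p ->
  (forall x, p (b * x) = p x) ->
  exists2 q, cstar_seminorm q /\ (forall x, q (b * x) = q x) &
   forall q', cstar_seminorm q' -> (forall x, q' (b * x) = q' x) ->
     (forall x, q' x <= q x) -> q' = q.
Proof.
move=> pP pb.
pose T := {q : A -> R | cstar_seminorm q /\ forall x, q (b * x) = q x}.
(* The order is reversed, so that a maximal element is a minimal seminorm. *)
pose leT (q q' : T) := `[< forall x, sval q' x <= sval q x >].
have [|r s t|s t|S St|q qmax] := @Zorn T leT.
- by move=> t; apply/asboolP.
- by move=> /asboolP h1 /asboolP h2; apply/asboolP => x; exact: le_trans (h1 x).
- case: s t => [s sP] [t tP] /asboolP /= h1 /asboolP /= h2.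
  have st : s = t by apply/funext => x; apply: le_anti; rewrite h1 h2.
  by move: sP tP {h1 h2}; rewrite st => sP tP; rewrite (Prop_irrelevance sP tP).
- have [S0|/existsNP[s0 /contrapT Ss0]] := pselect (forall s, ~ S s).
    by exists (exist _ p (conj pP pb)) => s /S0.
  pose I := {t : T | S t}; pose F (i : I) := sval (sval i).
  have chain (i j : I) : exists k : I, forall x, F k x <= F i x /\ F k x <= F j x.
    case: i j => [i Si] [j Sj]; have [/asboolP h|/asboolP h] := St i j Si Sj.
      by exists (exist _ j Sj) => x; rewrite /F /= h lexx.
    by exists (exist _ i Si) => x; rewrite /F /= h lexx.
  have FP (i : I) : cstar_seminorm (F i) by case: (svalP (sval i)).
  pose t x := inf (range (F^~ x)).
  have tP : cstar_seminorm t.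
    apply: (@cstar_seminorm_inf I (exist _ s0 Ss0)).
    + by move=> i x; exact: csn_ge0.
    + move=> i j x y; have [k kij] := chain i j; exists k.
      by rewrite (le_trans (csnD (FP k) _ _)) // lerD //; have [] := kij x; have [] := kij y.
    + by move=> i c x; exact: csnZ.
    + move=> i j x y; have [k kij] := chain i j; exists k.
      have [kx _] := kij x; have [_ ky] := kij y.
      by rewrite (le_trans (csnM (FP k) _ _)) // ler_pM // csn_ge0.
    + by move=> i x; exists i; rewrite csn_star.
    + by move=> i x; exists i; rewrite csn_star.
    + by move=> i; exact: csn1.
  have tb x : t (b * x) = t x.
    rewrite /t; suff -> : F^~ (b * x) = F^~ x by [].
    by apply/funext => i; have [_ h] := svalP (sval i); exact: h.
  exists (exist _ t (conj tP tb)) => s Ss; apply/asboolP => x /=.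
  apply: ge_inf; last by exists (exist _ s Ss).
  by exists 0 => _ [i _ <-]; exact: csn_ge0.
case: q qmax => q [qP qb] qmax; exists q => // q' q'P q'b le.
have := qmax (exist _ q' (conj q'P q'b)).
by move=> /(_ (asboolT le))/(congr1 sval).
Qed.

(** The element [b] is [star x * x] scaled to seminorm 1. A character whose modulus is a seminorm
    invariant under [b] has modulus 1 at [b], hence modulus [p x] at [x]. *)
Theorem cstar_seminorm_character (p : A -> R) (x : A) : cstar_seminorm p ->
  p x != 0 -> exists chi : {rmorphism A -> C},
  [/\ forall c y, chi (c *: y) = c * chi y, forall y, chi (star y) = (chi y)^*
    & cabs (chi x) = p x].
Proof.
move=> pP px0; have px : 0 < p x by rewrite lt_def px0 csn_ge0.
pose b := ((p x ^+ 2)^-1)%:C%C *: (star x * x).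
have bb : star b = b by rewrite starZ conjR starM starK mulrC.
have pb : p b = 1.
  rewrite csnZ // cabs_real csn_star // ger0_norm ?invr_ge0 ?sqr_ge0 //.
  by rewrite mulVf // sqrf_eq0.
have [p'P _ p'b _] := cstar_seminorm_localize pP bb pb.
have [q [qP qb] qmin] := zorn_seminorm p'P p'b.
have [c cc qc|chi [chiZ chiS chiN]] := @csn_character_ex q qP.
  (* Localising the minimal [q] at [c] keeps the invariance under [b], so minimality applies to the
     result. *)
  have [q'P q'q q'c q'b] := cstar_seminorm_localize qP cc qc.
  by rewrite -(qmin _ q'P (q'b b qb) q'q).
exists chi; split=> //; apply/eqP.
rewrite -(eqrXn2 (n := 2)) ?cabs_ge0 ?csn_ge0 //.
have : cabs (chi b) = 1 by rewrite chiN -[b]mulr1 qb csn1.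
rewrite chiZ rmorphM chiS cabsM cabs_real cabsM cabs_conj -expr2.
rewrite ger0_norm ?invr_ge0 ?sqr_ge0 // => /(congr1 ( *%R (p x ^+ 2))).
by rewrite mulVKf ?sqrf_eq0 // mulr1 => ->.
Qed.

End GelfandTheory.

(** * Integration over cosets of an open subgroup *)

Section Cosets.
Variables (G : topologicalGroupType) (U : set G).
Hypotheses (subU : subgroup U) (openU : open U).
Let U1 : U 1%g. Proof. by case: subU. Qed.

Let UM x y : U x -> U y -> U (x * y)%g. Proof. by case: subU => _ + _; exact. Qed.
Let UV x : U x -> U (x^-1)%g. Proof. by case: subU => _ _; exact. Qed.

Lemma mulg_continuousl (g : G) : continuous (fun x : G => (g * x)%g).
Proof.
move=> x; apply: (@continuous_comp _ _ _ (fun x : G => (g, x)) (fun z => (z.1 * z.2)%g)).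
  by apply: cvg_pair; [exact: cvg_cst|exact: cvg_id].
exact: mulg_continuous.
Qed.

Lemma mulg_continuousr (g : G) : continuous (fun x : G => (x * g)%g).
Proof.
move=> x; apply: (@continuous_comp _ _ _ (fun x : G => (x, g)) (fun z => (z.1 * z.2)%g)).
  by apply: cvg_pair; [exact: cvg_id|exact: cvg_cst].
exact: mulg_continuous.
Qed.

Definition coset (x : G) : set G := [set y | U (x^-1 * y)%g].

Lemma coset_open x : open (coset x).
Proof. by apply: open_comp openU => y _; exact: mulg_continuousl. Qed.

(** [get] depends only on the set [coset x], so all points of a coset receive the same
    representative. *)
Definition crep (x : G) : G := get (coset x).

Lemma coset_crep x : coset x (crep x).
Proof. by rewrite /crep; apply: (@getI _ (coset x) x); rewrite /coset /= mulVg. Qed.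

Lemma cosetE x y : coset x y -> coset x = coset y.
Proof.
rewrite /coset /= => xy; apply/seteqP; split=> z /= h.
  have := UM (UV xy) h; rewrite invgM invgK -mulgA; by rewrite mulVKg.
by have := UM xy h; rewrite -mulgA mulVKg.
Qed.

Lemma crep_eq x y : coset x y -> crep x = crep y.
Proof. by rewrite /crep => /cosetE ->. Qed.

Lemma crepK x : crep (crep x) = crep x.
Proof. by symmetry; apply: crep_eq; exact: coset_crep. Qed.

Lemma crepP x y : (crep x = crep y) <-> coset x y.
Proof.
split=> [e|]; last exact: crep_eq.
have hx := cosetE (coset_crep x); have hy := cosetE (coset_crep y).
by rewrite hx e -hy /coset /= mulVg.
Qed.

Lemma crepM x u : U u -> crep (x * u)%g = crep x.
Proof. by move=> Uu; symmetry; apply: crep_eq; rewrite /coset /= mulKg. Qed.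

Definition rinv (T : Type) (F : G -> T) := forall g u, U u -> F (g * u)%g = F g.

Lemma rinv_coset T (F : G -> T) x y : rinv F -> coset x y -> F y = F x.
Proof. by move=> hF xy; rewrite -(hF x _ xy) mulVKg. Qed.

Lemma rinv_crep T (F : G -> T) x : rinv F -> F (crep x) = F x.
Proof. by move=> /rinv_coset; apply; exact: coset_crep. Qed.

Lemma rinv_lmul T (F : G -> T) g : rinv F -> rinv (fun x => F (g * x)%g).
Proof. by move=> hF x u Uu; rewrite mulgA; exact: hF. Qed.

(** Since [U] is open, a right [U]-invariant function is locally constant; it is thus continuous and
    Borel measurable whatever its target. *)
Lemma rinv_open T (F : G -> T) (A : set T) : rinv F -> open (F @^-1` A).
Proof.
move=> hF; rewrite openE => x /= Ax.
apply: (@filterS _ _ _ (coset x)) => [y /(rinv_coset hF) /= -> //|].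
by apply: open_nbhs_nbhs; split; [exact: coset_open|rewrite /coset /= mulVg].
Qed.

Lemma open_borel (A : set G) : open A -> measurable (A : set (borel G)).
Proof. exact: sub_sigma_algebra. Qed.

Lemma rinv_measurable d (T : measurableType d) (F : G -> T) : rinv F ->
  measurable_fun [set: borel G] (F : borel G -> T).
Proof. by move=> hF _ A _; rewrite setTI; apply: open_borel; exact: rinv_open. Qed.

Definition creps : set G := range crep.

Section CosetMeasure.
(** Not only [mu]: the same formula is applied to the images of [mu] under translations and
    inversion, and the equality of both sums is the invariance of the integral. *)
Variables (R : realType) (nu : {measure set (borel G) -> \bar R}).
Hypothesis nu_coset : forall x, nu (coset x) = 1%E.
Local Open Scope ereal_scope.

Lemma integral_coset_fset (F : G -> R) (A : {fset G}) :
  [set` A] `<=` creps -> rinv F -> (forall x, (0 <= F x)%R) ->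
  (forall x, F x != 0%R -> crep x \in A) ->
  \int[nu]_x (F x)%:E = \sum_(x <- A) (F x)%:E.
Proof.
move=> Acr Finv F0 FA.
have e y : (F y)%:E = \sum_(x <- A) (F x * \1_(coset x) y)%:E.
  rewrite sumEFin; congr EFin.
  have [yA|yA] := boolP (crep y \in A).
    rewrite (big_fsetD1 (crep y)) //= indicE mem_set; last first.
      by apply/crepP; rewrite crepK.
    rewrite mulr1 rinv_crep // big1_fset ?addr0 // => x.
    rewrite in_fsetD1 => /andP[xy xA] _; rewrite indicE memNset ?mulr0 //.
    move=> /crepP xy'; move/eqP: xy; apply; rewrite -xy'.
    by have [z _ <-] := Acr _ xA; rewrite crepK.
  have -> : F y = 0%R by apply/eqP; apply: contraNT yA; exact: FA.
  rewrite big1_fset // => x xA _; rewrite indicE memNset ?mulr0 //.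
  move=> /crepP xy; move/negP: yA; apply; rewrite -xy.
  by have [z _ ez] := Acr _ xA; rewrite -ez crepK ez.
under eq_integral do rewrite e.
rewrite ge0_integral_sum //.
- apply: eq_bigr => x _; under eq_integral do rewrite EFinM.
  rewrite ge0_integralZl_EFin //.
  + by rewrite integral_indic ?setIT ?nu_coset ?mule1 //; apply: open_borel; exact: coset_open.
  + apply/measurable_EFinP; apply: measurable_indic; apply: open_borel; exact: coset_open.
- move=> x; apply/measurable_EFinP/measurable_funM => //; apply: measurable_indic.
  by apply: open_borel; exact: coset_open.
- by move=> x y _; rewrite lee_fin mulr_ge0.
Qed.

Lemma le_integral_fset (F : G -> R) (A : {fset G}) :
  [set` A] `<=` creps -> rinv F -> (forall x, (0 <= F x)%R) ->
  \sum_(x <- A) (F x)%:E <= \int[nu]_x (F x)%:E.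
Proof.
move=> Acr Finv F0.
pose F' x : R := if crep x \in A then F x else 0%R.
have F'inv : rinv F' by move=> g u Uu; rewrite /F' crepM // Finv.
have F'0 x : (0 <= F' x)%R by rewrite /F'; case: ifP.
have -> : \sum_(x <- A) (F x)%:E = \sum_(x <- A) (F' x)%:E.
  rewrite big_seq [RHS]big_seq; apply: eq_bigr => x xA; rewrite /F'.
  by have [z _ ez] := Acr _ xA; rewrite -ez crepK ez xA.
rewrite -integral_coset_fset //; last by move=> x; rewrite /F'; case: ifP => // _; rewrite eqxx.
apply: ge0_le_integral => //.
- by move=> x _; rewrite lee_fin.
- by apply/measurable_EFinP; exact: rinv_measurable.
- by apply/measurable_EFinP; exact: rinv_measurable.
- by move=> x _; rewrite lee_fin /F'; case: ifP.
Qed.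

(** There may be uncountably many cosets. When the sum is finite, only finitely many cosets carry a
    value above [1/(n+1)]; truncation at this level gives finite sums, and monotone convergence
    gives the integral. *)
Lemma integral_esum (F : G -> R) : rinv F -> (forall x, (0 <= F x)%R) ->
  \int[nu]_x (F x)%:E = \esum_(x in creps) (F x)%:E.
Proof.
move=> Finv F0; apply/eqP; rewrite eq_le; apply/andP; split; last first.
  apply: ge_ereal_sup => _ [X [finX XT] <-].
  rewrite fsbig_finite //=; apply: le_integral_fset => //.
  by rewrite fset_setK.
have [->|es] := eqVneq (\esum_(x in creps) (F x)%:E) +oo; first exact: leey.
pose D n := [set x | (F x > n.+1%:R^-1)%R].
pose Fn n x : R := if (F x > n.+1%:R^-1)%R then F x else 0%R.
have Fninv n : rinv (Fn n) by move=> g u Uu; rewrite /Fn Finv.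
have Fn0 n x : (0 <= Fn n x)%R by rewrite /Fn; case: ifP.
have fin n : finite_set (creps `&` D n).
  apply: contrapT => /infinite_set_fset inf.
  have [r er] : exists r : R, \esum_(x in creps) (F x)%:E = r%:E.
    exists (fine (\esum_(x in creps) (F x)%:E)); rewrite fineK // ge0_fin_numE.
      by rewrite lt_neqAle es leey.
    by apply: esum_ge0 => x _; rewrite lee_fin.
  have r0 : (0 <= r * n.+1%:R)%R.
    rewrite mulr_ge0 // -lee_fin -er; apply: esum_ge0 => x _; by rewrite lee_fin.
  have [B BD cB] := inf (Num.Def.archi_bound (r * n.+1%:R)).
  have : \sum_(x <- B) (F x)%:E <= r%:E.
    rewrite -er; apply: esum_ge; exists [set` B].
      by split=> // x /BD [].
    by rewrite fsbig_finite //= set_fsetK.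
  rewrite sumEFin lee_fin leNgt => /negP; apply.
  have {r0} := archi_boundP r0; rewrite -ltr_pdivlMr // => /lt_le_trans; apply.
  apply: (@le_trans _ _ (\sum_(x <- B) n.+1%:R^-1)%R).
    rewrite big_const_seq count_predT iter_addr_0 -[leRHS]mulr_natl.
    by rewrite ler_wpM2r ?invr_ge0 // ler_nat.
  by rewrite big_seq [leRHS]big_seq; apply: ler_sum => x /BD [_ /ltW].
have Fnlim x : (Fn n x)%:E @[n --> \oo] --> (F x)%:E.
  have [F0'|Fp] := eqVneq (F x) 0%R.
    apply: cvg_near_cst; apply: nearW => n; rewrite /Fn F0'.
    by case: ifP.
  have Fx : (0 < F x)%R by rewrite lt_def Fp F0.
  apply: cvg_near_cst; exists (Num.Def.archi_bound (F x)^-1) => // n /= hn.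
  rewrite /Fn ifT // invf_plt ?posrE //.
  apply: lt_le_trans (archi_boundP _) _; first by rewrite invr_ge0.
  by rewrite ler_nat ltnW.
have lim : \int[nu]_x (Fn n x)%:E @[n --> \oo] --> \int[nu]_x (F x)%:E.
  have -> : \int[nu]_x (F x)%:E = \int[nu]_x (limn (fun n => (Fn n x)%:E)).
    by apply: eq_integral => x _; apply/esym/cvg_lim.
  apply: cvg_monotone_convergence => //.
  - by move=> n; apply/measurable_EFinP; exact: rinv_measurable.
  - by move=> n x _; rewrite lee_fin.
  - move=> x _ m n mn; rewrite lee_fin /Fn; case: ifPn => [h|_]; last by case: ifP.
    by rewrite ifT // (le_lt_trans _ h) // lef_pV2 ?posrE // ler_nat.
apply: (cvge_le _ lim) => //; apply: nearW => n.
rewrite (@integral_coset_fset (Fn n) (fset_set (creps `&` D n))) //.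
- apply: (@le_trans _ _ (\sum_(x <- fset_set (creps `&` D n)) (F x)%:E)).
    by apply: lee_sum => x _; rewrite lee_fin /Fn; case: ifP.
  apply: esum_ge; exists (creps `&` D n); last by rewrite fsbig_finite.
  by split=> // x [].
- by rewrite fset_setK // => x [].
- move=> x; rewrite /Fn; case: ifPn; rewrite ?eqxx // => h _.
  rewrite in_fset_set //; apply: mem_set; split; [by exists x|by rewrite /D /= rinv_crep].
Qed.

End CosetMeasure.
End Cosets.

(** * Invariance of integrals and the L1-norm *)

Section HeckePair.
Variables (R : realType) (G : topologicalGroupType).
Variables (mu : {measure set (borel G) -> \bar R}) (U : set G).
Local Notation C := R[i].
Implicit Types F f : G -> C.

Record hecke_pair : Prop := HeckePair {
  hp_hausdorff : hausdorff_space G ;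
  hp_unimodular : unimodular R G ;
  hp_subgroup : subgroup U ;
  hp_compact : compact U ;
  hp_open : open U ;
  hp_haar : haar_measure mu ;
  hp_muU : mu U = 1%E }.

Hypothesis hp : hecke_pair.
Let subU := hp_subgroup hp.
Let openU := hp_open hp.
Let UV x : U x -> U (x^-1)%g. Proof. by case: subU => _ _; exact. Qed.

Let mU : measurable (U : set (borel G)). Proof. exact: (open_borel openU). Qed.

Lemma mu_coset x : mu (coset U x) = 1%E.
Proof.
rewrite -(hp_muU hp) -(haar_left_invariant (hp_haar hp) x mU).
congr (mu _); apply/seteqP; split=> y.
  by move=> h; exists (x^-1 * y)%g => //; rewrite mulVKg.
by move=> [z Uz <-]; rewrite /coset /= mulKg.
Qed.

Lemma continuous_borel (phi : G -> G) : continuous phi ->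
  measurable_fun [set: borel G] (phi : borel G -> borel G).
Proof.
move=> cphi; apply: (@measurability _ _ (borel G) (borel G) setT phi (@open G)) => // _ [A oA <-].
by rewrite setTI; apply: open_borel; apply: open_comp => // x _; exact: cphi.
Qed.

Section Preserving.
Variable phi : G -> G.
Hypothesis cphi : continuous phi.
Hypothesis phi_coset : forall x, mu (phi @^-1` coset U x) = 1%E.

Let mphi := continuous_borel cphi.

(* The integral of a right [U]-invariant function depends only on the measures of
   the cosets of [U]. *)
Lemma ge0_integral_preserving (F : G -> R) : rinv U F -> (forall x, 0 <= F x) ->
  (\int[mu]_x (F (phi x))%:E = \int[mu]_x (F x)%:E)%E.
Proof.
move=> Finv F0.
rewrite [RHS](integral_esum subU openU mu_coset) //.
have nuE x : pushforward mu (phi : borel G -> borel G) (coset U x) = 1%E.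
  by rewrite /pushforward phi_coset.
rewrite -(@integral_esum _ _ subU openU _ (pushforward mu (phi : borel G -> borel G)) nuE) //.
rewrite [RHS](ge0_integral_pushforward mphi) //.
- by apply/measurable_EFinP; apply: (rinv_measurable subU openU).
- by move=> x _; rewrite lee_fin.
Qed.

Lemma integral_preserving (F : G -> R) : rinv U F ->
  (\int[mu]_x (F (phi x))%:E = \int[mu]_x (F x)%:E)%E.
Proof.
move=> Finv; rewrite integralE [RHS]integralE.
have pos (H : G -> R) (y : G) : ((fun x => (H x)%:E)^\+ y)%E = (Num.max (H y) 0)%:E.
  by rewrite funeposE -EFin_max.
have neg (H : G -> R) (y : G) : ((fun x => (H x)%:E)^\- y)%E = (Num.max (- H y) 0)%:E.
  by rewrite funenegE -EFinN -EFin_max.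
congr (_ - _)%E.
  under eq_integral do rewrite (pos (fun x => F (phi x))).
  under [RHS]eq_integral do rewrite pos.
  apply: (@ge0_integral_preserving (fun x => Num.max (F x) 0)) => //.
    by move=> g u Uu; rewrite Finv.
  by move=> x; rewrite le_max lexx orbT.
under eq_integral do rewrite (neg (fun x => F (phi x))).
under [RHS]eq_integral do rewrite neg.
apply: (@ge0_integral_preserving (fun x => Num.max (- F x) 0)) => //.
  by move=> g u Uu; rewrite Finv.
by move=> x; rewrite le_max lexx orbT.
Qed.

Lemma cintegral_preserving F : rinv U F ->
  cintegral mu setT (fun x => F (phi x)) = cintegral mu setT F.
Proof.
move=> Finv; rewrite /cintegral /Rintegral; congr (Complex (fine _) (fine _)).
  by apply: (@integral_preserving (fun x => complex.Re (F x))) => g u Uu; rewrite Finv.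
by apply: (@integral_preserving (fun x => complex.Im (F x))) => g u Uu; rewrite Finv.
Qed.

End Preserving.

Lemma mu_preim_mulgl g x : mu ((fun y => g * y)%g @^-1` coset U x) = 1%E.
Proof.
rewrite -(mu_coset (g^-1 * x)%g); congr (mu _); apply/seteqP; split=> y;
  by rewrite /coset /= invgM invgK mulgA.
Qed.

(** Inversion turns the coset [x U] into the right translate [U x^-1], whose measure is that of [U]
    by unimodularity. *)
Lemma mu_preim_invg x : mu ((fun y => y^-1)%g @^-1` coset U x) = 1%E.
Proof.
rewrite -(hp_muU hp) -(hp_unimodular hp (hp_haar hp) x^-1%g mU).
congr (mu _); apply/seteqP; split=> y; rewrite /coset /=.
  by move=> /UV h; exists (y * x)%g; rewrite ?mulgK //; move: h; rewrite invgM !invgK.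
by move=> [z Uz <-]; rewrite invgM invgK mulKg; exact: UV.
Qed.

Lemma cintegral_mulgl F g : rinv U F ->
  cintegral mu setT (fun x => F (g * x)%g) = cintegral mu setT F.
Proof.
apply: (@cintegral_preserving (fun y => g * y)%g); first exact: mulg_continuousl.
exact: mu_preim_mulgl.
Qed.

Lemma cintegral_invg F : rinv U F ->
  cintegral mu setT (fun x => F (x^-1)%g) = cintegral mu setT F.
Proof.
apply: (@cintegral_preserving (fun y => y^-1)%g); first exact: invg_continuous.
exact: mu_preim_invg.
Qed.

Definition lnorm F : \bar R := (\int[mu]_x (cabs (F x))%:E)%E.

Lemma lnorm_ge0 F : (0 <= lnorm F)%E.
Proof. by apply: integral_ge0 => x _; rewrite lee_fin cabs_ge0. Qed.

Lemma rinv_cabs F : rinv U F -> rinv U (fun x => cabs (F x)).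
Proof. by move=> h g u Uu; rewrite h. Qed.

Lemma measurable_cabs F : rinv U F ->
  measurable_fun [set: borel G] (fun x : borel G => (cabs (F x))%:E).
Proof.
move=> h; apply/measurable_EFinP; apply: (rinv_measurable subU openU).
exact: rinv_cabs.
Qed.

Lemma lnorm_mulgl F g : rinv U F -> lnorm (fun x => F (g * x)%g) = lnorm F.
Proof.
move=> /rinv_cabs h; apply: (@ge0_integral_preserving (fun y => g * y)%g _ _ (fun x => cabs (F x))) => //.
- exact: mulg_continuousl.
- exact: mu_preim_mulgl.
- by move=> x; exact: cabs_ge0.
Qed.

Lemma lnorm_invg F : rinv U F -> lnorm (fun x => F (x^-1)%g) = lnorm F.
Proof.
move=> /rinv_cabs h; apply: (@ge0_integral_preserving (fun y => y^-1)%g _ _ (fun x => cabs (F x))) => //.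
- exact: invg_continuous.
- exact: mu_preim_invg.
- by move=> x; exact: cabs_ge0.
Qed.

Lemma le_lnorm F1 F2 : rinv U F1 -> rinv U F2 ->
  (forall x, cabs (F1 x) <= cabs (F2 x)) -> (lnorm F1 <= lnorm F2)%E.
Proof.
move=> h1 h2 le; apply: ge0_le_integral => //.
- by move=> x _; rewrite lee_fin cabs_ge0.
- exact: measurable_cabs.
- exact: measurable_cabs.
- by move=> x _; rewrite lee_fin.
Qed.

Lemma lnormD F1 F2 : rinv U F1 -> rinv U F2 ->
  (lnorm (fun x => F1 x + F2 x)%R <= lnorm F1 + lnorm F2)%E.
Proof.
move=> h1 h2; rewrite /lnorm -ge0_integralD //; first last.
- exact: measurable_cabs.
- by move=> x _; rewrite lee_fin cabs_ge0.
- exact: measurable_cabs.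
- by move=> x _; rewrite lee_fin cabs_ge0.
apply: ge0_le_integral => //.
- by move=> x _; rewrite lee_fin cabs_ge0.
- by apply: measurable_cabs => g u Uu; rewrite h1 // h2.
- by apply: emeasurable_funD; exact: measurable_cabs.
- by move=> x _; rewrite -EFinD lee_fin cabsD.
Qed.

Lemma lnormZ c F : rinv U F -> lnorm (fun x => c * F x) = ((cabs c)%:E * lnorm F)%E.
Proof.
move=> h; rewrite /lnorm -ge0_integralZl_EFin ?cabs_ge0 //.
- by apply: eq_integral => x _; rewrite cabsM EFinM.
- by move=> x _; rewrite lee_fin cabs_ge0.
- exact: measurable_cabs.
Qed.

(** A coset has mass 1, so each value is one term of the sum giving the norm. Integrable biinvariant
    functions are therefore bounded, and their convolutions converge at every point. *)
Lemma cabs_le_lnorm F x : rinv U F -> ((cabs (F x))%:E <= lnorm F)%E.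
Proof.
move=> h; have := @le_integral_fset _ _ subU openU _ mu mu_coset
  (fun x => cabs (F x)) [fset crep U x]%fset.
rewrite big_seq_fset1 (rinv_crep _ _ (rinv_cabs h)) //; apply => //.
- by move=> y /=; rewrite in_fset1 => /eqP ->; exists x.
- exact: rinv_cabs.
- by move=> y; exact: cabs_ge0.
Qed.

Section Integrable.
Variable F : G -> C.
Hypotheses (Finv : rinv U F) (Ffin : (lnorm F < +oo)%E).

Lemma integrable_Re : mu.-integrable setT (fun x : borel G => (complex.Re (F x))%:E).
Proof.
apply/integrableP; split.
  apply/measurable_EFinP; apply: (rinv_measurable subU openU) => g u Uu.
  by rewrite Finv.
apply: le_lt_trans Ffin; apply: ge0_le_integral => //.
- apply/measurableT_comp => //; apply/measurable_EFinP.
  by apply: (rinv_measurable subU openU) => g u Uu; rewrite Finv.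
- exact: measurable_cabs.
- by move=> x _; rewrite lee_fin Re_le_cabs.
Qed.

Lemma integrable_Im : mu.-integrable setT (fun x : borel G => (complex.Im (F x))%:E).
Proof.
apply/integrableP; split.
  apply/measurable_EFinP; apply: (rinv_measurable subU openU) => g u Uu.
  by rewrite Finv.
apply: le_lt_trans Ffin; apply: ge0_le_integral => //.
- apply/measurableT_comp => //; apply/measurable_EFinP.
  by apply: (rinv_measurable subU openU) => g u Uu; rewrite Finv.
- exact: measurable_cabs.
- by move=> x _; rewrite lee_fin Im_le_cabs.
Qed.
End Integrable.
End HeckePair.

(** * Complex integrals and finite sums over cosets *)

Section HeckeIntegrals.
Variables (R : realType) (G : topologicalGroupType).
Variables (mu : {measure set (borel G) -> \bar R}) (U : set G).
Local Notation C := R[i].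
Local Notation CI := (cintegral mu setT).
Local Notation lnorm := (lnorm mu).
Implicit Types F f : G -> C.

Hypothesis hp : hecke_pair mu U.
Let subU := hp_subgroup hp.
Let openU := hp_open hp.
Let U1 : U 1%g. Proof. by case: subU. Qed.

Definition rintegrable F := rinv U F /\ (lnorm F < +oo)%E.

Lemma rintegrable_le F1 F2 : rinv U F1 -> rintegrable F2 ->
  (forall x, cabs (F1 x) <= cabs (F2 x)) -> rintegrable F1.
Proof. by move=> h1 [h2 h] le; split=> //; apply: le_lt_trans h; apply: (le_lnorm hp). Qed.

Lemma rintegrableD F1 F2 : rintegrable F1 -> rintegrable F2 ->
  rintegrable (fun x => F1 x + F2 x).
Proof.
move=> [h1 f1] [h2 f2]; split; first by move=> g u Uu; rewrite h1 // h2.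
by rewrite (le_lt_trans (lnormD hp h1 h2)) // lte_add_pinfty.
Qed.

Lemma rintegrableZ c F : rintegrable F -> rintegrable (fun x => c * F x).
Proof.
move=> [h f]; split; first by move=> g u Uu; rewrite h.
by rewrite (lnormZ hp) // lte_mul_pinfty // ?lee_fin ?cabs_ge0.
Qed.

Lemma rintegrable0 : rintegrable (fun=> 0).
Proof.
split=> //; rewrite /lnorm; under eq_integral do rewrite cabs0.
by rewrite integral0.
Qed.

Definition cintegrable (D : set G) F :=
  mu.-integrable (D : set (borel G)) (fun x : borel G => (complex.Re (F x))%:E) /\
  mu.-integrable (D : set (borel G)) (fun x : borel G => (complex.Im (F x))%:E).

Section CIntegrable.
Variable D : set G.
Hypothesis mD : measurable (D : set (borel G)).

Let ReD (c d : C) : complex.Re (c + d) = complex.Re c + complex.Re d.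
Proof. by case: c d => [? ?] [? ?]. Qed.
Let ImD (c d : C) : complex.Im (c + d) = complex.Im c + complex.Im d.
Proof. by case: c d => [? ?] [? ?]. Qed.
Let ReM (c d : C) : complex.Re (c * d) =
  complex.Re c * complex.Re d + (- complex.Im c) * complex.Im d.
Proof. by case: c d => [? ?] [? ?]; rewrite mulNr. Qed.
Let ImM (c d : C) : complex.Im (c * d) =
  complex.Re c * complex.Im d + complex.Im c * complex.Re d.
Proof. by case: c d => [? ?] [? ?]. Qed.

Let integrableZlR r (H : G -> R) :
  mu.-integrable (D : set (borel G)) (fun x : borel G => (H x)%:E) ->
  mu.-integrable (D : set (borel G)) (fun x : borel G => (r * H x)%:E).
Proof. by move=> iH; under eq_fun do rewrite EFinM; exact: integrableZl. Qed.

Lemma cintegrable0 : cintegrable D (fun=> 0).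
Proof. by split; exact: integrable0. Qed.

Lemma cintegrableD F1 F2 : cintegrable D F1 -> cintegrable D F2 ->
  cintegrable D (fun x => F1 x + F2 x).
Proof.
move=> [h1 k1] [h2 k2]; split.
  by under eq_fun do rewrite ReD EFinD; exact: integrableD.
by under eq_fun do rewrite ImD EFinD; exact: integrableD.
Qed.

Lemma cintegrableZ c F : cintegrable D F -> cintegrable D (fun x => c * F x).
Proof.
move=> [h k]; split.
  by under eq_fun do rewrite ReM EFinD; apply: integrableD => //; exact: integrableZlR.
by under eq_fun do rewrite ImM EFinD; apply: integrableD => //; exact: integrableZlR.
Qed.

Lemma cintegralD_on F1 F2 : cintegrable D F1 -> cintegrable D F2 ->
  cintegral mu D (fun x => F1 x + F2 x) = cintegral mu D F1 + cintegral mu D F2.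
Proof.
move=> [h1 k1] [h2 k2]; rewrite /cintegral.
under eq_Rintegral do rewrite ReD.
under [X in Complex _ X]eq_Rintegral do rewrite ImD.
by rewrite !RintegralD.
Qed.

Lemma cintegralZ_on c F : cintegrable D F ->
  cintegral mu D (fun x => c * F x) = c * cintegral mu D F.
Proof.
move=> [h k]; rewrite /cintegral.
under eq_Rintegral do rewrite ReM.
under [X in Complex _ X]eq_Rintegral do rewrite ImM.
rewrite !RintegralD //; try exact: integrableZlR.
rewrite !RintegralZl //; case: c => a b.
by rewrite /= mulNr.
Qed.

Lemma cintegral_sum_on (I : eqType) (s : seq I) (F : I -> G -> C) :
  (forall i, i \in s -> cintegrable D (F i)) ->
  cintegrable D (fun x => \sum_(i <- s) F i x) /\
  cintegral mu D (fun x => \sum_(i <- s) F i x) = \sum_(i <- s) cintegral mu D (F i).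
Proof.
elim: s => [|i s IH] h.
  have -> : (fun x => \sum_(i <- [::]) F i x) = (fun=> 0).
    by apply/funext => x; rewrite big_nil.
  split; first exact: cintegrable0.
  rewrite big_nil /cintegral.
  by rewrite /Rintegral !integral0.
have [|h1 h2] := IH; first by move=> j js; apply: h; rewrite inE js orbT.
have hi : cintegrable D (F i) by apply: h; rewrite inE eqxx.
have -> : (fun x => \sum_(j <- i :: s) F j x) = (fun x => F i x + \sum_(j <- s) F j x).
  by apply/funext => x; rewrite big_cons.
by split; [exact: cintegrableD|rewrite cintegralD_on // big_cons h2].
Qed.

End CIntegrable.

Lemma rintegrable_cintegrable F : rintegrable F -> cintegrable setT F.
Proof. by move=> [h f]; split; [exact: (integrable_Re hp)|exact: (integrable_Im hp)]. Qed.

Lemma cintegralD F1 F2 : rintegrable F1 -> rintegrable F2 ->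
  CI (fun x => F1 x + F2 x) = CI F1 + CI F2.
Proof. by move=> h1 h2; apply: cintegralD_on => //; exact: rintegrable_cintegrable. Qed.

Lemma cintegralZ c F : rintegrable F -> CI (fun x => c * F x) = c * CI F.
Proof. by move=> h; apply: cintegralZ_on => //; exact: rintegrable_cintegrable. Qed.

Lemma cintegral_sum (I : eqType) (s : seq I) (F : I -> G -> C) :
  (forall i, i \in s -> rintegrable (F i)) ->
  rintegrable (fun x => \sum_(i <- s) F i x) /\
  CI (fun x => \sum_(i <- s) F i x) = \sum_(i <- s) CI (F i).
Proof.
move=> h; split; last first.
  by apply: (cintegral_sum_on _ _).2 => // i /h; exact: rintegrable_cintegrable.
elim: s h => [|i s IH] h.
  by under eq_fun do rewrite big_nil; exact: rintegrable0.
under eq_fun do rewrite big_cons.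
apply: rintegrableD; first by apply: h; rewrite inE eqxx.
by apply: IH => j js; apply: h; rewrite inE js orbT.
Qed.

Lemma cintegral_le F : rintegrable F -> ((cabs (CI F))%:E <= lnorm F)%E.
Proof.
move=> hF; have [z0|z0] := eqVneq (CI F) 0.
  by rewrite z0 cabs0; exact: lnorm_ge0.
(* The phase that rotates the integral onto the positive real axis, where it is the integral of a
   real part. *)
pose c := (CI F)^* / `|CI F|.
have cn : cabs c = 1.
  rewrite /cabs normrM normfV norm_conjC normr_id divff ?normr_eq0 //.
have cE : c * CI F = (cabs (CI F))%:C%C.
  by rewrite cabsE mulrAC [_^* * _]mulrC -normCK expr2 mulfK ?normr_eq0.
have hc := rintegrableZ c hF.
have -> : (cabs (CI F))%:E = (\int[mu]_x (complex.Re (c * F x))%:E)%E.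
  have := cintegralZ c hF; rewrite cE => /(congr1 (@complex.Re _)) /= <-.
  rewrite fineK //; apply: integrable_fin_num => //.
  by case: hc => h1 h2; exact: (integrable_Re hp).
have -> : lnorm F = lnorm (fun x => c * F x).
  by case: hF => h1 _; rewrite (lnormZ hp) // cn mul1e.
case: hc => h1 h2; apply: le_trans (lee_abs _) _.
apply: le_trans (le_abse_integral _ _ _) _ => //.
  exact: measurable_int (integrable_Re hp h1 h2).
apply: ge0_le_integral => //.
- apply/measurableT_comp => //; exact: measurable_int (integrable_Re hp h1 h2).
- exact: (measurable_cabs hp).
- by move=> x _; rewrite lee_fin Re_le_cabs.
Qed.

(** The form in which compact support is used: a finite set of representatives, possibly too large,
    of the cosets carrying [F]. *)
Definition fsup (F : G -> C) (A : {fset G}) :=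
  [set` A] `<=` creps U /\ forall x, F x != 0 -> crep U x \in A.

Lemma fsup_coset (F : G -> C) (A : {fset G}) y : rinv U F -> fsup F A ->
  F y = \sum_(x <- A) F x * (\1_(coset U x) y)%:C%C.
Proof.
move=> Finv [Acr FA].
have [yA|yA] := boolP (crep U y \in A).
  rewrite (big_fsetD1 (crep U y)) //= indicE mem_set; last first.
    by apply/(crepP subU); rewrite (crepK subU).
  rewrite mulr1 (rinv_crep subU) // big1_fset ?addr0 // => x.
  rewrite in_fsetD1 => /andP[xy xA] _; rewrite indicE memNset ?mulr0 //.
  move=> /(crepP subU) xy'; move/eqP: xy; apply; rewrite -xy'.
  by have [z _ <-] := Acr _ xA; rewrite (crepK subU).
have -> : F y = 0 by apply/eqP; apply: contraNT yA; exact: FA.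
rewrite big1_fset // => x xA _; rewrite indicE memNset ?mulr0 //.
move=> /(crepP subU) xy; move/negP: yA; apply; rewrite -xy.
by have [z _ ez] := Acr _ xA; rewrite -ez (crepK subU) ez.
Qed.

Lemma rinv_indic x : rinv U (fun y => (\1_(coset U x) y)%:C%C : C).
Proof.
move=> g u Uu; rewrite !indicE; congr (_%:C%C); congr (_%:R); congr nat_of_bool.
apply/idP/idP => /set_mem/(crepP subU) h; apply/mem_set/(crepP subU).
  by rewrite h (crepM subU).
by rewrite (crepM subU).
Qed.

Lemma lnorm_indic x : lnorm (fun y => (\1_(coset U x) y)%:C%C) = 1%E.
Proof.
rewrite /lnorm.
have e y : cabs ((\1_(coset U x) y)%:C%C : C) = \1_(coset U x) y.
  by rewrite cabs_real ger0_norm // indicE.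
under eq_integral do rewrite e.
by rewrite integral_indic ?setIT ?(mu_coset hp) //; apply: open_borel; exact: (coset_open openU).
Qed.

Lemma cintegral_indic x : CI (fun y => (\1_(coset U x) y)%:C%C) = 1.
Proof.
rewrite /cintegral /= Rintegral_cst // mul0r /Rintegral.
by rewrite integral_indic ?setIT ?(mu_coset hp) //; apply: open_borel; exact: (coset_open openU).
Qed.

Lemma fsup_integral F A : rinv U F -> fsup F A ->
  rintegrable F /\ CI F = \sum_(x <- A) F x.
Proof.
move=> Finv FA.
have FE : F = fun y => \sum_(x <- A) F x * (\1_(coset U x) y)%:C%C.
  by apply/funext => y; exact: fsup_coset.
have ri x : rintegrable (fun y => (\1_(coset U x) y)%:C%C).
  by split; [exact: rinv_indic|rewrite lnorm_indic ltry].
have [|h1 h2] := @cintegral_sum _ A (fun x y => F x * (\1_(coset U x) y)%:C%C).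
  by move=> x _; exact: rintegrableZ.
split; first by rewrite FE.
rewrite [in LHS]FE h2; apply: eq_bigr => x _.
by rewrite cintegralZ // cintegral_indic mulr1.
Qed.

Lemma L1E f : L1 mu U f <-> biinvariant U f /\ (lnorm f < +oo)%E.
Proof.
split=> [[bf /integrableP[mRe iRe] /integrableP[mIm iIm]]|[bf ff]]; last first.
  have rf : rinv U f by move=> g u Uu; rewrite -{1}[g]mul1g bf.
  by split=> //; [exact: (integrable_Re hp)|exact: (integrable_Im hp)].
split=> //; have rf : rinv U f by move=> g u Uu; rewrite -{1}[g]mul1g bf.
apply: (@le_lt_trans _ _ (\int[mu]_x (`|(complex.Re (f x))%:E| + `|(complex.Im (f x))%:E|)))%E.
  apply: ge0_le_integral => //.
  - by move=> x _; rewrite lee_fin cabs_ge0.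
  - exact: (measurable_cabs hp).
  - by apply: emeasurable_funD; apply: measurableT_comp.
  - by move=> x _; rewrite /= -EFinD lee_fin cabs_le_ReIm.
rewrite ge0_integralD //; [exact: lte_add_pinfty|exact: measurableT_comp..].
Qed.

End HeckeIntegrals.

(** Stands in for Tonelli's theorem on [G], where [mu] need not be sigma-finite. *)
Lemma esum_exchange (R : realType) (I J : choiceType) (A : set I) (B : set J)
    (a : I -> J -> \bar R) : (forall i j, (0 <= a i j)%E) ->
  (\esum_(i in A) \esum_(j in B) a i j = \esum_(j in B) \esum_(i in A) a i j)%E.
Proof.
move=> a0; rewrite (@esum_esum _ _ _ A (fun=> B)) // (@esum_esum _ _ _ B (fun=> A)) //.
apply: (@reindex_esum _ _ _ _ _ (fun k => (k.2, k.1)) (fun k => a k.1 k.2)).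
split.
- by move=> [j i] /= [].
- by move=> [j i] [j' i'] _ _ /= [-> ->].
- by move=> [i j] /= [? ?]; exists (j, i).
Qed.

(** * Convolution *)

Section Convolution.
Variables (R : realType) (G : topologicalGroupType).
Variables (mu : {measure set (borel G) -> \bar R}) (U : set G).
Local Notation C := R[i].
Local Notation lnorm := (lnorm mu).
Local Notation conv := (convolution mu).
Implicit Types F f : G -> C.

Hypothesis hp : hecke_pair mu U.
Let subU := hp_subgroup hp.
Let openU := hp_open hp.
Let U1 : U 1%g. Proof. by case: subU. Qed.
Let UV x : U x -> U (x^-1)%g. Proof. by case: subU => _ _; exact. Qed.

Lemma biinv_rinv f : biinvariant U f -> rinv U f.
Proof. by move=> bf g u Uu; rewrite -{1}[g]mul1g bf. Qed.

Lemma biinv_linv f u g : biinvariant U f -> U u -> f (u * g)%g = f g.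
Proof. by move=> bf Uu; rewrite -[(u * g)%g]mulg1 bf. Qed.

Lemma biinvP f : rinv U f -> (forall u g, U u -> f (u * g)%g = f g) -> biinvariant U f.
Proof. by move=> h1 h2 g u1 u2 Uu1 Uu2; rewrite h1 // h2. Qed.

Lemma biinv_inv f : biinvariant U f -> biinvariant U (fun g => f (g^-1)%g).
Proof.
by move=> bf g u1 u2 Uu1 Uu2; rewrite !invgM -(bf g^-1%g _ _ (UV Uu2) (UV Uu1)) mulgA.
Qed.

Definition L1norm f : R := fine (lnorm f).

Lemma L1_biinv f : L1 mu U f -> biinvariant U f.
Proof. by case. Qed.

Lemma L1_rinv f : L1 mu U f -> rinv U f.
Proof. by move/L1_biinv/biinv_rinv. Qed.

Lemma L1normE f : L1 mu U f -> lnorm f = (L1norm f)%:E.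
Proof.
by move=> /(L1E hp) [_ h]; rewrite /L1norm fineK // ge0_fin_numE // lnorm_ge0.
Qed.

Lemma L1norm_ge0 f : 0 <= L1norm f.
Proof. by apply: fine_ge0; exact: lnorm_ge0. Qed.

Lemma L1_rintegrable f : L1 mu U f -> rintegrable mu U f.
Proof. by move=> /(L1E hp) [/biinv_rinv]. Qed.

Lemma rintegrable_L1 f : biinvariant U f -> rintegrable mu U f -> L1 mu U f.
Proof. by move=> bf [_ h]; apply/(L1E hp). Qed.

Lemma cabs_le_L1norm f x : L1 mu U f -> cabs (f x) <= L1norm f.
Proof. by move=> Lf; rewrite -lee_fin -L1normE // (cabs_le_lnorm hp) //; exact: L1_rinv. Qed.

Lemma biinvD f1 f2 : biinvariant U f1 -> biinvariant U f2 ->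
  biinvariant U (fun x => f1 x + f2 x).
Proof. by move=> b1 b2 g u1 u2 h1 h2; rewrite b1 // b2. Qed.

Lemma biinvZ c f : biinvariant U f -> biinvariant U (fun x => c * f x).
Proof. by move=> b g u1 u2 h1 h2; rewrite b. Qed.

Lemma biinv_invol f : biinvariant U f -> biinvariant U (invol f).
Proof. by move=> /biinv_inv b g u1 u2 h1 h2; rewrite /invol b. Qed.

Lemma L1D f1 f2 : L1 mu U f1 -> L1 mu U f2 -> L1 mu U (fun x => f1 x + f2 x).
Proof.
move=> h1 h2; apply: rintegrable_L1; first by apply: biinvD; exact: L1_biinv.
by apply: (rintegrableD hp); exact: L1_rintegrable.
Qed.

Lemma L1Z c f : L1 mu U f -> L1 mu U (fun x => c * f x).
Proof.
move=> h; apply: rintegrable_L1; first by apply: biinvZ; exact: L1_biinv.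
by apply: (rintegrableZ hp); exact: L1_rintegrable.
Qed.

Lemma L1B f1 f2 : L1 mu U f1 -> L1 mu U f2 -> L1 mu U (fun x => f1 x - f2 x).
Proof.
move=> h1 h2; have := L1D h1 (L1Z (-1) h2).
by congr (L1 mu U _); apply/funext => x; rewrite mulN1r.
Qed.

Lemma L1normD f1 f2 : L1 mu U f1 -> L1 mu U f2 ->
  L1norm (fun x => f1 x + f2 x) <= L1norm f1 + L1norm f2.
Proof.
move=> h1 h2; rewrite -lee_fin EFinD -!L1normE //; last exact: L1D.
by apply: (lnormD hp); exact: L1_rinv.
Qed.

Lemma L1normZ c f : L1 mu U f -> L1norm (fun x => c * f x) = cabs c * L1norm f.
Proof.
move=> h; apply: EFin_inj; rewrite EFinM -!L1normE //; last exact: L1Z.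
by rewrite (lnormZ hp) //; exact: L1_rinv.
Qed.

Lemma L1normB f1 f2 : L1 mu U f1 -> L1 mu U f2 ->
  L1norm (fun x => f1 x - f2 x) <= L1norm f1 + L1norm f2.
Proof.
move=> h1 h2; have := L1normD h1 (L1Z (-1) h2).
rewrite L1normZ // cabsN cabs1 mul1r; congr (L1norm _ <= _).
by apply/funext => x; rewrite mulN1r.
Qed.

Lemma lnorm_invol f : biinvariant U f -> lnorm (invol f) = lnorm f.
Proof.
move=> /biinv_rinv rf; rewrite -[RHS](lnorm_invg hp rf) /lnorm.
by apply: eq_integral => x _; rewrite cabs_conj.
Qed.

Lemma L1_invol f : L1 mu U f -> L1 mu U (invol f).
Proof.
move=> /(L1E hp) [bf ff]; apply/(L1E hp); split; first exact: biinv_invol.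
by rewrite lnorm_invol.
Qed.

Lemma L1norm_invol f : L1 mu U f -> L1norm (invol f) = L1norm f.
Proof. by move=> Lf; rewrite /L1norm lnorm_invol //; exact: L1_biinv. Qed.

(** Left invariance of [f2] is what makes the integrand right invariant in [h], so that a
    convolution is a sum over cosets. *)
Lemma rinv_conv f1 f2 g : biinvariant U f1 -> biinvariant U f2 ->
  rinv U (fun h => f1 h * f2 (h^-1 * g)%g).
Proof.
move=> b1 b2 h u Uu; rewrite (biinv_rinv b1) // invgM -mulgA (biinv_linv _ b2) //.
exact: UV.
Qed.

Lemma conv_integrable f1 f2 g : L1 mu U f1 -> L1 mu U f2 ->
  rintegrable mu U (fun h => f1 h * f2 (h^-1 * g)%g).
Proof.
move=> L1f L2f; have := rintegrableZ hp (L1norm f2)%:C%C (L1_rintegrable L1f).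
move=> i1; apply: (rintegrable_le hp _ i1).
  by apply: rinv_conv; exact: L1_biinv.
move=> x; rewrite !cabsM cabs_real ger0_norm ?L1norm_ge0 // mulrC.
by rewrite ler_wpM2r ?cabs_ge0 // cabs_le_L1norm.
Qed.

Lemma biinv_conv f1 f2 : biinvariant U f1 -> biinvariant U f2 ->
  biinvariant U (conv f1 f2).
Proof.
move=> b1 b2; apply: biinvP => [g u Uu|u g Uu]; rewrite /convolution.
  congr (cintegral _ _ _); apply/funext => h.
  by rewrite mulgA (biinv_rinv b2).
rewrite -(cintegral_mulgl hp u (rinv_conv (u * g)%g b1 b2)).
congr (cintegral _ _ _); apply/funext => h.
by rewrite (biinv_linv _ b1) // invgM -mulgA mulKg.
Qed.

(** Over [creps U] both integrals are sums and can be exchanged; the inner one is then the norm of a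
    translate of [f2], scaled by a value of [f1]. *)
Lemma lnorm_conv f1 f2 : L1 mu U f1 -> L1 mu U f2 ->
  (lnorm (conv f1 f2) <= lnorm f1 * lnorm f2)%E.
Proof.
move=> Lf1 Lf2; have [b1 b2] := (L1_biinv Lf1, L1_biinv Lf2).
have IE F : rinv U F -> lnorm F = (\esum_(x in creps U) (cabs (F x))%:E)%E.
  move=> rF; apply: (integral_esum subU openU (mu_coset hp)) => [g u Uu|x].
    by rewrite rF.
  exact: cabs_ge0.
rewrite IE; last by apply: biinv_rinv; exact: biinv_conv.
apply: (@le_trans _ _ (\esum_(g in creps U) \esum_(h in creps U)
    (cabs (f1 h * f2 (h^-1 * g)%g))%:E)%E).
  apply: le_esum => g _; rewrite -(IE (fun h => f1 h * f2 (h^-1 * g)%g)).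
    by apply: (cintegral_le hp); exact: conv_integrable.
  exact: rinv_conv.
rewrite esum_exchange; last by move=> *; rewrite lee_fin cabs_ge0.
have -> : (\esum_(h in creps U) \esum_(g in creps U)
    (cabs (f1 h * f2 (h^-1 * g)%g))%:E)%E =
    (\esum_(h in creps U) (cabs ((L1norm f2)%:C%C * f1 h))%:E)%E.
  apply: eq_esum => h _; rewrite -(IE (fun g => f1 h * f2 (h^-1 * g)%g)); last first.
    by apply: (@rinv_lmul _ _ _ (fun g => f1 h * f2 g)) => g u Uu; rewrite (biinv_rinv b2).
  rewrite (lnormZ hp (f1 h) (F := fun g => f2 (h^-1 * g)%g)); last first.
    by apply: rinv_lmul; exact: biinv_rinv.
  rewrite (lnorm_mulgl hp) ?L1normE //; last exact: biinv_rinv.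
  by rewrite -EFinM cabsM cabs_real ger0_norm ?L1norm_ge0 // mulrC.
rewrite -(IE (fun h => (L1norm f2)%:C%C * f1 h)).
  rewrite (lnormZ hp); last exact: biinv_rinv.
  by rewrite cabs_real ger0_norm ?L1norm_ge0 // -L1normE // muleC.
by move=> g u Uu; rewrite (biinv_rinv b1).
Qed.

Lemma L1_conv f1 f2 : L1 mu U f1 -> L1 mu U f2 -> L1 mu U (conv f1 f2).
Proof.
move=> h1 h2; apply/(L1E hp); split; first by apply: biinv_conv; exact: L1_biinv.
by rewrite (le_lt_trans (lnorm_conv h1 h2)) // !L1normE // -EFinM ltry.
Qed.

Lemma L1norm_conv f1 f2 : L1 mu U f1 -> L1 mu U f2 ->
  L1norm (conv f1 f2) <= L1norm f1 * L1norm f2.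
Proof.
by move=> h1 h2; rewrite -lee_fin EFinM -!L1normE ?lnorm_conv //; exact: L1_conv.
Qed.

Lemma convDl f1 f2 f3 : L1 mu U f1 -> L1 mu U f2 -> L1 mu U f3 ->
  conv (fun x => f1 x + f2 x) f3 = (fun x => conv f1 f3 x + conv f2 f3 x).
Proof.
move=> h1 h2 h3; apply/funext => g; rewrite /convolution.
rewrite -(cintegralD hp); [|exact: conv_integrable..].
by congr (cintegral _ _ _); apply/funext => h; rewrite mulrDl.
Qed.

Lemma convDr f1 f2 f3 : L1 mu U f1 -> L1 mu U f2 -> L1 mu U f3 ->
  conv f1 (fun x => f2 x + f3 x) = (fun x => conv f1 f2 x + conv f1 f3 x).
Proof.
move=> h1 h2 h3; apply/funext => g; rewrite /convolution.
rewrite -(cintegralD hp); [|exact: conv_integrable..].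
by congr (cintegral _ _ _); apply/funext => h; rewrite mulrDr.
Qed.

Lemma convZl c f1 f2 : L1 mu U f1 -> L1 mu U f2 ->
  conv (fun x => c * f1 x) f2 = (fun x => c * conv f1 f2 x).
Proof.
move=> h1 h2; apply/funext => g; rewrite /convolution.
rewrite -(cintegralZ hp); last exact: conv_integrable.
by congr (cintegral _ _ _); apply/funext => h; rewrite mulrA.
Qed.

Lemma convZr c f1 f2 : L1 mu U f1 -> L1 mu U f2 ->
  conv f1 (fun x => c * f2 x) = (fun x => c * conv f1 f2 x).
Proof.
move=> h1 h2; apply/funext => g; rewrite /convolution.
rewrite -(cintegralZ hp); last exact: conv_integrable.
by congr (cintegral _ _ _); apply/funext => h; rewrite mulrCA.
Qed.

Lemma convBr f1 f2 f3 : L1 mu U f1 -> L1 mu U f2 -> L1 mu U f3 ->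
  conv f1 (fun x => f2 x - f3 x) = (fun x => conv f1 f2 x - conv f1 f3 x).
Proof.
move=> h1 h2 h3; have := convDr h1 h2 (L1Z (-1) h3).
rewrite convZr // => e.
transitivity (conv f1 (fun x => f2 x + -1 * f3 x)).
  by congr (conv _ _); apply/funext => x; rewrite mulN1r.
by rewrite e; apply/funext => x; rewrite mulN1r.
Qed.

Lemma compact_hecke f K : biinvariant U f -> compact K ->
  (forall x, f x != 0 -> K x) -> hecke U f.
Proof.
move=> bf cK fK; split=> //.
apply: (subclosed_compact _ cK); first exact: closed_closure.
have clK : closed K by apply: compact_closed => //; exact: hp_hausdorff hp.
by rewrite [X in _ `<=` X](closure_id K).1 //; exact: closure_subset.
Qed.

Lemma fsup_hecke f A : biinvariant U f -> fsup U f A -> hecke U f.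
Proof.
move=> bf [Acr fA].
pose K : set G := \big[setU/set0]_(x <- A) ((fun y => x * y)%g @` U).
apply: (@compact_hecke f K) => //.
  rewrite /K; elim/big_ind: _ => //.
  - exact: compact0.
  - by move=> X Y cX cY; exact: compactU.
  - move=> x _; apply: continuous_compact; last exact: hp_compact hp.
    by apply: continuous_subspaceT; exact: mulg_continuousl.
move=> x /fA xA; rewrite /K (big_fsetD1 _ xA) /=; left.
exists ((crep U x)^-1 * x)%g; last by rewrite mulVKg.
by apply/(crepP subU); rewrite (crepK subU).
Qed.

(** Cosets are open, so finitely many of them cover the compact support. *)
Lemma hecke_fsup f : hecke U f -> exists A, fsup U f A.
Proof.
move=> [bf]; rewrite compact_cover => /(_ G setT (coset U)) [||A _ fA].
- by move=> x _; exact: (coset_open openU).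
- by move=> x _; exists x => //; rewrite /coset /= mulVg.
exists [fset crep U x | x in A]%fset; split.
  by move=> x /= /imfsetP[y _ ->]; exists y.
move=> x fx; have [|y yA xy] := fA x; first exact: subset_closure.
by apply/imfsetP; exists y => //; symmetry; apply/(crepP subU).
Qed.

Lemma hecke_biinv f : hecke U f -> biinvariant U f. Proof. by case. Qed.

Lemma hecke_L1 f : hecke U f -> L1 mu U f.
Proof.
move=> hf; have bf := hecke_biinv hf; have [A fA] := hecke_fsup hf.
by apply: rintegrable_L1 => //; have [] := fsup_integral hp (biinv_rinv bf) fA.
Qed.

End Convolution.

(** * The Hecke algebra and its density in L1 *)

Section HeckeAlgebra.
Variables (R : realType) (G : topologicalGroupType).
Variables (mu : {measure set (borel G) -> \bar R}) (U : set G).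
Local Notation C := R[i].
Local Notation lnorm := (lnorm mu).
Local Notation L1norm := (L1norm mu).
Local Notation conv := (convolution mu).
Local Notation hecke := (hecke (R := R) U).
Local Notation L1 := (L1 mu U).
Implicit Types F f : G -> C.

Hypothesis hp : hecke_pair mu U.
Let subU := hp_subgroup hp.
Let openU := hp_open hp.
Let U1 : U 1%g. Proof. by case: subU. Qed.
Let UM x y : U x -> U y -> U (x * y)%g. Proof. by case: subU => _ + _; exact. Qed.
Let UV x : U x -> U (x^-1)%g. Proof. by case: subU => _ _; exact. Qed.

Lemma rintegrable_mulgl F g : rintegrable mu U F ->
  rintegrable mu U (fun x => F (g * x)%g).
Proof.
by move=> [h1 h2]; split; [exact: rinv_lmul|rewrite (lnorm_mulgl hp)].
Qed.

Lemma heckeD f1 f2 : hecke f1 -> hecke f2 -> hecke (fun x => f1 x + f2 x).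
Proof.
move=> [b1 c1] [b2 c2]; apply: (@compact_hecke _ _ _ _ hp _ _ (biinvD b1 b2) (compactU c1 c2)).
move=> x; have [z1|z1 _] := eqVneq (f1 x) 0; last by left; exact: subset_closure.
by rewrite z1 add0r; right; exact: subset_closure.
Qed.

Lemma heckeZ c f : hecke f -> hecke (fun x => c * f x).
Proof.
move=> [b k]; apply: (@compact_hecke _ _ _ _ hp _ _ (biinvZ c b) k) => x.
by rewrite mulf_eq0 negb_or => /andP[_ ?]; exact: subset_closure.
Qed.

Lemma hecke0 : hecke (fun=> 0).
Proof.
apply: (@compact_hecke _ _ _ _ hp _ set0) => //; first exact: compact0.
by move=> x; rewrite eqxx.
Qed.

Lemma hecke_invol f : hecke f -> hecke (invol f).
Proof.
move=> [b k]; have := continuous_compact (continuous_subspaceT (@invg_continuous G)) k.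
move/(compact_hecke hp (biinv_invol hp b)); apply => x fx.
exists (x^-1)%g; last by rewrite invgK.
by apply: subset_closure => /=; move: fx; rewrite /invol conjC_eq0.
Qed.

Lemma convE f1 f2 A g : fsup U f1 A -> biinvariant U f1 -> biinvariant U f2 ->
  conv f1 f2 g = \sum_(h <- A) f1 h * f2 (h^-1 * g)%g.
Proof.
move=> [Acr fA] b1 b2; rewrite /convolution.
have [] // := @fsup_integral _ _ _ _ hp (fun h => f1 h * f2 (h^-1 * g)%g) A.
  exact: (rinv_conv hp).
by split=> // x; rewrite mulf_eq0 negb_or => /andP[/fA].
Qed.

Lemma hecke_conv f1 f2 : hecke f1 -> hecke f2 -> hecke (conv f1 f2).
Proof.
move=> h1 h2; have [b1 b2] := (hecke_biinv h1, hecke_biinv h2).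
have [[A fA] [B fB]] := (hecke_fsup hp h1, hecke_fsup hp h2).
apply: (@fsup_hecke _ _ _ _ hp _ [fset crep U (a * b)%g | a in A, b in B]%fset).
  exact: (biinv_conv hp).
split; first by move=> x /= /imfset2P[a _ [b _ ->]]; exists (a * b)%g.
move=> x; rewrite (convE _ fA) // => nz.
have [a aA nz2] : exists2 a, a \in A & f1 a * f2 (a^-1 * x)%g != 0.
  apply: contrapT => no; move/eqP: nz; apply; rewrite big1_fset // => a aA _.
  by apply/eqP; apply: contrapT => /negP ne; apply: no; exists a.
move: nz2; rewrite mulf_eq0 negb_or => /andP[_ /(proj2 fB) bB].
apply/imfset2P; exists a => //; exists (crep U (a^-1 * x)%g) => //.
apply/(crepP subU); rewrite /coset /=.
have := coset_crep subU (a^-1 * x)%g; rewrite /coset /=.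
by rewrite invgM invgK mulgA.
Qed.

Definition hunit : G -> C := fun x => (\1_(coset U 1%g) x)%:C%C.

Lemma coset1 : coset U 1%g = U.
Proof. by apply/seteqP; split=> x; rewrite /coset /= invg1 mul1g. Qed.

Lemma hunitE x : hunit x = (if x \in U then 1 else 0).
Proof. by rewrite /hunit indicE coset1; case: (x \in U). Qed.

Lemma biinv_hunit : biinvariant U hunit.
Proof.
move=> g u1 u2 h1 h2; rewrite !hunitE; congr (if _ then _ else _).
apply/idP/idP => /set_mem h; apply: mem_set; last by apply: UM => //; exact: UM.
have := UM (UV h1) (UM h (UV h2)).
by rewrite mulgK mulKg.
Qed.

Lemma hecke_hunit : hecke hunit.
Proof.
apply: (compact_hecke hp biinv_hunit (hp_compact hp)) => x.
by rewrite hunitE; case: ifP => [/set_mem //|_]; rewrite eqxx.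
Qed.

Lemma conv1f f : biinvariant U f -> conv hunit f = f.
Proof.
move=> bf; apply/funext => g; rewrite /convolution.
have -> : (fun h => hunit h * f (h^-1 * g)%g) = (fun h => f g * hunit h).
  apply/funext => h; rewrite hunitE mulrC; case: ifP => [/set_mem Uh|_]; last by rewrite !mulr0.
  by rewrite (biinv_linv hp _ bf) //; exact: UV.
rewrite (cintegralZ hp) ?(cintegral_indic hp) ?mulr1 //.
by apply: (L1_rintegrable hp); exact: (hecke_L1 hp hecke_hunit).
Qed.

(** Convolving with [f1] is a finite combination of translates, so associativity reduces to a
    translation of the variable in each of finitely many integrals. *)
Lemma convA f1 f2 f3 : hecke f1 -> hecke f2 -> hecke f3 ->
  conv (conv f1 f2) f3 = conv f1 (conv f2 f3).
Proof.
move=> h1 h2 h3; have [A fA] := hecke_fsup hp h1.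
have [b1 [b2 b3]] := (hecke_biinv h1, (hecke_biinv h2, hecke_biinv h3)).
apply/funext => g; rewrite [RHS](convE _ fA) //; last exact: (biinv_conv hp).
rewrite {1}/convolution.
have -> : (fun h => conv f1 f2 h * f3 (h^-1 * g)%g) =
    (fun h => \sum_(k <- A) f1 k * (f2 (k^-1 * h)%g * f3 (h^-1 * g)%g)).
  apply/funext => h; rewrite (convE _ fA) // mulr_suml.
  by apply: eq_bigr => k _; rewrite mulrA.
have e k : (fun h => f2 (k^-1 * h)%g * f3 (h^-1 * g)%g) =
    (fun h => (fun h' => f2 h' * f3 (h'^-1 * (k^-1 * g))%g) (k^-1 * h)%g).
  by apply/funext => h /=; rewrite invgM invgK -mulgA mulVKg.
have ri k : rintegrable mu U (fun h => f2 h * f3 (h^-1 * (k^-1 * g))%g).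
  by apply: (conv_integrable hp); exact: (hecke_L1 hp).
have ri' k : rintegrable mu U (fun h => f2 (k^-1 * h)%g * f3 (h^-1 * g)%g).
  by rewrite e; exact: (rintegrable_mulgl k^-1%g (ri k)).
rewrite (cintegral_sum hp _).2; last by move=> k _; exact: (rintegrableZ hp).
apply: eq_bigr => k _; rewrite (cintegralZ hp) //; congr (_ * _).
by rewrite e; exact: (cintegral_mulgl hp k^-1%g (proj1 (ri k))).
Qed.

(** A finite set [X] of representatives captures the norm up to [e]. Cutting [f] off to the double
    cosets through [X], rather than to the cosets, preserves biinvariance, and double cosets are
    compact too. *)
Lemma hecke_dense f e : L1 f -> 0 < e ->
  exists2 g, hecke g & L1norm (fun x => f x - g x) < e.
Proof.
move=> Lf e0; have bf := L1_biinv Lf; have rf := biinv_rinv hp bf.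
have IE : lnorm f = (\esum_(x in creps U) (cabs (f x))%:E)%E.
  apply: (integral_esum subU openU (mu_coset hp)) => [g u Uu|x].
    by rewrite rf.
  exact: cabs_ge0.
have : ((L1norm f - e)%:E < \esum_(x in creps U) (cabs (f x))%:E)%E.
  by rewrite -IE (L1normE hp) // lte_fin ltrBlDr ltrDl.
move=> /ereal_sup_gt[_ [X [finX Xcr] <-]].
rewrite fsbig_finite //= => hX.
pose D := [set x | exists u v k, [/\ U u, U v, X k & x = (u * k * v)%g]].
pose g x : C := if x \in D then f x else 0.
have Dbi x u v : U u -> U v -> ((u * x * v)%g \in D) = (x \in D).
  move=> Uu Uv; apply/idP/idP => /set_mem [u' [v' [k [Uu' Uv' Xk e']]]]; apply/mem_set.
    exists (u^-1 * u')%g, (v' * v^-1)%g, k; split=> //; try by apply: UM => //; exact: UV.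
    have -> : x = (u^-1 * (u * x * v) * v^-1)%g by rewrite -!mulgA mulKg mulgV mulg1.
    by rewrite e' !mulgA.
  exists (u * u')%g, (v' * v)%g, k; split=> //; try by apply: UM.
  by rewrite e' !mulgA.
have bg : biinvariant U g by move=> x u v Uu Uv; rewrite /g Dbi // bf.
have hg : hecke g.
  pose K : set G := \big[setU/set0]_(k <- fset_set X)
    ((fun z : G * G => z.1 * k * z.2)%g @` (U `*` U)).
  apply: (@compact_hecke _ _ _ _ hp _ K) => //.
    rewrite /K; elim/big_ind: _ => //.
    - exact: compact0.
    - by move=> Y Z cY cZ; exact: compactU.
    - move=> k _; apply: continuous_compact; last first.
        by apply: compact_setX; exact: hp_compact hp.
      apply: continuous_subspaceT => z.
      apply: (@continuous_comp _ _ _ (fun z : G * G => ((z.1 * k)%g, z.2)) (fun z => (z.1 * z.2)%g)).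
        apply: cvg_pair; last exact: cvg_snd.
        apply: (@continuous_comp _ _ _ fst (fun x => (x * k)%g)); first exact: cvg_fst.
        exact: mulg_continuousr.
      exact: mulg_continuous.
  move=> x; rewrite /g; case: ifPn => [/set_mem[u [v [k [Uu Uv Xk ->]]]] _|]; last by rewrite eqxx.
  have kX : k \in fset_set X by rewrite in_fset_set //; exact: mem_set.
  by rewrite /K (big_fsetD1 _ kX) /=; left; exists (u, v).
exists g => //.
have Lg := hecke_L1 hp hg.
have Lfg := L1B hp Lf Lg.
(* At every point one of [g] and [f - g] vanishes, so the norms add exactly. *)
have sum : L1norm f = L1norm g + L1norm (fun x => f x - g x).
  apply: EFin_inj; rewrite EFinD -!(L1normE hp) // /lnorm -ge0_integralD //.
  - apply: eq_integral => x _; rewrite -EFinD; congr EFin; rewrite /g.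
    by case: ifP => _; rewrite ?subrr ?subr0 cabs0 ?addr0 ?add0r.
  - by move=> x _; rewrite lee_fin cabs_ge0.
  - by apply: (measurable_cabs hp); exact: (L1_rinv hp Lg).
  - by move=> x _; rewrite lee_fin cabs_ge0.
  - by apply: (measurable_cabs hp); exact: (L1_rinv hp Lfg).
have : L1norm f - e < L1norm g.
  rewrite -lte_fin -(L1normE hp Lg) (lt_le_trans hX) //.
  apply: le_trans (le_integral_fset subU openU (mu_coset hp) (F := fun x => cabs (g x)) (A := fset_set X) _ _ _).
  - rewrite big_seq [leRHS]big_seq; apply: lee_sum => x.
    rewrite in_fset_set // => /set_mem Xx; rewrite lee_fin /g ifT //.
    by apply/mem_set; exists 1%g, 1%g, x; split=> //; rewrite mul1g mulg1.
  - by rewrite fset_setK.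
  - by apply: rinv_cabs; exact: (biinv_rinv hp).
  - by move=> x; exact: cabs_ge0.
by rewrite sum; lra.
Qed.

End HeckeAlgebra.

(** * Neumann series in L1 *)

Section RealLimit.
Variable R : realType.
Local Notation C := R[i].

Lemma geometric_small (r c e : R) : 0 <= r < 1 -> 0 < e -> exists n, c * r ^+ n < e.
Proof.
move=> /andP[r0 r1] e0.
have cv : (fun n => c * r ^+ n) @ \oo --> (0 : R).
  by apply: cvg_geometric; rewrite ger0_norm.
have /cvgrPdist_lt /(_ e e0) [n _ /(_ n (leqnn n))] := cv.
rewrite sub0r normrN => h; exists n.
exact: le_lt_trans (ler_norm _) h.
Qed.

(** The limit of a sequence with known errors [b] is a supremum of lower bounds: every [u n - b n]
    lies below every [u k + b k]. *)
Lemma sup_limit (u b : nat -> R) :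
  (forall m n, (m <= n)%N -> `|u n - u m| <= b m) ->
  forall m, `|sup (range (fun n => u n - b n)) - u m| <= b m.
Proof.
move=> h m.
have b0 k : 0 <= b k by have := h k k (leqnn k); rewrite subrr normr0.
have ub k n : u n - b n <= u k + b k.
  have [kn|/ltnW nk] := leqP k n.
    by have := h k n kn; have := b0 n; rewrite ler_norml => ? /andP[]; lra.
  by have := h n k nk; have := b0 k; rewrite ler_norml => ? /andP[]; lra.
have le1 : sup (range (fun n => u n - b n)) <= u m + b m.
  by apply: ge_sup; [exists (u 0%N - b 0%N), 0%N|move=> _ [n _ <-]].
have le2 : u m - b m <= sup (range (fun n => u n - b n)).
  by apply: ub_le_sup; [exists (u 0%N + b 0%N) => _ [n _ <-]|exists m].
rewrite ler_norml; lra.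
Qed.

(** An explicit function of the sequence of values, so that a pointwise limit of biinvariant
    functions is biinvariant by congruence. *)
Definition climit (b : nat -> R) (u : nat -> C) : C :=
  Complex (sup (range (fun n => complex.Re (u n) - b n)))
          (sup (range (fun n => complex.Im (u n) - b n))).

(** The factor 2 adds the errors of the real and of the imaginary part. *)
Lemma climitP (b : nat -> R) (u : nat -> C) :
  (forall m n, (m <= n)%N -> cabs (u n - u m) <= b m) ->
  forall m, cabs (climit b u - u m) <= 2 * b m.
Proof.
move=> h m.
have ReB (c d : C) : complex.Re (c - d) = complex.Re c - complex.Re d.
  by case: c d => [? ?] [? ?].
have ImB (c d : C) : complex.Im (c - d) = complex.Im c - complex.Im d.
  by case: c d => [? ?] [? ?].
apply: le_trans (cabs_le_ReIm _) _; rewrite ReB ImB mulr_natl mulr2n.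
apply: lerD; apply: (sup_limit (u := fun n => _ (u n))) => {}m n mn.
  by rewrite -ReB (le_trans (Re_le_cabs _)) // h.
by rewrite -ImB (le_trans (Im_le_cabs _)) // h.
Qed.

End RealLimit.

Section Neumann.
Variables (R : realType) (G : topologicalGroupType).
Variables (mu : {measure set (borel G) -> \bar R}) (U : set G).
Local Notation C := R[i].
Local Notation lnorm := (lnorm mu).
Local Notation L1norm := (L1norm mu).
Local Notation conv := (convolution mu).
Local Notation L1 := (L1 mu U).
Implicit Types F f : G -> C.

Hypothesis hp : hecke_pair mu U.
Let subU := hp_subgroup hp.
Let openU := hp_open hp.

Lemma lnorm_le_fset F (M : R) : rinv U F ->
  (forall A : {fset G}, [set` A] `<=` creps U -> \sum_(x <- A) cabs (F x) <= M) ->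
  (lnorm F <= M%:E)%E.
Proof.
move=> rF h.
have -> : lnorm F = (\esum_(x in creps U) (cabs (F x))%:E)%E.
  apply: (integral_esum subU openU (mu_coset hp)) => [g u Uu|x].
    by rewrite rF.
  exact: cabs_ge0.
apply: ge_ereal_sup => _ [X [finX Xcr] <-].
by rewrite fsbig_finite //= sumEFin lee_fin h // fset_setK.
Qed.

Lemma le_L1norm_fset f (A : {fset G}) : L1 f -> [set` A] `<=` creps U ->
  \sum_(x <- A) cabs (f x) <= L1norm f.
Proof.
move=> Lf Acr; rewrite -lee_fin -sumEFin -(L1normE hp) //.
apply: (le_integral_fset subU openU (mu_coset hp)) => //.
  by apply: rinv_cabs; exact: (L1_rinv hp Lf).
by move=> x; exact: cabs_ge0.
Qed.

Lemma L1_0 : L1 (fun=> 0).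
Proof. by apply: (hecke_L1 hp); exact: (hecke0 (R := R) hp). Qed.

Lemma L1norm0 : L1norm (fun=> 0) = 0.
Proof.
rewrite /L1norm /lnorm; under eq_integral do rewrite cabs0.
by rewrite integral0.
Qed.

Section Series.
Variable h : G -> C.
Hypotheses (Lh : L1 h) (h1 : L1norm h < 1).

Let r := L1norm h.
Let r0 : 0 <= r. Proof. exact: L1norm_ge0. Qed.

(** Shifted by one: [cpow n] is the convolution power [n + 1] of [h], so that [psum n] sums the
    powers from 1 to [n]. *)
Fixpoint cpow n : G -> C := if n is n'.+1 then conv h (cpow n') else h.

Fixpoint psum n : G -> C := if n is n'.+1 then fun x => psum n' x + cpow n' x else fun=> 0.

Let L1_cpow n : L1 (cpow n).
Proof. by elim: n => //= n IH; exact: (L1_conv hp). Qed.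

Let L1norm_cpow n : L1norm (cpow n) <= r ^+ n.+1.
Proof.
elim: n => [|n IH] /=; first by rewrite expr1.
by rewrite (le_trans (L1norm_conv hp Lh (L1_cpow n))) // exprS ler_wpM2l.
Qed.

Let L1_psum n : L1 (psum n).
Proof. by elim: n => [|n IH] /=; [exact: L1_0|exact: (L1D hp)]. Qed.

Let psumS n : psum n.+1 = fun x => h x + conv h (psum n) x.
Proof.
elim: n => [|n IH].
  apply/funext => x /=; rewrite add0r -[LHS]addr0; congr (_ + _).
  transitivity (conv h (fun y => 0 * h y) x); first by rewrite (convZr hp) // mul0r.
  by congr (conv h _ x); apply/funext => y; rewrite mul0r.
transitivity (fun x => h x + conv h (fun x => psum n x + cpow n x) x) => //.
rewrite (convDr hp) //; apply/funext => x.
transitivity (psum n.+1 x + conv h (cpow n) x) => //.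
by rewrite IH addrA.
Qed.

(** The tail of the geometric series from the power [n + 1] on, that is, a bound for what [psum n]
    omits. *)
Let b n := r ^+ n.+1 / (1 - r).
Let b0 n : 0 <= b n.
Proof. by rewrite divr_ge0 ?exprn_ge0 // subr_ge0 ltW. Qed.

(** The sharp bound [b m - b n], instead of [b m], makes the induction telescope. *)
Let psumB m n : (m <= n)%N -> L1norm (fun x => psum n x - psum m x) <= b m - b n.
Proof.
move=> /subnK <-; elim: (n - m)%N => [|k IH].
  rewrite add0n; under [X in L1norm X]eq_fun do rewrite subrr.
  by rewrite L1norm0 subrr.
rewrite addSn /=.
have -> : (fun x => psum (k + m) x + cpow (k + m) x - psum m x) =
   (fun x => (psum (k + m) x - psum m x) + cpow (k + m) x).
  by apply/funext => x; rewrite addrAC.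
apply: le_trans (L1normD hp _ _) _ => //; first exact: (L1B hp).
have := L1norm_cpow (k + m); have bS : b (k + m).+1 = b (k + m) - r ^+ (k + m).+1.
  rewrite /b [r ^+ (k + m).+2]exprS; field.
  by rewrite subr_eq0 gt_eqF.
rewrite bS; lra.
Qed.

Let y : G -> C := fun x => climit b (fun n => psum n x).

Let yP x m : cabs (y x - psum m x) <= 2 * b m.
Proof.
apply: (@climitP _ b (fun n => psum n x)) => {}m n mn.
have Ld := L1B hp (L1_psum n) (L1_psum m).
apply: le_trans (cabs_le_L1norm hp x Ld) _.
by apply: le_trans (psumB mn) _; rewrite gerBl.
Qed.

Let b_small c e : 0 < e -> exists m, c * b m < e.
Proof.
have hr : 0 <= r < 1 by rewrite r0.
move=> /(geometric_small (c * r / (1 - r)) hr) [m hm]; exists m.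
by apply: le_lt_trans hm; rewrite /b exprS !mulrA -!mulrA [_ * r ^+ m]mulrC !mulrA.
Qed.

Let y_biinv : biinvariant U y.
Proof.
move=> g u1 u2 h1' h2'; rewrite /y; congr (climit b _); apply/funext => n.
exact: (L1_biinv (L1_psum n)).
Qed.

(** Only pointwise errors are known for [y], so the norm is tested on a finite set [A] of cosets.
    Passing through a later [psum (m + k)], with [k] depending on the size of [A], makes the
    pointwise part negligible. *)
Let y_psum m : rinv U (fun x => y x - psum m x) ->
  (lnorm (fun x => y x - psum m x)%R <= (b m)%:E)%E.
Proof.
move=> ri; apply: lnorm_le_fset => // A Acr; apply/ler_addgt0Pr => e e0.
have [k hk] := b_small (2 * (size A)%:R) e0.
have hb : b (m + k) <= b k.
  apply: ler_wpM2r; first by rewrite invr_ge0 subr_ge0 ltW.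
  by apply: ler_wiXn2l => //; [exact: ltW|rewrite ltnS leq_addl].
have le1 : \sum_(x <- A) cabs (y x - psum m x) <=
    \sum_(x <- A) cabs (y x - psum (m + k) x) +
    \sum_(x <- A) cabs (psum (m + k) x - psum m x).
  rewrite -big_split /=; apply: ler_sum => x _.
  by rewrite (le_trans _ (cabsD _ _)) // addrA subrK.
have le2 : \sum_(x <- A) cabs (y x - psum (m + k) x) <= 2 * (size A)%:R * b k.
  apply: (@le_trans _ _ (\sum_(x <- A) 2 * b k)).
    apply: ler_sum => x _; apply: le_trans (yP _ _) _.
    by rewrite ler_wpM2l.
  by rewrite big_const_seq count_predT iter_addr_0 -[leLHS]mulr_natr mulrAC.
have le3 : \sum_(x <- A) cabs (psum (m + k) x - psum m x) <= b m.
  have Ld := L1B hp (L1_psum (m + k)) (L1_psum m).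
  apply: le_trans (le_L1norm_fset Ld Acr) _.
  by apply: le_trans (psumB (leq_addr k m)) _; rewrite gerBl.
by have := b0 k; lra.
Qed.

Let L1_ypsum m : L1 (fun x => y x - psum m x).
Proof.
have bi : biinvariant U (fun x => y x - psum m x).
  by move=> g u v Uu Uv; rewrite y_biinv // (L1_biinv (L1_psum m)).
apply/(L1E hp); split=> //; apply: le_lt_trans (y_psum _) _; last exact: ltry.
exact: (biinv_rinv hp).
Qed.

(** [1 + z] is the inverse of [1 - h]; stated for [z] alone, the equation makes sense in an algebra
    without unit. *)
Lemma neumann : exists2 z, L1 z & z = fun x => h x + conv h z x.
Proof.
have Ly : L1 y.
  have := L1_ypsum 0; congr L1; apply/funext => x /=; by rewrite subr0.
exists y => //; apply/funext => x; apply/eqP; rewrite -subr_eq0 -cabs_eq0.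
apply/eqP/le_anti; rewrite cabs_ge0 andbT; apply/ler_addgt0Pr => e e0; rewrite add0r.
(* By [psumS] the defect is [(y - psum (m+1)) - h * (y - psum m)], of modulus at most
   [2 b (m+1) + b m <= 3 b m]. *)
have [m hm] := b_small 3 e0.
have -> : y x - (h x + conv h y x) = (y x - psum m.+1 x) -
    conv h (fun x => y x - psum m x) x.
  by rewrite (convBr hp) // psumS; ring.
apply: le_trans (cabsD _ _) _; rewrite cabsN.
have l1 := yP x m.+1.
have Lc := L1_conv hp Lh (L1_ypsum m).
have l2 : cabs (conv h (fun x => y x - psum m x) x) <= b m.
  apply: le_trans (cabs_le_L1norm hp x Lc) _.
  apply: le_trans (L1norm_conv hp Lh (L1_ypsum m)) _.
  have lb : L1norm (fun x => y x - psum m x) <= b m.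
    rewrite -lee_fin -(L1normE hp) // y_psum //.
    exact: (L1_rinv hp (L1_ypsum m)).
  have := b0 m; have := @L1norm_ge0 _ _ mu (fun x => y x - psum m x).
  have := h1; have := r0; rewrite -/r; nra.
have l3 : b m.+1 <= b m.
  apply: ler_wpM2r; first by rewrite invr_ge0 subr_ge0 ltW.
  by apply: ler_wiXn2l => //; exact: ltW.
lra.
Qed.

End Series.
End Neumann.

(** * Spherical functions and characters *)

Section Spherical.
Variables (R : realType) (G : topologicalGroupType).
Variables (mu : {measure set (borel G) -> \bar R}) (U : set G).
Local Notation C := R[i].
Local Notation CI := (cintegral mu setT).
Local Notation conv := (convolution mu).
Local Notation hecke := (hecke (R := R) U).
Implicit Types F f w : G -> C.

Hypothesis hp : hecke_pair mu U.
Let subU := hp_subgroup hp.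
Let openU := hp_open hp.
Let UM x y : U x -> U y -> U (x * y)%g. Proof. by case: subU => _ + _; exact. Qed.
Let UV x : U x -> U (x^-1)%g. Proof. by case: subU => _ _; exact. Qed.
Let mU : measurable (U : set (borel G)). Proof. exact: (open_borel openU). Qed.

Lemma rinv_continuous (T : topologicalType) (F : G -> T) : rinv U F -> continuous F.
Proof.
move=> rF x A /nbhs_singleton Ax; apply: open_nbhs_nbhs; split=> //.
exact: (rinv_open subU openU).
Qed.

Lemma continuous_measurableR (phi : G -> R) : continuous phi ->
  measurable_fun [set: borel G] (phi : borel G -> R).
Proof.
move=> cphi; apply: (@measurability _ _ (borel G) R setT phi _ (RGenOInfty.measurableE R)) => _ [_ [x ->] <-].
by rewrite setTI; apply: open_borel; apply: open_comp => // y _; exact: cphi.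
Qed.

Lemma continuous_integrable (phi : G -> R) : continuous phi ->
  mu.-integrable (U : set (borel G)) (fun x : borel G => (phi x)%:E).
Proof.
move=> cphi; apply: measurable_bounded_integrable => //.
- by rewrite (hp_muU hp) ltry.
- by apply: measurable_funTS; exact: continuous_measurableR.
- have [M [Mr h]] := compact_bounded (continuous_compact (continuous_subspaceT cphi) (hp_compact hp)).
  by exists M; split=> // N MN x Ux; apply: (h N MN); exists x.
Qed.

(** With [u] inside the argument, right invariance in [u] is lost and sums over cosets do not apply;
    integrability over [U] comes from continuity on a compact set. *)
Lemma cintegrable_translate w h x : rinv U w ->
  cintegrable mu U (fun u => w (h * u * x)%g).
Proof.
move=> rw.
have ct : continuous (fun u : G => (h * u * x)%g).
  move=> u; apply: (@continuous_comp _ _ _ (fun u => h * u)%g (fun v => v * x)%g).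
    exact: mulg_continuousl.
  exact: mulg_continuousr.
split.
  apply: (@continuous_integrable (fun u => complex.Re (w (h * u * x)%g))) => u.
  apply: (@continuous_comp _ _ _ (fun u => h * u * x)%g (fun v => complex.Re (w v))).
    exact: ct.
  by apply: rinv_continuous => g v Uv; rewrite rw.
apply: (@continuous_integrable (fun u => complex.Im (w (h * u * x)%g))) => u.
apply: (@continuous_comp _ _ _ (fun u => h * u * x)%g (fun v => complex.Im (w v))).
  exact: ct.
by apply: rinv_continuous => g v Uv; rewrite rw.
Qed.

Lemma mu_mulgr (A : set G) u : measurable (A : set (borel G)) ->
  mu ((fun x => x * u)%g @^-1` A) = mu A.
Proof.
move=> mA; rewrite -(hp_unimodular hp (hp_haar hp) u^-1%g mA).
congr (mu _); apply/seteqP; split=> y /=.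
  by move=> h; exists (y * u)%g => //; rewrite mulgK.
by move=> [z Az <-]; rewrite mulgVK.
Qed.

Lemma mu_mulgl (A : set G) u : measurable (A : set (borel G)) ->
  mu ((fun x => u * x)%g @^-1` A) = mu A.
Proof.
move=> mA; rewrite -(haar_left_invariant (hp_haar hp) u^-1%g mA).
congr (mu _); apply/seteqP; split=> y /=.
  by move=> h; exists (u * y)%g => //; rewrite mulKg.
by move=> [z Az <-]; rewrite mulVKg.
Qed.

Lemma integralU_preserving (t : G -> G) (phi : G -> R) : continuous t ->
  (forall A, measurable (A : set (borel G)) -> mu (t @^-1` A) = mu A) ->
  t @^-1` U = U -> continuous phi ->
  (\int[mu]_(x in (U : set (borel G))) (phi (t x))%:E =
   \int[mu]_(x in (U : set (borel G))) (phi x)%:E)%E.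
Proof.
move=> ct mt tU cphi; have mct := continuous_borel ct.
rewrite [RHS](@eq_measure_integral _ _ _ _ (pushforward mu (t : borel G -> borel G))).
  rewrite (integral_pushforward mct) ?tU //; first last.
  - apply: (@continuous_integrable (fun x => phi (t x))) => x.
    by apply: continuous_comp; [exact: ct|exact: cphi].
  - by apply/measurable_EFinP; exact: continuous_measurableR.
by move=> A mA _; symmetry; exact: mt.
Qed.

Definition umean w (h g : G) : C := cintegral mu U (fun u => w (h * u * g)%g).

(** The inner factors are absorbed by the bijection [u -> u2 u u3] of [U], which preserves [mu] by
    left invariance and unimodularity, the outer ones by [w]. Hence [umean w] is constant on double
    cosets in each variable. *)
Lemma umeanM w h g u1 u2 u3 u4 : biinvariant U w -> U u1 -> U u2 -> U u3 -> U u4 ->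
  umean w (u1 * h * u2)%g (u3 * g * u4)%g = umean w h g.
Proof.
move=> bw h1 h2 h3 h4; rewrite /umean /cintegral /Rintegral.
have e u : w (u1 * h * u2 * u * (u3 * g * u4))%g = w (h * (u2 * u * u3) * g)%g.
  by rewrite -[RHS](bw _ _ _ h1 h4) !mulgA.
have ct : continuous (fun u : G => (u2 * u * u3)%g).
  move=> u; apply: (@continuous_comp _ _ _ (fun u => u2 * u)%g (fun v => v * u3)%g).
    exact: mulg_continuousl.
  exact: mulg_continuousr.
have mt A : measurable (A : set (borel G)) ->
    mu ((fun u : G => (u2 * u * u3)%g) @^-1` A) = mu A.
  move=> mA; have mA' : measurable ((fun x => x * u3)%g @^-1` A : set (borel G)).
    have := continuous_borel (@mulg_continuousr G u3) measurableT mA.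
    by rewrite setTI.
  by rewrite -(mu_mulgr u3 mA) -(mu_mulgl u2 mA').
have tU : (fun u : G => (u2 * u * u3)%g) @^-1` U = U.
  apply/seteqP; split=> u /=; last by move=> ?; apply: UM => //; exact: UM.
  by move=> h'; have := UM (UV h2) (UM h' (UV h3)); rewrite mulgK mulKg.
have rw : rinv U w by exact: (biinv_rinv hp).
have ct' : continuous (fun u : G => (h * u * g)%g).
  move=> u; apply: (@continuous_comp _ _ _ (fun u => h * u)%g (fun v => v * g)%g).
    exact: mulg_continuousl.
  exact: mulg_continuousr.
congr (Complex (fine _) (fine _)).
  under eq_integral do rewrite e.
  apply: (@integralU_preserving _ (fun u => complex.Re (w (h * u * g)%g)) ct mt tU) => u.
  apply: (@continuous_comp _ _ _ (fun u => h * u * g)%g (fun v => complex.Re (w v))).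
    exact: ct'.
  by apply: rinv_continuous => v u' Uv; rewrite rw.
under eq_integral do rewrite e.
apply: (@integralU_preserving _ (fun u => complex.Im (w (h * u * g)%g)) ct mt tU) => u.
apply: (@continuous_comp _ _ _ (fun u => h * u * g)%g (fun v => complex.Im (w v))).
  exact: ct'.
by apply: rinv_continuous => v u' Uv; rewrite rw.
Qed.

Definition chi w f : C := CI (fun x => f x * w x).

Lemma hecke_mul_integrable f w : hecke f -> rinv U w ->
  rintegrable mu U (fun x => f x * w x).
Proof.
move=> hf rw; have [A [Acr fA]] := hecke_fsup hp hf.
have rf := biinv_rinv hp (hecke_biinv hf).
have [] // := @fsup_integral _ _ _ _ hp (fun x => f x * w x) A.
  by move=> g u Uu; rewrite rf // rw.
by split=> // x; rewrite mulf_eq0 negb_or => /andP[/fA].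
Qed.

Lemma chi_fsup f A w : hecke f -> fsup U f A -> rinv U w ->
  chi w f = \sum_(x <- A) f x * w x.
Proof.
move=> hf [Acr fA] rw; have rf := biinv_rinv hp (hecke_biinv hf).
have [] // := @fsup_integral _ _ _ _ hp (fun x => f x * w x) A.
  by move=> g u Uu; rewrite rf // rw.
by split=> // x; rewrite mulf_eq0 negb_or => /andP[/fA].
Qed.

Lemma chiD f1 f2 w : hecke f1 -> hecke f2 -> rinv U w ->
  chi w (fun x => f1 x + f2 x) = chi w f1 + chi w f2.
Proof.
move=> h1 h2 rw; rewrite /chi -(cintegralD hp); [|exact: hecke_mul_integrable..].
by congr (cintegral _ _ _); apply/funext => x; rewrite mulrDl.
Qed.

Lemma chiZ c f w : hecke f -> rinv U w ->
  chi w (fun x => c * f x) = c * chi w f.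
Proof.
move=> h rw; rewrite /chi -(cintegralZ hp); last exact: hecke_mul_integrable.
by congr (cintegral _ _ _); apply/funext => x; rewrite mulrA.
Qed.

(** Left invariance of [f] lets a [u] of [U] be inserted between [h] and [x] without changing the
    integral; averaging over [u] then produces the mean to which the functional equation of a
    spherical function applies. *)
Lemma chi_translate f A w h : hecke f -> fsup U f A -> biinvariant U w ->
  chi (fun x => w (h * x)%g) f = \sum_(x <- A) f x * umean w h x.
Proof.
move=> hf fA bw; have bf := hecke_biinv hf; have rf := biinv_rinv hp bf.
have rw := biinv_rinv hp bw.
have e u : U u -> chi (fun x => w (h * x)%g) f = \sum_(x <- A) f x * w (h * u * x)%g.
  move=> Uu; transitivity (chi (fun x => w (h * u * x)%g) f).
    have rfw : rinv U (fun x => f x * w (h * x)%g).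
      by move=> g v Uv; congr (_ * _); [exact: rf|exact: (rinv_lmul h rw)].
    rewrite /chi -(cintegral_mulgl hp u rfw); congr (cintegral _ _ _).
    by apply/funext => x; rewrite (biinv_linv hp _ bf) // mulgA.
  by apply: chi_fsup => //; exact: rinv_lmul.
pose c := chi (fun x => w (h * x)%g) f.
have -> : chi (fun x => w (h * x)%g) f = cintegral mu U (fun=> c).
  by rewrite /cintegral /= !Rintegral_cst // (hp_muU hp) /= !mulr1.
have -> : cintegral mu U (fun=> c) =
    cintegral mu U (fun u => \sum_(x <- A) f x * w (h * u * x)%g).
  rewrite /cintegral; congr Complex; apply: eq_Rintegral => u /set_mem Uu;
  by rewrite -e.
rewrite (cintegral_sum_on (mu := mu) mU _).2.
  apply: eq_bigr => x _; rewrite (cintegralZ_on mU) //; exact: cintegrable_translate.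
by move=> x _; apply: cintegrableZ => //; exact: cintegrable_translate.
Qed.

Lemma chi_conv f1 f2 A w : hecke f1 -> hecke f2 -> fsup U f1 A -> biinvariant U w ->
  chi w (conv f1 f2) = \sum_(h <- A) f1 h * chi (fun x => w (h * x)%g) f2.
Proof.
move=> h1 h2 fA bw; have [b1 b2] := (hecke_biinv h1, hecke_biinv h2).
have rw := biinv_rinv hp bw; have r2 := biinv_rinv hp b2.
rewrite {1}/chi.
have -> : (fun x => conv f1 f2 x * w x) =
    (fun x => \sum_(h <- A) f1 h * (f2 (h^-1 * x)%g * w x)).
  apply/funext => x; rewrite (convE hp _ fA) // mulr_suml.
  by apply: eq_bigr => h _; rewrite mulrA.
have ri h : rintegrable mu U (fun x => f2 x * w (h * x)%g).
  by apply: hecke_mul_integrable => //; exact: rinv_lmul.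
have e h : (fun x => f2 (h^-1 * x)%g * w x) =
    (fun x => f2 (h^-1 * x)%g * w (h * (h^-1 * x))%g).
  by apply/funext => x; rewrite mulVKg.
have ri' h : rintegrable mu U (fun x => f2 (h^-1 * x)%g * w x).
  by rewrite e; exact: (rintegrable_mulgl hp h^-1%g (ri h)).
rewrite (cintegral_sum hp _).2; last by move=> h _; exact: (rintegrableZ hp).
apply: eq_bigr => h _; rewrite (cintegralZ hp) //; congr (_ * _).
by rewrite e; exact: (cintegral_mulgl hp h^-1%g (proj1 (ri h))).
Qed.

Lemma chiM f1 f2 w : hecke f1 -> hecke f2 -> spherical mu U w ->
  chi w (conv f1 f2) = chi w f1 * chi w f2.
Proof.
move=> h1 h2 [_ _ bw sw]; have [[A fA] [B fB]] := (hecke_fsup hp h1, hecke_fsup hp h2).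
have rw := biinv_rinv hp bw.
rewrite (chi_conv h1 h2 fA bw) (chi_fsup h1 fA) // mulr_suml.
apply: eq_bigr => h _; rewrite -mulrA; congr (_ * _).
rewrite (chi_translate _ h2 fB) // (chi_fsup h2 fB) // mulr_sumr.
by apply: eq_bigr => x _; rewrite /umean sw mulrCA.
Qed.

Lemma cintegral_conj F : rintegrable mu U F -> CI (fun x => (F x)^*) = (CI F)^*.
Proof.
move=> [rF fF]; rewrite /cintegral conjCE /=; congr Complex.
  by apply: eq_Rintegral => x _; case: (ReIm_conj (F x)).
have -> : (- \int[mu]_(x in [set: borel G]) complex.Im (F x))%R =
   \int[mu]_(x in [set: borel G]) (- 1 * complex.Im (F x)).
  by rewrite RintegralZl ?mulN1r //; exact: (integrable_Im hp rF fF).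
apply: eq_Rintegral => x _; rewrite mulN1r.
by case: (ReIm_conj (F x)).
Qed.

Lemma chi_star_gen f w : biinvariant U f -> biinvariant U w ->
  rintegrable mu U (fun x => f x * w x) ->
  (forall g, w (g^-1)%g = (w g)^*) -> chi w (invol f) = (chi w f)^*.
Proof.
move=> bf bw ri ws; rewrite /chi -(cintegral_conj ri).
rewrite -(cintegral_invg hp (F := fun x => (f x * w x)^*)); last first.
  by move=> g u Uu; rewrite (biinv_rinv hp bf) // (biinv_rinv hp bw).
congr (cintegral _ _ _); apply/funext => x.
by rewrite /invol [in RHS]ws rmorphM /= conjCK.
Qed.

Lemma chi_star f w : hecke f -> star_spherical mu U w ->
  chi w (invol f) = (chi w f)^*.
Proof.
move=> hf [[_ _ bw _] ws]; apply: chi_star_gen => //; first exact: hecke_biinv.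
by apply: hecke_mul_integrable => //; exact: (biinv_rinv hp).
Qed.

End Spherical.

(** * Double cosets; from spherical functions to characters and back *)

Section Characters.
Variables (R : realType) (G : topologicalGroupType).
Variables (mu : {measure set (borel G) -> \bar R}) (U : set G).
Local Notation C := R[i].
Local Notation CI := (cintegral mu setT).
Local Notation lnorm := (lnorm mu).
Local Notation L1norm := (L1norm mu).
Local Notation conv := (convolution mu).
Local Notation hecke := (hecke (R := R) U).
Local Notation L1 := (L1 mu U).
Local Notation chi := (chi mu).
Implicit Types F f w : G -> C.

Hypothesis hp : hecke_pair mu U.
Let subU := hp_subgroup hp.
Let U1 : U 1%g. Proof. by case: subU. Qed.
Let UM x y : U x -> U y -> U (x * y)%g. Proof. by case: subU => _ + _; exact. Qed.
Let UV x : U x -> U (x^-1)%g. Proof. by case: subU => _ _; exact. Qed.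

Definition dcoset (g : G) : set G := [set x | exists u v, [/\ U u, U v & x = (u * g * v)%g]].

Definition hind (g : G) : G -> C := fun x => if x \in dcoset g then 1 else 0.

Lemma dcosetxx g : dcoset g g.
Proof. by exists 1%g, 1%g; split=> //; rewrite mul1g mulg1. Qed.

Lemma dcosetM g x u v : U u -> U v -> dcoset g (u * x * v)%g <-> dcoset g x.
Proof.
move=> Uu Uv; split=> -[u' [v' [Uu' Uv' e]]].
  exists (u^-1 * u')%g, (v' * v^-1)%g; split; try by apply: UM => //; exact: UV.
  have -> : x = (u^-1 * (u * x * v) * v^-1)%g by rewrite -!mulgA mulKg mulgV mulg1.
  by rewrite e !mulgA.
exists (u * u')%g, (v' * v)%g; split; try by apply: UM.
by rewrite e !mulgA.
Qed.

Lemma biinv_hind g : biinvariant U (hind g).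
Proof.
move=> x u v Uu Uv; rewrite /hind; congr (if _ then _ else _).
by apply/idP/idP => /set_mem h; apply/mem_set; apply/(dcosetM g x Uu Uv).
Qed.

Lemma hecke_hind g : hecke (hind g).
Proof.
pose K : set G := (fun z : G * G => z.1 * g * z.2)%g @` (U `*` U).
apply: (@compact_hecke _ _ _ _ hp _ K (@biinv_hind g)).
  apply: continuous_compact; last by apply: compact_setX; exact: hp_compact hp.
  apply: continuous_subspaceT => z.
  apply: (@continuous_comp _ _ _ (fun z : G * G => ((z.1 * g)%g, z.2)) (fun z => (z.1 * z.2)%g)).
    apply: cvg_pair; last exact: cvg_snd.
    apply: (@continuous_comp _ _ _ fst (fun x => (x * g)%g)); first exact: cvg_fst.
    exact: mulg_continuousr.
  exact: mulg_continuous.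
move=> x; rewrite /hind; case: ifP => [/set_mem[u [v [Uu Uv ->]]] _|]; last by rewrite eqxx.
by exists (u, v).
Qed.

Lemma hind_id g : hind g g = 1.
Proof. by rewrite /hind ifT //; apply/mem_set; exact: dcosetxx. Qed.

Lemma biinv_dcoset T (w : G -> T) g x :
  (forall g u1 u2, U u1 -> U u2 -> w (u1 * g * u2)%g = w g) ->
  dcoset g x -> w x = w g.
Proof. by move=> bw [u [v [Uu Uv ->]]]; exact: bw. Qed.

Lemma hindM w g x : biinvariant U w -> hind g x * w x = w g * hind g x.
Proof.
move=> bw; rewrite /hind; case: ifP => [/set_mem h|_]; last by rewrite mul0r mulr0.
by rewrite mul1r mulr1 (biinv_dcoset bw h).
Qed.

Lemma hind_mul_eq g x (a b : C) : (dcoset g x -> a = b) -> hind g x * a = hind g x * b.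
Proof.
rewrite /hind; case: ifP => [/set_mem h /(_ h) -> //|_ _].
exact: etrans (mul0r _) (esym (mul0r _)).
Qed.

Lemma cabs_hind g x : (cabs (hind g x))%:C%C = hind g x.
Proof. by rewrite /hind; case: ifP => _; rewrite ?cabs1 ?cabs0. Qed.

Lemma cintegral_ge0 f : (forall x, (cabs (f x))%:C%C = f x) -> CI f = (L1norm f)%:C%C.
Proof.
move=> f0; rewrite /cintegral /L1norm /lnorm; congr Complex.
  by congr fine; apply: eq_integral => x _; rewrite -[in LHS]f0.
transitivity (\int[mu]_(x in [set: borel G]) (0 : R)).
  by apply: eq_Rintegral => x _; rewrite -f0.
by rewrite /Rintegral integral0.
Qed.

(** The measure of [U g U], equivalently the number of cosets [x U] that it contains. *)
Definition hmass g : R := L1norm (hind g).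

Lemma hmass_ge1 g : 1 <= hmass g.
Proof.
have := cabs_le_L1norm hp g (hecke_L1 hp (hecke_hind g)).
by rewrite hind_id cabs1.
Qed.

Lemma hmass_gt0 g : 0 < hmass g.
Proof. exact: lt_le_trans (hmass_ge1 g). Qed.

Lemma hmassC_neq0 g : (hmass g)%:C%C != 0 :> C.
Proof. by rewrite -cabs_eq0 cabs_real normr_eq0 gt_eqF // hmass_gt0. Qed.

Lemma chi_hind w g : biinvariant U w -> chi w (hind g) = w g * (hmass g)%:C%C.
Proof.
move=> bw; rewrite /chi; under [X in CI X]eq_fun do rewrite hindM //.
rewrite (cintegralZ hp); first by rewrite cintegral_ge0 //; exact: cabs_hind.
by apply: (L1_rintegrable hp); exact: (hecke_L1 hp (hecke_hind g)).
Qed.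

Lemma invol_hind g : invol (hind g) = hind (g^-1)%g.
Proof.
apply/funext => x; rewrite /invol /hind.
have -> : (x^-1 \in dcoset g)%g = (x \in dcoset g^-1)%g.
  apply/idP/idP => /set_mem [u [v [Uu Uv e]]]; apply/mem_set; exists (v^-1)%g, (u^-1)%g;
    split; try exact: UV.
    by rewrite -[x]invgK e !invgM mulgA.
  by rewrite e !invgM invgK mulgA.
by case: ifP => _; rewrite ?conjC1 ?conjC0.
Qed.

Lemma hmassV g : hmass (g^-1)%g = hmass g.
Proof.
by rewrite /hmass -invol_hind (L1norm_invol hp) //; exact: (hecke_L1 hp (hecke_hind g)).
Qed.

Lemma spherical_le1_of_chi w : biinvariant U w ->
  (forall f, hecke f -> cabs (chi w f) <= L1norm f) -> forall g, cabs (w g) <= 1.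
Proof.
move=> bw h g; have := h _ (hecke_hind g); rewrite chi_hind // cabsM cabs_real.
rewrite ger0_norm ?(ltW (hmass_gt0 g)) // -/(hmass g).
by rewrite -ler_pdivlMr ?hmass_gt0 // divff // gt_eqF // hmass_gt0.
Qed.

Section Bounded.
Variable w : G -> C.
Hypotheses (bw : biinvariant U w) (w1 : forall x, cabs (w x) <= 1).

Lemma L1_mul_integrable f : L1 f -> rintegrable mu U (fun x => f x * w x).
Proof.
move=> Lf; apply: (rintegrable_le hp) (L1_rintegrable hp Lf) _.
  move=> g u Uu; rewrite (L1_rinv hp Lf) //.
  by rewrite (biinv_rinv hp bw).
by move=> x; rewrite cabsM ler_piMr // cabs_ge0.
Qed.

Lemma chi_le f : L1 f -> cabs (chi w f) <= L1norm f.
Proof.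
move=> Lf; have ri := L1_mul_integrable Lf.
rewrite -lee_fin -(L1normE hp) // (le_trans (cintegral_le hp ri)) //.
apply: (le_lnorm hp); [by case: ri|exact: (L1_rinv hp)|].
by move=> x; rewrite cabsM ler_piMr // cabs_ge0.
Qed.

Lemma chi_L1D f1 f2 : L1 f1 -> L1 f2 ->
  chi w (fun x => f1 x + f2 x) = chi w f1 + chi w f2.
Proof.
move=> h1 h2; rewrite /chi -(cintegralD hp); [|exact: L1_mul_integrable..].
by congr (cintegral _ _ _); apply/funext => x; rewrite mulrDl.
Qed.

Lemma chi_L1Z c f : L1 f -> chi w (fun x => c * f x) = c * chi w f.
Proof.
move=> h; rewrite /chi -(cintegralZ hp); last exact: L1_mul_integrable.
by congr (cintegral _ _ _); apply/funext => x; rewrite mulrA.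
Qed.

Lemma chi_L1B f1 f2 : L1 f1 -> L1 f2 ->
  chi w (fun x => f1 x - f2 x) = chi w f1 - chi w f2.
Proof.
move=> h1 h2; transitivity (chi w (fun x => f1 x + (-1) * f2 x)).
  by congr (chi w _); apply/funext => x; rewrite mulN1r.
by rewrite chi_L1D // ?chi_L1Z ?mulN1r //; exact: (L1Z hp).
Qed.

Lemma chi_L1star f : L1 f -> (forall g, w (g^-1)%g = (w g)^*) ->
  chi w (invol f) = (chi w f)^*.
Proof.
move=> Lf ws; apply: (chi_star_gen hp) => //; first exact: L1_biinv Lf.
exact: L1_mul_integrable.
Qed.

(** Extends [chiM] by density: [chi w] is multiplicative on Hecke functions and contractive for the
    L1-norm. *)
Lemma chi_L1M f1 f2 : spherical mu U w -> L1 f1 -> L1 f2 ->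
  chi w (conv f1 f2) = chi w f1 * chi w f2.
Proof.
move=> sw L1f L2f; apply/eqP; rewrite -subr_eq0 -cabs_eq0; apply/eqP.
apply: le_anti; rewrite cabs_ge0 andbT; apply/ler_addgt0Pr => e e0; rewrite add0r.
(* The [+ 1] leaves room for [g2], whose norm exceeds that of [f2] by at most [d <= 1]. *)
pose K := L1norm f1 + L1norm f2 + 1.
have K1 : 1 <= K by rewrite lerDr addr_ge0 // L1norm_ge0.
have nf1 : L1norm f1 <= K.
  by have := @L1norm_ge0 _ _ mu f2; rewrite /K; lra.
have nf2 : L1norm f2 <= K.
  by have := @L1norm_ge0 _ _ mu f1; rewrite /K; lra.
(* Four error terms of size at most [K * d] must add up to at most [e]. *)
pose d := Num.min 1 (e / (2 * (K + K))).
have d0 : 0 < d by rewrite lt_min ltr01 /= divr_gt0 //; lra.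
have d1 : d <= 1 by rewrite ge_min lexx.
have dK : d * (2 * (K + K)) <= e.
  rewrite -ler_pdivlMr; last lra.
  by rewrite ge_min lexx orbT.
have [g1 hg1 dg1] := hecke_dense hp L1f d0.
have [g2 hg2 dg2] := hecke_dense hp L2f d0.
have Lg1 := hecke_L1 hp hg1; have Lg2 := hecke_L1 hp hg2.
have LB1 := L1B hp L1f Lg1; have LB2 := L1B hp L2f Lg2.
have ng2 : L1norm g2 <= K.
  have -> : g2 = (fun x => f2 x - (f2 x - g2 x)) by apply/funext => x; ring.
  have := L1normB hp L2f LB2; have := @L1norm_ge0 _ _ mu f1; rewrite /K; lra.
have e1 : chi w (conv f1 f2) - chi w f1 * chi w f2 =
   (chi w (conv f1 (fun x => f2 x - g2 x)) + chi w (conv (fun x => f1 x - g1 x) g2))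
   - (chi w f1 * chi w (fun x => f2 x - g2 x) + chi w (fun x => f1 x - g1 x) * chi w g2).
  have cB : conv (fun x => f1 x - g1 x) g2 = fun x => conv f1 g2 x - conv g1 g2 x.
    have := convDl hp L1f (L1Z hp (-1) Lg1) Lg2; rewrite (convZl hp) // => e'.
    transitivity (conv (fun x => f1 x + -1 * g1 x) g2).
      by congr (conv _ _); apply/funext => x; rewrite mulN1r.
    by rewrite e'; apply/funext => x; rewrite mulN1r.
  rewrite cB (convBr hp) // !chi_L1B //; try exact: (L1_conv hp).
  rewrite (chiM hp hg1 hg2) //.
  by move: (chi w _) (chi w _) (chi w _) (chi w _) (chi w _) (chi w _) => *; ring.
rewrite e1.
have b1 : cabs (chi w (conv f1 (fun x => f2 x - g2 x))) <= K * d.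
  apply: le_trans (chi_le (L1_conv hp L1f LB2)) _.
  apply: le_trans (L1norm_conv hp L1f LB2) _.
  by apply: ler_pM; rewrite ?L1norm_ge0 //; exact: ltW.
have b2 : cabs (chi w (conv (fun x => f1 x - g1 x) g2)) <= d * K.
  apply: le_trans (chi_le (L1_conv hp LB1 Lg2)) _.
  apply: le_trans (L1norm_conv hp LB1 Lg2) _.
  by apply: ler_pM; rewrite ?L1norm_ge0 //; exact: ltW.
have b3 : cabs (chi w f1 * chi w (fun x => f2 x - g2 x)) <= K * d.
  rewrite cabsM; apply: ler_pM; rewrite ?cabs_ge0 //.
    exact: le_trans (chi_le L1f) _.
  by apply: le_trans (chi_le LB2) _; exact: ltW.
have b4 : cabs (chi w (fun x => f1 x - g1 x) * chi w g2) <= d * K.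
  rewrite cabsM; apply: ler_pM; rewrite ?cabs_ge0 //.
    by apply: le_trans (chi_le LB1) _; exact: ltW.
  exact: le_trans (chi_le Lg2) _.
apply: le_trans (cabsD _ _) _; rewrite cabsN.
apply: le_trans (lerD (cabsD _ _) (cabsD _ _)) _.
apply: le_trans (lerD (lerD b1 b2) (lerD b3 b4)) _.
have -> : K * d + d * K + (K * d + d * K) = d * (2 * (K + K)) by ring.
exact: dK.
Qed.

End Bounded.

(** With [S] the supremum of the modulus, [chi w] is bounded by [S] times the L1-norm. On the
    convolution of [hind x] and [hind y] this gives [|w x| |w y| <= S], and the supremum over [y]
    gives [|w x| S <= S]. *)
Lemma bounded_spherical_le1 w M : spherical mu U w -> (forall x, cabs (w x) <= M) ->
  forall x, cabs (w x) <= 1.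
Proof.
move=> sw wM; have [_ w1 bw _] := sw.
pose S := range (fun x => cabs (w x)).
have S_ub : has_ubound S by exists M => _ [x _ <-].
have S1 : 1 <= sup S by apply: ub_le_sup => //; exists 1%g; rewrite // w1 cabs1.
have S0 : 0 <= sup S := le_trans ler01 S1.
have wS x : cabs (w x) <= sup S by apply: ub_le_sup => //; exists x.
have chi_leS f : hecke f -> cabs (chi w f) <= sup S * L1norm f.
  move=> hf; have ri := hecke_mul_integrable hp hf (biinv_rinv hp bw).
  have Lf := hecke_L1 hp hf.
  rewrite -lee_fin EFinM -(L1normE hp) //; apply: le_trans (cintegral_le hp ri) _.
  have -> : ((sup S)%:E * lnorm f)%E = lnorm (fun x => (sup S)%:C%C * f x).
    by rewrite (lnormZ hp) ?cabs_real ?ger0_norm //; exact: (L1_rinv hp).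
  apply: (le_lnorm hp); first by case: ri.
    by move=> g u Uu; rewrite (L1_rinv hp Lf).
  move=> x; rewrite !cabsM cabs_real mulrC ger0_norm //.
  by rewrite ler_wpM2r ?cabs_ge0.
have key x y : cabs (w x) * cabs (w y) <= sup S.
  have hx := hecke_hind x; have hy := hecke_hind y.
  have := chi_leS _ (hecke_conv hp hx hy).
  rewrite (chiM hp hx hy) // !chi_hind // !cabsM !cabs_real.
  rewrite !ger0_norm ?(ltW (hmass_gt0 _)) //.
  have := L1norm_conv hp (hecke_L1 hp hx) (hecke_L1 hp hy); rewrite -!/(hmass _) => h1 h2.
  have : cabs (w x) * hmass x * (cabs (w y) * hmass y) <= sup S * (hmass x * hmass y).
    by apply: le_trans h2 _; rewrite ler_wpM2l.
  have -> : cabs (w x) * hmass x * (cabs (w y) * hmass y) =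
    (cabs (w x) * cabs (w y)) * (hmass x * hmass y) by ring.
  by rewrite ler_pM2r // mulr_gt0 // hmass_gt0.
move=> x; have [x0|x0] := eqVneq (cabs (w x)) 0; first by rewrite x0.
have xp : 0 < cabs (w x) by rewrite lt_def x0 cabs_ge0.
have : sup S <= sup S / cabs (w x).
  apply: ge_sup; first by exists (cabs (w 1%g)), 1%g.
  by move=> _ [y _ <-]; rewrite ler_pdivlMr // mulrC.
by rewrite ler_pdivlMr // -{2}[sup S]mulr1 ler_pM2l // (lt_le_trans ltr01).
Qed.

Section CharacterToSpherical.
Variable X : (G -> C) -> C.
Hypothesis XD : forall f1 f2, hecke f1 -> hecke f2 -> X (fun x => f1 x + f2 x) = X f1 + X f2.
Hypothesis XZ : forall c f, hecke f -> X (fun x => c * f x) = c * X f.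
Hypothesis XM : forall f1 f2, hecke f1 -> hecke f2 -> X (conv f1 f2) = X f1 * X f2.
Hypothesis XS : forall f, hecke f -> X (invol f) = (X f)^*.
Hypothesis X1 : X (hunit R U) = 1.

(** The only choice compatible with [chi_hind]. *)
Let w g : C := X (hind g) / (hmass g)%:C%C.

Let bw : biinvariant U w.
Proof.
move=> g u v Uu Uv; rewrite /w /hmass.
suff -> : hind (u * g * v)%g = hind g by [].
apply/funext => x; rewrite /hind; congr (if _ then _ else _).
apply/idP/idP => /set_mem [u' [v' [Uu' Uv' ->]]]; apply/mem_set.
  by exists (u' * u)%g, (v * v')%g; split; [exact: UM..|rewrite !mulgA].
exists (u' * u^-1)%g, (v^-1 * v')%g; split; try by apply: UM => //; exact: UV.
by rewrite !mulgA mulgVK -!mulgA mulVKg !mulgA.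
Qed.

Let rw : rinv U w := biinv_rinv hp bw.

Let X_hind g : X (hind g) = chi w (hind g).
Proof. by rewrite chi_hind // /w mulfVK // hmassC_neq0. Qed.

(** Induction on the number of cosets carrying [f]: subtracting [f x] times [hind x] clears the
    whole double coset of [x], so at least one coset disappears and none is added. *)
Lemma character_chi f : hecke f -> X f = chi w f.
Proof.
move=> hf; have [A fA] := hecke_fsup hp hf.
have [n] := ubnP #|` A|; elim: n A f hf fA => // n IH A f hf fA; rewrite ltnS => cA.
have [f0|/existsNP[x /eqP fx]] := pselect (forall x, f x = 0).
  have -> : f = (fun x => 0 * f x) by apply/funext => x; rewrite f0 mul0r.
  by rewrite XZ // (chiZ hp) // !mul0r.
pose f' y := f y + (- f x) * hind x y.
have hf' : hecke f' by apply: (heckeD hp) => //; apply: (heckeZ hp); exact: hecke_hind.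
have [Acr fA'] := fA; have xA : crep U x \in A by exact: fA'.
have fA2 : fsup U f' (A `\ crep U x)%fset.
  split; first by move=> y /=; rewrite in_fsetD1 => /andP[_]; exact: Acr.
  move=> y; rewrite in_fsetD1 /f' /hind; case: ifPn => [/set_mem h|yx].
    by rewrite (biinv_dcoset (hecke_biinv hf) h) mulr1 subrr eqxx.
  rewrite mulr0 addr0 => /fA' ->; rewrite andbT; apply: contraNneq yx => e.
  apply/mem_set; exists 1%g, (x^-1 * y)%g; split=> //; last by rewrite mul1g mulVKg.
  by apply/(crepP subU).
rewrite (cardfsD1 (crep U x)) xA add1n in cA.
have := IH _ _ hf' fA2 cA.
have hx : hecke (fun y => (- f x) * hind x y) by apply: (heckeZ hp); exact: hecke_hind.
rewrite /f' XD // (chiD hp) // XZ ?(chiZ hp) //; try exact: hecke_hind.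
by rewrite X_hind => /addIr.
Qed.

Lemma character_spherical : star_spherical mu U w.
Proof.
have ws g : w (g^-1)%g = (w g)^*.
  rewrite /w hmassV -invol_hind XS; last exact: hecke_hind.
  by rewrite rmorphM fmorphV /= conjR.
split=> //; split=> //.
- exact: (rinv_continuous (T := C^o) hp rw).
- have e : hind 1%g = hunit R U.
    apply/funext => x; rewrite hunitE /hind; congr (if _ then _ else _).
    apply/idP/idP => /set_mem.
      by move=> [u [v [Uu Uv ->]]]; apply/mem_set; rewrite mulg1; exact: UM.
    by move=> Ux; apply/mem_set; exists x, 1%g; rewrite !mulg1.
  have := chi_hind 1%g bw; rewrite -X_hind e X1 => /esym.
  suff -> : hmass 1%g = 1 by rewrite mulr1.
  by rewrite /hmass e /L1norm (lnorm_indic hp).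
(* The value of [X] at the convolution of [hind g1] and [hind g2] is computed twice, by [XM] and by
   [chi_conv]. As [umean] is constant on double cosets, the comparison is the functional equation
   multiplied by both masses. *)
- move=> g1 g2; have [h1 h2] := (hecke_hind g1, hecke_hind g2).
  have [[A fA] [B fB]] := (hecke_fsup hp h1, hecke_fsup hp h2).
  have sumE g A' : fsup U (hind g) A' -> \sum_(x <- A') hind g x = (hmass g)%:C%C.
    move=> fA'; have [_ <-] := fsup_integral hp (biinv_rinv hp (@biinv_hind g)) fA'.
    by rewrite cintegral_ge0 //; exact: cabs_hind.
  have := XM h1 h2; rewrite (character_chi (hecke_conv hp h1 h2)) (chi_conv hp h1 h2 fA bw).
  have e2 h : chi (fun x => w (h * x)%g) (hind g2) = umean mu U w h g2 * (hmass g2)%:C%C.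
    rewrite (chi_translate hp h h2 fB bw) -(sumE _ _ fB) mulr_sumr.
    apply: eq_bigr => x _; rewrite [RHS]mulrC; apply: hind_mul_eq => -[u [v [Uu Uv ->]]].
    by have := umeanM hp h g2 bw U1 U1 Uu Uv; rewrite mul1g mulg1.
  under eq_bigr do rewrite e2 mulrA.
  have e1 : \sum_(h <- A) hind g1 h * umean mu U w h g2 * (hmass g2)%:C%C =
     (hmass g1)%:C%C * (umean mu U w g1 g2 * (hmass g2)%:C%C).
    rewrite -(sumE _ _ fA) mulr_suml; apply: eq_bigr => h _; rewrite -mulrA.
    apply: hind_mul_eq => -[u [v [Uu Uv ->]]].
    have em := umeanM hp g1 g2 bw Uu Uv U1 U1; rewrite mul1g mulg1 in em.
    by rewrite em.
  rewrite e1 !X_hind !chi_hind // -/(umean mu U w g1 g2).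
  have -> : w g1 * (hmass g1)%:C%C * (w g2 * (hmass g2)%:C%C) =
    (hmass g1)%:C%C * ((w g1 * w g2) * (hmass g2)%:C%C).
    by rewrite mulrACA [RHS]mulrCA.
  by move=> /(mulfI (hmassC_neq0 g1))/(mulIf (hmassC_neq0 g2)).
Qed.

Lemma character_ex : exists2 v, star_spherical mu U v & forall f, hecke f -> X f = chi v f.
Proof. by exists w; [exact: character_spherical|exact: character_chi]. Qed.

End CharacterToSpherical.
End Characters.

(** * The commutative Hecke algebra and characters attaining a seminorm *)

Section HeckeRing.
Variables (R : realType) (G : topologicalGroupType).
Variables (mu : {measure set (borel G) -> \bar R}) (U : set G).
Local Notation C := R[i].
Local Notation conv := (convolution mu).
Local Notation hecke := (hecke (R := R) U).
Implicit Types f : G -> C.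

Hypothesis hp : hecke_pair mu U.
Hypothesis gp : gelfand_pair mu U.

(* The [let]s make [halg] depend on the hypotheses that its ring structure needs. *)
Definition halg : Type := let _ := hp in let _ := gp in {f : G -> C | f \in hecke}.

HB.instance Definition _ := Choice.copy halg {f : G -> C | f \in hecke}.

Definition hval (x : halg) : G -> C := sval x.
Definition hin f (hf : hecke f) : halg := exist _ f (mem_set hf).

Lemma hvalP (x : halg) : hecke (hval x). Proof. exact: set_mem (svalP x). Qed.
Lemma hval_inj : injective hval. Proof. exact: val_inj. Qed.

Definition hadd (x y : halg) : halg := hin (heckeD hp (hvalP x) (hvalP y)).
Definition hscale (c : C) (x : halg) : halg := hin (heckeZ hp c (hvalP x)).
Definition hmul (x y : halg) : halg := hin (hecke_conv hp (hvalP x) (hvalP y)).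
Definition hstar (x : halg) : halg := hin (hecke_invol hp (hvalP x)).
Definition hzero : halg := hin (hecke0 (R := R) hp).
Definition hone : halg := hin (hecke_hunit (R := R) hp).

Let haddA : associative hadd.
Proof. by move=> x y z; apply: hval_inj; apply/funext => g /=; rewrite addrA. Qed.
Let haddC : commutative hadd.
Proof. by move=> x y; apply: hval_inj; apply/funext => g /=; rewrite addrC. Qed.
Let hadd0 : left_id hzero hadd.
Proof. by move=> x; apply: hval_inj; apply/funext => g /=; rewrite add0r. Qed.
Let haddN : left_inverse hzero (hscale (-1)) hadd.
Proof. by move=> x; apply: hval_inj; apply/funext => g /=; rewrite mulN1r addNr. Qed.

HB.instance Definition _ := GRing.isZmodule.Build halg haddA haddC hadd0 haddN.

Let L1h (x : halg) : L1 mu U (hval x) := hecke_L1 hp (hvalP x).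

Let hmulA : associative hmul.
Proof. by move=> x y z; apply: hval_inj; rewrite /= (convA hp) //; exact: hvalP. Qed.
Let hmulC : commutative hmul.
Proof. by move=> x y; apply: hval_inj; apply: gp; exact: L1h. Qed.
Let hmul1 : left_id hone hmul.
Proof. by move=> x; apply: hval_inj; apply: (conv1f hp); exact: hecke_biinv (hvalP x). Qed.
Let hmulDl : left_distributive hmul +%R.
Proof. by move=> x y z; apply: hval_inj; apply: (convDl hp); exact: L1h. Qed.
Let hone_neq0 : hone != 0.
Proof.
apply/eqP => /(congr1 hval)/(congr1 (fun f => f 1%g)) /=.
rewrite hunitE ifT; last by apply/mem_set; case: (hp_subgroup hp).
by move/eqP; rewrite oner_eq0.
Qed.

HB.instance Definition _ :=
  GRing.Zmodule_isComNzRing.Build halg hmulA hmulC hmul1 hmulDl hone_neq0.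

Let hscaleA a b x : hscale a (hscale b x) = hscale (a * b) x.
Proof. by apply: hval_inj; apply/funext => g /=; rewrite mulrA. Qed.
Let hscale1 : left_id 1 hscale.
Proof. by move=> x; apply: hval_inj; apply/funext => g /=; rewrite mul1r. Qed.
Let hscaleDr : right_distributive hscale +%R.
Proof. by move=> c x y; apply: hval_inj; apply/funext => g /=; rewrite mulrDr. Qed.
Let hscaleDl x : {morph hscale^~ x : a b / a + b}.
Proof. by move=> a b; apply: hval_inj; apply/funext => g /=; rewrite mulrDl. Qed.

HB.instance Definition _ :=
  GRing.Zmodule_isLmodule.Build C halg hscaleA hscale1 hscaleDr hscaleDl.

Let hscaleAl (c : C) (x y : halg) : c *: (x * y) = c *: x * y.
Proof. by apply: hval_inj; rewrite /= [RHS](convZl hp) //; exact: L1h. Qed.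

HB.instance Definition _ := GRing.Lmodule_isLalgebra.Build C halg hscaleAl.
HB.instance Definition _ := GRing.Lalgebra_isComAlgebra.Build C halg.

(** In general the involution reverses convolutions; commutativity restores the order, as the
    hypothesis [starM] of the abstract theory demands. *)
Lemma invol_conv f1 f2 : hecke f1 -> hecke f2 ->
  invol (conv f1 f2) = conv (invol f1) (invol f2).
Proof.
move=> h1 h2; have [i1 i2] := (hecke_invol hp h1, hecke_invol hp h2).
rewrite (gp (hecke_L1 hp i1) (hecke_L1 hp i2)); apply/funext => g.
have ri := conv_integrable hp g^-1%g (hecke_L1 hp h1) (hecke_L1 hp h2).
rewrite /invol /convolution -(cintegral_conj hp ri).
have ri2 := conv_integrable hp g (hecke_L1 hp i2) (hecke_L1 hp i1).
rewrite -[RHS](cintegral_mulgl hp g (proj1 ri2)); congr (cintegral _ _ _).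
apply/funext => h; rewrite /invol rmorphM /= mulrC.
by rewrite [((g * h)^-1 * g)^-1%g]invgM invgK mulKg invgM.
Qed.

Lemma hecke_seminorm_character (p : (G -> C) -> R) f :
  (forall f, hecke f -> 0 <= p f) ->
  (forall f1 f2, hecke f1 -> hecke f2 -> p (fun x => f1 x + f2 x) <= p f1 + p f2) ->
  (forall c f, hecke f -> p (fun x => c * f x) = cabs c * p f) ->
  (forall f1 f2, hecke f1 -> hecke f2 -> p (conv f1 f2) <= p f1 * p f2) ->
  (forall f, hecke f -> p (conv (invol f) f) = p f ^+ 2) ->
  hecke f -> p f != 0 ->
  exists2 w, star_spherical mu U w & cabs (chi mu w f) = p f.
Proof.
move=> p0 pD pZ pM pS hf pf.
have hu := hecke_hunit (R := R) hp.
(* At the unit the C*-identity says that [p] equals its square there; the value is nonzero because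
   it times [p f] bounds the nonzero [p f]. *)
have p1 : p (hunit R U) = 1.
  have i1 : invol (hunit R U) = hunit R U.
    apply/funext => x; rewrite /invol !hunitE.
    have [_ _ UV] := hp_subgroup hp.
    have -> : (x^-1 \in U)%g = (x \in U).
      apply/idP/idP => /set_mem; last by move=> ?; apply/mem_set; exact: UV.
      by move=> /UV; rewrite invgK => ?; exact/mem_set.
    by case: ifP => _; rewrite ?conjC1 ?conjC0.
  have := pS _ hu; rewrite i1 (conv1f hp); last exact: hecke_biinv hu.
  have : p (hunit R U) != 0.
    apply: contra_neq pf => z; apply: le_anti; rewrite p0 // andbT.
    by have := pM _ _ hu hf; rewrite (conv1f hp (hecke_biinv hf)) z mul0r.
  by move=> nz; rewrite expr2 => /(congr1 (fun t => t / p (hunit R U))); rewrite mulfK // divff.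
have sP : @cstar_seminorm R halg hstar (fun x => p (hval x)).
  split.
  - by move=> x; apply: p0; exact: hvalP.
  - by move=> x y; apply: pD; exact: hvalP.
  - by move=> c x; apply: pZ; exact: hvalP.
  - by move=> x y; apply: pM; exact: hvalP.
  - by move=> x; apply: pS; exact: hvalP.
  - exact: p1.
have sD : {morph hstar : x y / x + y}.
  by move=> x y; apply: hval_inj; apply/funext => g; rewrite /= /invol rmorphD.
have sM : {morph hstar : x y / x * y}.
  by move=> x y; apply: hval_inj; apply: invol_conv; exact: hvalP.
have sZ (c : C) (x : halg) : hstar (c *: x) = c^* *: hstar x.
  by apply: hval_inj; apply/funext => g; rewrite /= /invol rmorphM.
have sK : involutive hstar.
  by move=> x; apply: hval_inj; apply/funext => g; rewrite /= /invol invgK conjCK.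
have [|X [XZ XS Xf]] := @cstar_seminorm_character _ _ _ sD sM sZ sK _ (hin hf) sP.
  exact: pf.
(* [character_ex] takes a map on all functions, hence this extension by 0 of the character of
   [halg]. *)
pose Y f' : C := if pselect (hecke f') is left h then X (hin h) else 0.
have YE f' (h : hecke f') : Y f' = X (hin h).
  by rewrite /Y; case: pselect => // h'; rewrite (Prop_irrelevance h h').
have [|||||w sw wE] := @character_ex _ _ _ _ hp Y.
- move=> f1 f2 h1 h2; rewrite (YE _ h1) (YE _ h2) (YE _ (heckeD hp h1 h2)) -rmorphD.
  by congr (X _); apply: hval_inj.
- move=> c f' h; rewrite (YE _ h) (YE _ (heckeZ hp c h)) -XZ.
  by congr (X _); apply: hval_inj.
- move=> f1 f2 h1 h2; rewrite (YE _ h1) (YE _ h2) (YE _ (hecke_conv hp h1 h2)) -rmorphM.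
  by congr (X _); apply: hval_inj.
- move=> f' h; rewrite (YE _ h) (YE _ (hecke_invol hp h)) -XS.
  by congr (X _); apply: hval_inj.
- by rewrite (YE _ hu) -(rmorph1 X); congr (X _); apply: hval_inj.
by exists w => //; rewrite -wE // (YE _ hf) Xf.
Qed.

End HeckeRing.

(** * Representations on Hilbert spaces *)

Section ComplexNorm.
Variable R : realType.
Local Notation C := R[i].

Lemma gt0C (e : C) : 0 < e -> exists2 r : R, 0 < r & e = r%:C%C.
Proof.
move=> e0; exists (complex.Re e).
  by move: e0; rewrite ltcE => /andP[].
by rewrite RRe_real // realE ltW.
Qed.

Variable V : normedModType C.
Implicit Types v w : V.

Definition cnorm v : R := complex.Re `|v|.

Lemma cnormE v : (cnorm v)%:C%C = `|v|.
Proof. by rewrite /cnorm RRe_real // realE normr_ge0. Qed.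

Lemma cnorm_ge0 v : 0 <= cnorm v.
Proof. by apply: (@Re_le _ 0). Qed.

Lemma cnormD v w : cnorm (v + w) <= cnorm v + cnorm w.
Proof. by rewrite -lecR rmorphD /= !cnormE ler_normD. Qed.

Lemma cnormN v : cnorm (- v) = cnorm v.
Proof. by rewrite /cnorm normrN. Qed.

Lemma cnormB v w : cnorm (v - w) <= cnorm v + cnorm w.
Proof. by rewrite -[cnorm w]cnormN cnormD. Qed.

Lemma cnormZ (c : C) v : cnorm (c *: v) = cabs c * cnorm v.
Proof. by apply: complexI; rewrite rmorphM /= !cnormE cabsE normrZ. Qed.

Lemma cnorm0 : cnorm 0 = 0. Proof. by rewrite /cnorm normr0. Qed.

Lemma cnorm_eq0 v : cnorm v = 0 -> v = 0.
Proof. by move=> h; apply/eqP; rewrite -normr_eq0 -cnormE h. Qed.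

Lemma cnorm_le1 v : (`|v| <= 1) = (cnorm v <= 1).
Proof. by rewrite -cnormE -lecR. Qed.

Lemma dense_cnorm (S : set V) : (forall v (e : R), 0 < e -> exists2 w, S w & cnorm (v - w) < e) ->
  dense S.
Proof.
move=> h O [v Ov] oO.
have /nbhs_ballP[e /= /gt0C[r r0 ->] be] : nbhs v O by apply: open_nbhs_nbhs.
have [w Sw vw] := h v r r0; exists w; split=> //; apply: be.
by rewrite -ball_normE /= -cnormE ltcR.
Qed.

Lemma cnorm_dense (S : set V) : dense S ->
  forall v (e : R), 0 < e -> exists2 w, S w & cnorm (v - w) < e.
Proof.
move=> dS v e e0.
have e0' : 0 < e%:C%C :> C by rewrite ltcR.
have [|w [/= vw Sw]] := dS (ball v e%:C%C)^° _ (open_interior _).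
  by exists v; apply: nbhsx_ballx.
exists w => //; have := interior_subset vw.
by rewrite -ball_normE /= -cnormE ltcR.
Qed.

End ComplexNorm.

Lemma complex_norm_complete (R : realType) (F : set_system R[i]^o) :
  ProperFilter F -> cauchy F -> cvg F.
Proof.
move=> FF /cauchyP Fc.
have part (p : R[i] -> R) : (forall c d, p (c - d) = p c - p d) ->
    (forall c, `|p c| <= cabs c) -> cvg (p @ F).
  move=> pB ple; apply: cauchy_cvg; apply/cauchyP => e e0.
  have e0' : 0 < e%:C%C :> R[i] by rewrite ltcR.
  have [x Fx] := Fc _ e0'; exists (p x); change (F (p @^-1` ball (p x) e)); apply: filterS Fx => y /=.
  rewrite -!ball_normE /= => h; rewrite -pB (le_lt_trans (ple _)) //.
  by rewrite -ltcR cabsE.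
have ReB (c d : R[i]) : complex.Re (c - d) = complex.Re c - complex.Re d.
  by case: c d => [? ?] [? ?].
have ImB (c d : R[i]) : complex.Im (c - d) = complex.Im c - complex.Im d.
  by case: c d => [? ?] [? ?].
have /cvg_ex[a Fa] := part _ ReB (@Re_le_cabs R).
have /cvg_ex[b Fb] := part _ ImB (@Im_le_cabs R).
apply/cvg_ex; exists (Complex a b : R[i]^o); apply/cvgrPdist_lt => _ /gt0C[e e0 ->].
have e2 : 0 < e / 2 by rewrite divr_gt0.
have /cvgrPdist_lt /(_ _ e2) Fa' := Fa.
have /cvgrPdist_lt /(_ _ e2) Fb' := Fb.
apply: filterS2 Fa' Fb' => c h1 h2.
rewrite -cabsE ltcR (le_lt_trans (cabs_le_ReIm _)) // ReB ImB /=.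
by rewrite (splitr e) ltrD.
Qed.

(* An alias, because the library already attaches a completeness instance
   (for real fields only) to the head constant of [R[i]^o]. *)
Definition complex_line (R : realType) : Type := R[i]^o.

HB.instance Definition _ (R : realType) := NormedModule.copy (complex_line R) R[i]^o.
HB.instance Definition _ (R : realType) :=
  Uniform_isComplete.Build (complex_line R) (@complex_norm_complete R).

Section HilbertLine.
Variable R : realType.
Local Notation C := R[i].
Local Notation CL := (complex_line R).

Definition line_dot (x y : CL) : C := (x : C) * (y : C)^*.

Let line_dot_bilinear : bilinear_for
  (GRing.Scale.Law.clone _ _ ( *%R ) _)
  (GRing.Scale.Law.clone _ _ (Num.conj \; *%R ) _) line_dot.
Proof.
split=> [y a x x'|x a y y'] /=; rewrite /line_dot.
  by rewrite mulrDl mulrA.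
by rewrite rmorphD rmorphM /= mulrDr mulrCA.
Qed.

HB.instance Definition _ := bilinear_isBilinear.Build C CL CL C _ _ line_dot line_dot_bilinear.

Let line_dot_herm (x y : CL) : line_dot x y = (-1) ^+ false * (line_dot y x)^*.
Proof. by rewrite expr0 mul1r /line_dot rmorphM /= conjCK mulrC. Qed.

HB.instance Definition _ := isHermitianSesquilinear.Build C CL false Num.conj line_dot line_dot_herm.

Let line_dot_gt0 (u : CL) : u != 0 -> 0 < line_dot u u.
Proof. by move=> u0; rewrite /line_dot -normCK exprn_gt0 // normr_gt0. Qed.

HB.instance Definition _ := isDotProduct.Build C CL line_dot line_dot_gt0.

Definition hilbert_line : hilbertType R :=
  @HilbertType R CL line_dot (fun v => normCK v).

End HilbertLine.

Section HilbertSpace.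
Variables (R : realType) (H : hilbertType R).
Local Notation C := R[i].
Implicit Types v w : H.
Local Notation "'[ v , w ]" := (hdot H v w).

Lemma hdotC v w : '[w, v] = '[v, w]^*.
Proof. by have := @hermitian_subproof _ _ _ _ (hdot H) w v; rewrite expr0 mul1r. Qed.

Lemma cnorm_sqr v : cnorm v ^+ 2 = complex.Re '[v, v].
Proof. by rewrite -hdot_norm -cnormE -rmorphXn. Qed.

Lemma Re_hdotC v w : complex.Re '[w, v] = complex.Re '[v, w].
Proof. by rewrite hdotC; case: (ReIm_conj '[v, w]). Qed.

Lemma cnorm_sub_sqr v w :
  cnorm (v - w) ^+ 2 = cnorm v ^+ 2 + cnorm w ^+ 2 - 2 * complex.Re '[v, w].
Proof.
rewrite !cnorm_sqr linearBl /= !linearBr /=.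
have ReB (c d : C) : complex.Re (c - d) = complex.Re c - complex.Re d.
  by case: c d => [? ?] [? ?].
by rewrite !ReB (Re_hdotC v w); ring.
Qed.

Lemma Re_hdotZ (a b : R) v w :
  complex.Re '[a%:C%C *: v, b%:C%C *: w] = a * b * complex.Re '[v, w].
Proof.
rewrite linearZl_LR linearZr_LR /= conjR.
by case: '[v, w] => x y /=; ring.
Qed.

Lemma Re_hdot_le v w : complex.Re '[v, w] <= cnorm v * cnorm w.
Proof.
have [v0|v0] := eqVneq (cnorm v) 0.
  by rewrite (cnorm_eq0 v0) linear0l cnorm0 mul0r.
have [w0|w0] := eqVneq (cnorm w) 0.
  by rewrite (cnorm_eq0 w0) linear0r cnorm0 mulr0.
have vp : 0 < cnorm v by rewrite lt_def v0 cnorm_ge0.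
have wp : 0 < cnorm w by rewrite lt_def w0 cnorm_ge0.
(* Both vectors are scaled to the same norm; expanding the square leaves [2 |v| |w|] times the
   wanted difference. *)
have := sqr_ge0 (cnorm ((cnorm w)%:C%C *: v - (cnorm v)%:C%C *: w)).
rewrite cnorm_sub_sqr Re_hdotZ !cnormZ !cabs_real !ger0_norm ?cnorm_ge0 //.
move: (complex.Re _) (cnorm v) (cnorm w) vp wp {v0 w0} => r a b a0 b0.
have ab := mulr_gt0 a0 b0.
have -> : (b * a) ^+ 2 + (a * b) ^+ 2 - 2 * (b * a * r) = (a * b) * (2 * (a * b - r)) by ring.
by rewrite pmulr_rge0 //; lra.
Qed.

Section Operators.
Variable T : {linear H -> H}.

Definition opn : R := fine (opnorm T).

Lemma opnorm_ge0 : (0 <= opnorm T)%E.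
Proof.
apply: ereal_sup_ubound; exists 0; first by rewrite /= normr0.
by rewrite linear0 normr0.
Qed.

Lemma opn_ge0 : 0 <= opn. Proof. exact: fine_ge0 opnorm_ge0. Qed.

Lemma opnorm_le (M : R) : 0 <= M -> (forall v, cnorm (T v) <= M * cnorm v) ->
  (opnorm T <= M%:E)%E.
Proof.
move=> M0 h; apply: ge_ereal_sup => _ [v /= v1 <-]; rewrite lee_fin.
by apply: le_trans (h v) _; rewrite ler_piMr // -cnorm_le1.
Qed.

Hypothesis Tfin : (opnorm T < +oo)%E.

Lemma opnE : opnorm T = opn%:E.
Proof. by rewrite /opn fineK // ge0_fin_numE // opnorm_ge0. Qed.

Lemma cnorm_op_le v : cnorm (T v) <= opn * cnorm v.
Proof.
have [v0|v0] := eqVneq (cnorm v) 0.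
  by rewrite (cnorm_eq0 v0) linear0 cnorm0 mulr0.
have vp : 0 < cnorm v by rewrite lt_def v0 cnorm_ge0.
have : ((cnorm (T ((cnorm v)^-1%:C%C *: v)))%:E <= opnorm T)%E.
  apply: ereal_sup_ubound; exists ((cnorm v)^-1%:C%C *: v) => //=.
  by rewrite cnorm_le1 cnormZ cabs_real ger0_norm ?invr_ge0 ?cnorm_ge0 // mulVf.
rewrite opnE lee_fin linearZ cnormZ cabs_real ger0_norm ?invr_ge0 ?cnorm_ge0 //.
by rewrite ler_pdivrMl // mulrC.
Qed.

Lemma opn_adherent e : e < opn -> exists2 v, cnorm v <= 1 & e < cnorm (T v).
Proof.
rewrite -lte_fin -opnE => /ereal_sup_gt[_ [v /= v1 <-]]; rewrite lte_fin => h.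
by exists v => //; rewrite -cnorm_le1.
Qed.

End Operators.
End HilbertSpace.

(** * Norm bounds for representations of the Hecke algebra and of L1 *)

Section Representations.
Variables (R : realType) (G : topologicalGroupType).
Variables (mu : {measure set (borel G) -> \bar R}) (U : set G).
Local Notation C := R[i].
Local Notation L1norm := (L1norm mu).
Local Notation conv := (convolution mu).
Local Notation hecke := (hecke (R := R) U).
Local Notation L1 := (L1 mu U).
Local Notation chi := (chi mu).
Implicit Types f : G -> C.

Hypothesis hp : hecke_pair mu U.
Hypothesis gp : gelfand_pair mu U.

Section Line.
Variables (A : set (G -> C)) (X : (G -> C) -> C).
Hypothesis XD : forall f1 f2, A f1 -> A f2 -> X (fun x => f1 x + f2 x) = X f1 + X f2.
Hypothesis XZ : forall c f, A f -> X (fun x => c * f x) = c * X f.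
Hypothesis XM : forall f1 f2, A f1 -> A f2 -> X (conv f1 f2) = X f1 * X f2.
Hypothesis XS : forall f, A f -> X (invol f) = (X f)^*.

Definition line_mul (c : C) : {linear hilbert_line R -> hilbert_line R} :=
  ( *:%R c : {linear complex_line R -> complex_line R}).

Lemma opnorm_line_mul c : opnorm (line_mul c) = (cabs c)%:E.
Proof.
apply: le_anti; apply/andP; split.
  apply: opnorm_le; first exact: cabs_ge0.
  by move=> v; rewrite cnormZ.
apply: ereal_sup_ubound; exists (1 : C); first by rewrite /= normr1.
have -> : line_mul c (1 : C) = c by exact: mulr1.
by [].
Qed.

Lemma line_rep : star_rep mu A (fun f => line_mul (X f)).
Proof.
split.
- by move=> f Af; rewrite opnorm_line_mul ltry.
- by move=> f1 f2 h1 h2 v; rewrite /line_mul /= XD // scalerDl.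
- by move=> c f h v; rewrite /line_mul /= XZ // scalerA.
- by move=> f1 f2 h1 h2 v; rewrite /line_mul /= XM // scalerA.
- move=> f h v w; rewrite /line_mul /= XS // linearZl_LR linearZr_LR /=.
  by rewrite conjCK.
Qed.

(** A *-character is a representation on the line, so its modulus is a lower bound for the universal
    norm. *)
Lemma cabs_le_rep_norm f : ((cabs (X f))%:E <= rep_norm mu A f)%E.
Proof.
rewrite -opnorm_line_mul; apply: ereal_sup_ubound.
exists (hilbert_line R), (fun f => line_mul (X f)); split=> //; exact: line_rep.
Qed.

End Line.

Section Rep.
(** [A] is kept abstract: for the Hecke algebra the facts below make the operator norm a C*-seminorm
    fit for [hecke_seminorm_character], for L1 they enter the contraction bound. *)
Variables (A : set (G -> C)) (H : hilbertType R) (pi : (G -> C) -> {linear H -> H}).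
Hypothesis Ainvol : forall f, A f -> A (invol f).
Hypothesis Aconv : forall f1 f2, A f1 -> A f2 -> A (conv f1 f2).
Hypothesis AD : forall f1 f2, A f1 -> A f2 -> A (fun x => f1 x + f2 x).
Hypothesis AZ : forall c f, A f -> A (fun x => c * f x).
Hypothesis piP : star_rep mu A pi.

Let pfin f : A f -> (opnorm (pi f) < +oo)%E. Proof. by case: piP => h _ _ _ _; exact: h. Qed.
Let piD f1 f2 : A f1 -> A f2 -> forall v, pi (fun g => f1 g + f2 g) v = pi f1 v + pi f2 v.
Proof. by case: piP => _ h _ _ _; exact: h. Qed.
Let piZ c f : A f -> forall v, pi (fun g => c * f g) v = c *: pi f v.
Proof. by case: piP => _ _ h _ _; exact: h. Qed.
Let piM f1 f2 : A f1 -> A f2 -> forall v, pi (conv f1 f2) v = pi f1 (pi f2 v).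
Proof. by case: piP => _ _ _ h _; exact: h. Qed.
Let piS f : A f -> forall v w, hdot H (pi f v) w = hdot H v (pi (invol f) w).
Proof. by case: piP => _ _ _ _ h; exact: h. Qed.

Local Notation p f := (opn (pi f)).

Lemma rep_opn_le f (M : R) : A f -> 0 <= M -> (forall v, cnorm (pi f v) <= M * cnorm v) -> p f <= M.
Proof. by move=> Af M0 h; rewrite -lee_fin -opnE ?pfin //; exact: opnorm_le. Qed.

Lemma rep_opnD f1 f2 : A f1 -> A f2 -> p (fun x => f1 x + f2 x) <= p f1 + p f2.
Proof.
move=> h1 h2; apply: rep_opn_le; [exact: AD|by rewrite addr_ge0 // opn_ge0|].
move=> v; rewrite piD // mulrDl (le_trans (cnormD _ _)) // lerD //;
  by apply: cnorm_op_le; exact: pfin.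
Qed.

Lemma rep_opnZ_le c f : A f -> p (fun x => c * f x) <= cabs c * p f.
Proof.
move=> h; apply: rep_opn_le; [exact: AZ|by rewrite mulr_ge0 ?cabs_ge0 ?opn_ge0|].
move=> v; rewrite piZ // cnormZ -mulrA ler_wpM2l ?cabs_ge0 //.
by apply: cnorm_op_le; exact: pfin.
Qed.

Lemma rep_opnZ c f : A f -> p (fun x => c * f x) = cabs c * p f.
Proof.
move=> h; have [->|c0] := eqVneq c 0.
  apply: le_anti; rewrite rep_opnZ_le //= cabs0 mul0r; exact: opn_ge0.
have cp : 0 < cabs c by rewrite lt_def cabs_ge0 cabs_eq0 c0.
apply: le_anti; rewrite rep_opnZ_le //=.
have := rep_opnZ_le c^-1 (AZ c h).
have -> : (fun x => c^-1 * (c * f x)) = f by apply/funext => x; rewrite mulKf.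
have -> : cabs c^-1 = (cabs c)^-1.
  by apply: (mulfI (lt0r_neq0 cp)); rewrite -cabsM divff // cabs1 divff // gt_eqF.
by rewrite ler_pdivlMl.
Qed.

Lemma rep_opnM f1 f2 : A f1 -> A f2 -> p (conv f1 f2) <= p f1 * p f2.
Proof.
move=> h1 h2; apply: rep_opn_le; [exact: Aconv|by rewrite mulr_ge0 ?opn_ge0|].
move=> v; rewrite piM // -mulrA (le_trans (cnorm_op_le (pfin h1) _)) //.
by rewrite ler_wpM2l ?opn_ge0 //; apply: cnorm_op_le; exact: pfin.
Qed.

Lemma rep_cnorm_sqr f v : A f ->
  cnorm (pi f v) ^+ 2 = complex.Re (hdot H v (pi (conv (invol f) f) v)).
Proof. by move=> h; rewrite cnorm_sqr piS // -piM //; exact: Ainvol. Qed.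

Lemma rep_sqr_le f : A f -> p f ^+ 2 <= p (conv (invol f) f).
Proof.
move=> h; have hc := Aconv (Ainvol h) h.
have q0 : 0 <= p (conv (invol f) f) by exact: opn_ge0.
rewrite -[leRHS]sqr_sqrtr // ler_sqr ?nnegrE ?opn_ge0 ?sqrtr_ge0 //.
apply: rep_opn_le => //.
move=> v; rewrite -ler_sqr ?nnegrE ?mulr_ge0 ?sqrtr_ge0 ?cnorm_ge0 //.
rewrite exprMn sqr_sqrtr // rep_cnorm_sqr //.
apply: le_trans (Re_hdot_le _ _) _.
have := cnorm_op_le (pfin hc) v; have := cnorm_ge0 v.
move: (cnorm (pi _ v)) (cnorm v) (p _) => a b c b0 ab.
by rewrite expr2 mulrCA ler_wpM2l.
Qed.

Lemma rep_opn_invol f : A f -> p (invol f) = p f.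
Proof.
have half g : A g -> p g <= p (invol g).
  move=> h; have [->|p0] := eqVneq (p g) 0; first exact: opn_ge0.
  have pp : 0 < p g by rewrite lt_def p0 opn_ge0.
  rewrite -(ler_pM2r pp) -expr2; apply: le_trans (rep_sqr_le h) _.
  by apply: rep_opnM => //; exact: Ainvol.
move=> h; apply: le_anti; rewrite half // andbT.
have := half _ (Ainvol h).
have -> // : invol (invol f) = f.
by apply/funext => x; rewrite /invol invgK conjCK.
Qed.

Lemma rep_opn_star f : A f -> p (conv (invol f) f) = p f ^+ 2.
Proof.
move=> h; apply: le_anti; rewrite rep_sqr_le // andbT.
apply: le_trans (rep_opnM (Ainvol h) h) _.
by rewrite rep_opn_invol // expr2.
Qed.

End Rep.

Lemma star_rep_hecke_le (H : hilbertType R) (pi : (G -> C) -> {linear H -> H}) f (K : R) :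
  star_rep mu hecke pi -> hecke f -> 0 <= K ->
  (forall w, star_spherical mu U w -> cabs (chi w f) <= K) ->
  (opnorm (pi f) <= K%:E)%E.
Proof.
move=> piP hf K0 h.
have [i1 [i2 [i3 i4]]] := (hecke_invol hp, (hecke_conv hp, (heckeD hp, heckeZ hp))).
have fin : (opnorm (pi f) < +oo)%E by case: piP => h' _ _ _ _; exact: h'.
rewrite opnE // lee_fin; have [->//|p0] := eqVneq (opn (pi f)) 0.
have [|||||||w sw <-] // := @hecke_seminorm_character _ _ _ _ hp gp (fun f => opn (pi f)) f.
- by move=> *; exact: opn_ge0.
- by move=> f1 f2 h1 h2; exact: (rep_opnD i3 piP).
- by move=> c f' h'; exact: (rep_opnZ i4 piP).
- by move=> f1 f2 h1 h2; exact: (rep_opnM i2 piP).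
- by move=> f' h'; exact: (rep_opn_star i1 i2 piP).
exact: h.
Qed.

(* With [T = pi (f* * f) / |pi f|^2], which is self-adjoint of norm [1], the
   Neumann inverse in [L1] would make [1 - T] invertible, whereas unit vectors
   almost attaining [|pi f|] are approximate fixed vectors of [T]. *)
Lemma star_rep_L1_le (H : hilbertType R) (pi : (G -> C) -> {linear H -> H}) f :
  star_rep mu L1 pi -> L1 f -> (opnorm (pi f) <= (L1norm f)%:E)%E.
Proof.
move=> piP Lf; have [fin piD piZ piM piS] := piP.
have [i1 [i2 [i3 i4]]] := (L1_invol hp, (L1_conv hp, (L1D hp, L1Z hp))).
rewrite (opnE (fin _ Lf)) lee_fin leNgt; apply/negP => lt.
set M := opn (pi f) in lt.
have M0 : 0 < M by apply: le_lt_trans lt; exact: L1norm_ge0.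
pose ff := conv (invol f) f.
have Lff : L1 ff by apply: i2 => //; exact: i1.
pose c : C := ((M ^+ 2)^-1)%:C%C.
have cabsc : cabs c = (M ^+ 2)^-1 by rewrite cabs_real ger0_norm // invr_ge0 sqr_ge0.
pose h x := c * ff x.
have Lh : L1 h by exact: i4.
have h1 : L1norm h < 1.
  rewrite (L1normZ hp) // cabsc mulrC ltr_pdivrMr ?exprn_gt0 // mul1r.
  apply: le_lt_trans (L1norm_conv hp (i1 _ Lf) Lf) _.
  rewrite (L1norm_invol hp) // -expr2 ltr_sqr ?nnegrE ?L1norm_ge0 //.
  exact: ltW.
have [z Lz zE] := neumann hp Lh h1.
have piz v : pi z v = pi h v + pi z (pi h v).
  by rewrite {1}zE piD //; [rewrite (gp Lh Lz) piM|exact: i2].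
have pih v : pi h v = c *: pi ff v by rewrite piZ.
(* The quasi-inverse gives [pi h = pi z (1 - pi h)], so a vector almost fixed by [pi h] is almost
   annihilated by it. *)
have key v : cnorm (pi h v) <= opn (pi z) * cnorm (v - pi h v).
  have -> : pi h v = pi z (v - pi h v) by rewrite linearB /= {1}piz addrK.
  rewrite [X in _ * cnorm (v - X)](_ : _ = pi h v); last first.
    by rewrite linearB /= {1}piz addrK.
  exact: (cnorm_op_le (fin _ Lz)).
have sq v : complex.Re (hdot H v (pi h v)) = (cnorm (pi f v) / M) ^+ 2.
  rewrite expr_div_n (rep_cnorm_sqr i1 piP) // pih.
  have := Re_hdotZ (1 : R) (M ^+ 2)^-1 v (pi ff v).
  by rewrite scale1r mul1r mulrC.
have hnle v : cnorm (pi h v) <= cnorm v.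
  rewrite pih cnormZ cabsc ler_pdivrMl ?exprn_gt0 //.
  by rewrite /M -(rep_opn_star i1 i2 piP) //; exact: (cnorm_op_le (fin _ Lff)).
set k := opn (pi z) in key.
have k0 : 0 <= k by exact: opn_ge0.
(* For [T = pi h], the vector below has [|v - T v|^2 <= 4 d], so [key] gives
   [|T v|^2 <= 4 d k^2 < 1/2]; but [d <= 1/8] and [|T v| > (1 - d)^2 >= 49/64] give
   [|T v|^2 > 1/2]. *)
pose d : R := (8 * (k ^+ 2 + 1))^-1.
have d0 : 0 < d by rewrite invr_gt0; have := sqr_ge0 k; lra.
have dk : d * (8 * (k ^+ 2 + 1)) = 1.
  by rewrite mulVf //; have := sqr_ge0 k; move=> ?; apply: lt0r_neq0; lra.
have [|v v1 hv] := @opn_adherent _ _ (pi f) (fin _ Lf) (M * (1 - d)).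
  by rewrite -/M gtr_pMr //; lra.
pose s := cnorm (pi f v) / M.
have s1 : 1 - d < s by rewrite ltr_pdivlMr // mulrC.
have t1 : cnorm (pi h v) <= 1 by exact: le_trans (hnle v) v1.
have t2 : s ^+ 2 <= cnorm (pi h v).
  rewrite -sq; apply: le_trans (Re_hdot_le _ _) _.
  by rewrite ler_piMl // cnorm_ge0.
have t3 := key v; have t4 := cnorm_sub_sqr v (pi h v); rewrite sq -/s in t4.
have t5 := cnorm_ge0 v; have t6 := cnorm_ge0 (v - pi h v).
move: (cnorm (pi h v)) (cnorm v) (cnorm (v - pi h v)) t1 t2 t3 t4 t5 t6 v1 => a b e.
move=> a1 sa ae e2 b0 e0 b1.
have s0 : (1 - d) ^+ 2 < s ^+ 2.
  have d8 : d <= 1 / 8 by have := sqr_ge0 k; nra.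
  by rewrite ltr_sqr ?nnegrE //; lra.
have e3 : e ^+ 2 <= 4 * d.
  have : b ^+ 2 <= 1 by rewrite expr_le1.
  have : a ^+ 2 <= 1 by rewrite expr_le1 //; apply: le_trans sa; exact: sqr_ge0.
  have := sqr_ge0 d; nra.
have a2 : 1 / 2 < a.
  have d8 : d <= 1 / 8 by have := sqr_ge0 k; nra.
  nra.
have : a ^+ 2 <= k ^+ 2 * e ^+ 2.
  rewrite -exprMn ler_sqr ?nnegrE //; first lra.
  by rewrite mulr_ge0.
have := sqr_ge0 k; have := sqr_ge0 e; nra.
Qed.

End Representations.

Lemma subr_cancel (V : zmodType) (a b u v x : V) :
  x = b + v -> a - (b + u) = (a - x) - (u - v).
Proof. by move=> ->; rewrite opprB addrA !opprD !addrA subrK. Qed.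

(** * Boundedness from the isomorphism *)

Section Necessity.
Variables (R : realType) (G : topologicalGroupType).
Variables (mu : {measure set (borel G) -> \bar R}) (U : set G).
Local Notation C := R[i].
Local Notation L1norm := (L1norm mu).
Local Notation conv := (convolution mu).
Local Notation hecke := (hecke (R := R) U).
Local Notation chi := (chi mu).
Implicit Types f : G -> C.

Hypothesis hp : hecke_pair mu U.

Lemma bounded_cabsP (w : G -> C) :
  bounded_fun (w : G -> C^o) <-> exists M : R, forall x, cabs (w x) <= M.
Proof.
split=> [[M [Mr hM]]|[M hM]].
  exists (complex.Re (M + 1)) => x; apply: Re_le.
  by apply: (hM (M + 1)) => //; rewrite ltrDl.
exists M%:C%C; split; first by apply/complex_realP; exists M.
move=> N MN x _ /=; apply: le_trans (ltW MN).
have -> : `|w x : C^o| = (cabs (w x))%:C%C by rewrite cabsE.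
by rewrite lecR.
Qed.

Lemma hecke_chi_le_rep_norm w f : star_spherical mu U w -> hecke f ->
  ((cabs (chi w f))%:E <= rep_norm mu hecke f)%E.
Proof.
move=> sw hf; have [[_ _ bw _] _] := sw; have rw := biinv_rinv hp bw.
apply: (@cabs_le_rep_norm _ _ mu hecke (chi w)).
- by move=> f1 f2 h1 h2; exact: (chiD hp).
- by move=> c f' h; exact: (chiZ hp).
- by move=> f1 f2 h1 h2; apply: (chiM hp) => //; case: sw.
- by move=> f' h; exact: (chi_star hp).
Qed.

(** Instead of extending [chi w] to the completion, the quasi-inverse [x] pulled back to [CH] is
    approximated by a Hecke function [g]. Since [chi w h = 1], the element [t = g - (h + h * g)] has
    [chi w t = -1] whatever [g] is, while its norm tends to 0 as [g] approaches [x]. *)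
Lemma iso_chi_le w f : canonical_surjection_iso mu U -> star_spherical mu U w ->
  hecke f -> cabs (chi w f) <= L1norm f.
Proof.
move=> [CH [CL [phi [[phiM phiS] phiE phibij]]]] sw hf.
have [[_ _ bw _] _] := sw; have rw := biinv_rinv hp bw.
rewrite leNgt; apply/negP => lt.
have c0 : chi w f != 0.
  by rewrite -cabs_eq0 gt_eqF // (le_lt_trans _ lt) // L1norm_ge0.
pose h x := (chi w f)^-1 * f x.
have hh : hecke h by exact: (heckeZ hp).
have Lh := hecke_L1 hp hh.
have ch : chi w h = 1 by rewrite (chiZ hp) // mulVf.
have h1 : L1norm h < 1.
  have cp : 0 < cabs (chi w f) by rewrite lt_def cabs_ge0 cabs_eq0 c0.
  rewrite (L1normZ hp); last exact: (hecke_L1 hp).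
  have -> : cabs (chi w f)^-1 = (cabs (chi w f))^-1.
    by apply: (mulfI (lt0r_neq0 cp)); rewrite -cabsM divff // cabs1 divff // gt_eqF.
  by rewrite mulrC ltr_pdivrMr // mul1r.
have [z Lz zE] := neumann hp Lh h1.
have Lhz := L1_conv hp Lh Lz.
have ez : completion_emb CL z =
    completion_emb CL h + cmul (completion_emb CL h) (completion_emb CL z).
  by rewrite {1}zE completion_embD // completion_embM.
have [psi psiK phiK] := phibij.
pose x := psi (completion_emb CL z).
have ex : x = completion_emb CH h + cmul (completion_emb CH h) x.
  by apply: (can_inj psiK); rewrite linearD /= phiM phiE // /x phiK.
pose K := cnorm (completion_emb CH h).
have K0 : 0 <= K by exact: cnorm_ge0.
(* The norm of [t] is at most [(1 + K)] times the distance from [g] to [x], hence below 1 for this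
   [e]. *)
pose e : R := (2 * (1 + K))^-1.
have e0 : 0 < e by rewrite invr_gt0; lra.
have eK : (1 + K) * e < 1.
  by rewrite ltr_pdivrMr; lra.
have [_ [g hg <-] dg] := cnorm_dense (@completion_dense _ _ _ _ CH) x e0.
pose t y := g y + (- 1) * (h y + conv h g y).
have hc := hecke_conv hp hh hg; have hs := heckeD hp hh hc.
have ht : hecke t by apply: (heckeD hp) => //; exact: (heckeZ hp).
have ct : chi w t = - 1.
  have sp : spherical mu U w by case: sw.
  rewrite (chiD hp hg _ rw); last exact: (heckeZ hp).
  rewrite (chiZ hp _ hs rw) (chiD hp hh hc rw) (chiM hp hh hg sp) ch.
  by move: (chi w g) => r; ring.
have et : completion_emb CH t = (completion_emb CH g - x) -
    cmul (completion_emb CH h) (completion_emb CH g - x).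
  rewrite completion_embD //; last exact: (heckeZ hp).
  rewrite completion_embZ // completion_embD // completion_embM // scaleN1r.
  have cB : cmul (completion_emb CH h) (completion_emb CH g - x) =
     cmul (completion_emb CH h) (completion_emb CH g) - cmul (completion_emb CH h) x.
    by rewrite cmulDr -scaleN1r cmulZr scaleN1r.
  rewrite cB; apply: subr_cancel; exact: ex.
have := hecke_chi_le_rep_norm sw ht; rewrite -(completion_norm CH ht) ct lee_fin cabsN cabs1.
change (1 <= cnorm (completion_emb CH t) -> False).
rewrite et => le1; have := le_trans le1 (cnormB _ _).
have mle : cnorm (cmul (completion_emb CH h) (completion_emb CH g - x)) <=
    K * cnorm (completion_emb CH g - x).
  by have := cnormM (completion_emb CH h) (completion_emb CH g - x);
    rewrite -!cnormE -rmorphM lecR.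
move=> le2; have {mle} le3 := le_trans le2 (lerD (lexx _) mle).
have dg' : cnorm (completion_emb CH g - x) < e by rewrite -cnormN opprB.
move: (cnorm (completion_emb CH g - x)) dg' le3 => r r1.
have : (1 + K) * r <= (1 + K) * e by rewrite ler_wpM2l ?ltW //; lra.
move: eK; rewrite !mulrDl !mul1r; lra.
Qed.

Lemma iso_bounded w : canonical_surjection_iso mu U -> star_spherical mu U w ->
  bounded_fun (w : G -> C^o).
Proof.
move=> iso sw; apply/bounded_cabsP; exists 1; apply: (spherical_le1_of_chi hp).
  by case: sw => -[].
by move=> f hf; exact: iso_chi_le.
Qed.

End Necessity.

(** * The completions for bounded spherical functions *)

Section Completion.
Variables (R : realType) (G : topologicalGroupType).
Variables (mu : {measure set (borel G) -> \bar R}) (U : set G).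
Local Notation C := R[i].
Local Notation L1norm := (L1norm mu).
Local Notation conv := (convolution mu).
Local Notation hecke := (hecke (R := R) U).
Local Notation L1 := (L1 mu U).
Local Notation chi := (chi mu).
Implicit Types f : G -> C.

Hypothesis hp : hecke_pair mu U.
Hypothesis gp : gelfand_pair mu U.
Hypothesis sph_le1 : forall w, star_spherical mu U w -> forall x, cabs (w x) <= 1.

Definition sph : Type := {w : G -> C | star_spherical mu U w}.
Implicit Types s : sph.

(** Makes [sph] nonempty, so that suprema over it behave as norms. *)
Lemma star_spherical_cst : star_spherical mu U (fun=> 1).
Proof.
split=> [|g]; last by rewrite conjC1.
split=> //; first by move=> x; exact: cst_continuous.
move=> g1 g2; rewrite mul1r /cintegral /= !Rintegral_cst //;
  try exact: (open_borel (hp_open hp)).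
by rewrite (hp_muU hp) mul1r mul0r.
Qed.

Definition sph_triv : sph := exist _ (fun=> 1) star_spherical_cst.

Definition gtrans f s : C := chi (sval s) f.

Let bw s : biinvariant U (sval s). Proof. by case: (svalP s) => -[]. Qed.
Let le1 s x : cabs (sval s x) <= 1. Proof. exact: sph_le1 (svalP s) x. Qed.

Lemma gtrans_le f s : L1 f -> cabs (gtrans f s) <= L1norm f.
Proof. by move=> Lf; exact: (chi_le hp (bw s) (le1 s)). Qed.

Lemma gtransD f1 f2 s : L1 f1 -> L1 f2 ->
  gtrans (fun x => f1 x + f2 x) s = gtrans f1 s + gtrans f2 s.
Proof. exact: (chi_L1D hp (bw s) (le1 s)). Qed.

Lemma gtransZ c f s : L1 f -> gtrans (fun x => c * f x) s = c * gtrans f s.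
Proof. exact: (chi_L1Z hp (bw s) (le1 s)). Qed.

Lemma gtransB f1 f2 s : L1 f1 -> L1 f2 ->
  gtrans (fun x => f1 x - f2 x) s = gtrans f1 s - gtrans f2 s.
Proof. exact: (chi_L1B hp (bw s) (le1 s)). Qed.

Lemma gtransM f1 f2 s : L1 f1 -> L1 f2 ->
  gtrans (conv f1 f2) s = gtrans f1 s * gtrans f2 s.
Proof. by apply: (chi_L1M hp (bw s) (le1 s)); case: (svalP s). Qed.

Lemma gtransS f s : L1 f -> gtrans (invol f) s = (gtrans f s)^*.
Proof. by move=> Lf; apply: (chi_L1star hp (bw s) (le1 s)) => //; case: (svalP s). Qed.

Definition approximable (F : sph -> C) := forall e : R, 0 < e ->
  exists2 f, hecke f & forall s, cabs (F s - gtrans f s) <= e.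

Lemma approximable_gtrans f : L1 f -> approximable (gtrans f).
Proof.
move=> Lf e e0; have [g hg dg] := hecke_dense hp Lf e0; exists g => // s.
have Lg := hecke_L1 hp hg; rewrite -gtransB //.
by apply: le_trans (gtrans_le s (L1B hp Lf Lg)) _; exact: ltW.
Qed.

Lemma approximable_bounded F : approximable F -> exists M : R, forall s, cabs (F s) <= M.
Proof.
move=> /(_ 1 ltr01)[f hf h]; exists (1 + L1norm f) => s.
rewrite -[F s](subrK (gtrans f s)) (le_trans (cabsD _ _)) // lerD ?h //.
by apply: gtrans_le; exact: (hecke_L1 hp).
Qed.

Lemma approximable0 : approximable (fun=> 0).
Proof.
move=> e e0; exists (fun=> 0); first exact: (hecke0 (R := R) hp).
move=> s; have L0 : L1 (fun=> 0 : C) by apply: (hecke_L1 hp); exact: (hecke0 (R := R) hp).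
rewrite -cabsN opprB subr0; apply: le_trans (gtrans_le s L0) _.
by rewrite (L1norm0 mu) ltW.
Qed.

Lemma approximableD F1 F2 : approximable F1 -> approximable F2 ->
  approximable (fun s => F1 s + F2 s).
Proof.
move=> a1 a2 e e0; have e2 : 0 < e / 2 by rewrite divr_gt0.
have [f1 h1 d1] := a1 _ e2; have [f2 h2 d2] := a2 _ e2.
exists (fun x => f1 x + f2 x); first exact: (heckeD hp).
move=> s; rewrite gtransD; [|exact: (hecke_L1 hp)..].
rewrite opprD addrACA (le_trans (cabsD _ _)) // (splitr e) lerD //.
Qed.

Lemma approximableZ c F : approximable F -> approximable (fun s => c * F s).
Proof.
move=> a e e0.
have c1 : 0 < cabs c + 1 by have := cabs_ge0 c; lra.
have [f h d] := a _ (divr_gt0 e0 c1).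
exists (fun x => c * f x); first exact: (heckeZ hp).
move=> s; rewrite gtransZ; last exact: (hecke_L1 hp).
rewrite -mulrBr cabsM; have := d s; rewrite ler_pdivlMr //.
have := cabs_ge0 c; have := cabs_ge0 (F s - gtrans f s).
move: (cabs c) (cabs _) => a1 a2; nra.
Qed.

Lemma approximableM F1 F2 : approximable F1 -> approximable F2 ->
  approximable (fun s => F1 s * F2 s).
Proof.
move=> a1 a2 e e0.
have [M1 b1] := approximable_bounded a1; have [M2 b2] := approximable_bounded a2.
have M10 : 0 <= M1 by apply: le_trans (b1 sph_triv); exact: cabs_ge0.
have M20 : 0 <= M2 by apply: le_trans (b2 sph_triv); exact: cabs_ge0.
(* With both approximations within [d], the product is off by at most [d M2 + M1 d + d^2], and
   [d^2 <= d]. *)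
pose d := Num.min 1 (e / (M1 + M2 + 1)).
have K0 : 0 < M1 + M2 + 1 by lra.
have d0 : 0 < d by rewrite lt_min ltr01 divr_gt0.
have d1 : d <= 1 by rewrite ge_min lexx.
have dK : d * (M1 + M2 + 1) <= e.
  by rewrite -ler_pdivlMr // ge_min lexx orbT.
have [f1 h1 e1] := a1 _ d0; have [f2 h2 e2] := a2 _ d0.
exists (conv f1 f2); first exact: (hecke_conv hp).
move=> s; rewrite gtransM; [|exact: (hecke_L1 hp)..].
have -> : F1 s * F2 s - gtrans f1 s * gtrans f2 s =
    (F1 s - gtrans f1 s) * F2 s +
    (F1 s * (F2 s - gtrans f2 s) - (F1 s - gtrans f1 s) * (F2 s - gtrans f2 s)).
  by move: (F1 s) (F2 s) (gtrans f1 s) (gtrans f2 s) => *; ring.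
apply: le_trans (cabsD _ _) _.
apply: le_trans (lerD (lexx _) (cabsD _ _)) _; rewrite cabsN !cabsM.
move: (cabs_ge0 (F1 s)) (cabs_ge0 (F2 s)) (b1 s) (b2 s) (e1 s) (e2 s)
  (cabs_ge0 (F1 s - gtrans f1 s)) (cabs_ge0 (F2 s - gtrans f2 s)).
move: (cabs (F1 s - _)) (cabs (F2 s - _)) (cabs (F1 s)) (cabs (F2 s)) => x y a b.
move=> a0 b0 aM bM xd yd x0 y0; apply: le_trans dK.
have : x * b <= d * M2 by apply: ler_pM.
have : a * y <= M1 * d by apply: ler_pM.
have : x * y <= d * 1 by apply: ler_pM => //; exact: le_trans yd d1.
lra.
Qed.

Lemma approximable_conj F : approximable F -> approximable (fun s => (F s)^*).
Proof.
move=> a e e0; have [f h d] := a _ e0; exists (invol f); first exact: (hecke_invol hp).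
move=> s; rewrite gtransS; last exact: (hecke_L1 hp).
by rewrite -rmorphB cabs_conj.
Qed.

(* The uniform closure of the spherical transforms, a concrete model of both
   completions; the [let]s are as in [halg]. *)
Definition galg : Type := let _ := hp in let _ := sph_le1 in
  {F : sph -> C | `[< approximable F >]}.

HB.instance Definition _ := Choice.copy galg {F : sph -> C | `[< approximable F >]}.

Definition gval (x : galg) : sph -> C := sval x.
Definition gin F (aF : approximable F) : galg := exist _ F (asboolT aF).

Lemma gvalP (x : galg) : approximable (gval x). Proof. exact: asboolW (svalP x). Qed.
Lemma gval_inj : injective gval. Proof. exact: val_inj. Qed.

Definition gadd (x y : galg) : galg := gin (approximableD (gvalP x) (gvalP y)).
Definition gscale (c : C) (x : galg) : galg := gin (approximableZ c (gvalP x)).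
Definition gmul (x y : galg) : galg := gin (approximableM (gvalP x) (gvalP y)).
Definition gstar (x : galg) : galg := gin (approximable_conj (gvalP x)).
Definition gzero : galg := gin approximable0.

Let gaddA : associative gadd.
Proof. by move=> x y z; apply: gval_inj; apply/funext => g /=; rewrite addrA. Qed.
Let gaddC : commutative gadd.
Proof. by move=> x y; apply: gval_inj; apply/funext => g /=; rewrite addrC. Qed.
Let gadd0 : left_id gzero gadd.
Proof. by move=> x; apply: gval_inj; apply/funext => g /=; rewrite add0r. Qed.
Let gaddN : left_inverse gzero (gscale (-1)) gadd.
Proof. by move=> x; apply: gval_inj; apply/funext => g /=; rewrite mulN1r addNr. Qed.

HB.instance Definition _ := GRing.isZmodule.Build galg gaddA gaddC gadd0 gaddN.

Let gscaleA a b x : gscale a (gscale b x) = gscale (a * b) x.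
Proof. by apply: gval_inj; apply/funext => g /=; rewrite mulrA. Qed.
Let gscale1 : left_id 1 gscale.
Proof. by move=> x; apply: gval_inj; apply/funext => g /=; rewrite mul1r. Qed.
Let gscaleDr : right_distributive gscale +%R.
Proof. by move=> c x y; apply: gval_inj; apply/funext => g /=; rewrite mulrDr. Qed.
Let gscaleDl x : {morph gscale^~ x : a b / a + b}.
Proof. by move=> a b; apply: gval_inj; apply/funext => g /=; rewrite mulrDl. Qed.

HB.instance Definition _ :=
  GRing.Zmodule_isLmodule.Build C galg gscaleA gscale1 gscaleDr gscaleDl.

Lemma gvalD (x y : galg) s : gval (x + y) s = gval x s + gval y s. Proof. by []. Qed.
Lemma gvalZ c (x : galg) s : gval (c *: x) s = c * gval x s. Proof. by []. Qed.
Lemma gvalB (x y : galg) s : gval (x - y) s = gval x s - gval y s.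
Proof. by rewrite -scaleN1r gvalD gvalZ mulN1r. Qed.

Definition gsup (x : galg) : R := sup (range (fun s => cabs (gval x s))).

Lemma gsup_ge (x : galg) s : cabs (gval x s) <= gsup x.
Proof.
apply: ub_le_sup; last by exists s.
by have [M h] := approximable_bounded (gvalP x); exists M => _ [t _ <-].
Qed.

Lemma gsup_le (x : galg) (M : R) : (forall s, cabs (gval x s) <= M) -> gsup x <= M.
Proof.
move=> h; apply: ge_sup; first by exists (cabs (gval x sph_triv)), sph_triv.
by move=> _ [s _ <-].
Qed.

Lemma gsup_ge0 (x : galg) : 0 <= gsup x.
Proof. exact: le_trans (cabs_ge0 _) (gsup_ge x sph_triv). Qed.

Lemma gsupD (x y : galg) : gsup (x + y) <= gsup x + gsup y.
Proof.
by apply: gsup_le => s; rewrite gvalD (le_trans (cabsD _ _)) // lerD // gsup_ge.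
Qed.

Lemma gsupZ c (x : galg) : gsup (c *: x) = cabs c * gsup x.
Proof.
apply: le_anti; apply/andP; split.
  by apply: gsup_le => s; rewrite gvalZ cabsM ler_wpM2l ?cabs_ge0 // gsup_ge.
have [->|c0] := eqVneq c 0; first by rewrite cabs0 mul0r gsup_ge0.
have cp : 0 < cabs c by rewrite lt_def cabs_ge0 cabs_eq0 c0.
rewrite -ler_pdivlMl //; apply: gsup_le => s.
by rewrite ler_pdivlMl // -cabsM -gvalZ gsup_ge.
Qed.

Lemma gsup_eq0 (x : galg) : gsup x = 0 -> x = 0.
Proof.
move=> h; apply: gval_inj; apply/funext => s; apply/eqP.
by rewrite -cabs_eq0; apply/eqP/le_anti; rewrite cabs_ge0 -h gsup_ge.
Qed.

Let gnorm (x : galg) : C := (gsup x)%:C%C.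
Let gnormD (x y : galg) : gnorm (x + y) <= gnorm x + gnorm y.
Proof. by rewrite /gnorm -rmorphD lecR gsupD. Qed.
Let gnormZ (c : C) (x : galg) : gnorm (c *: x) = `|c| * gnorm x.
Proof. by rewrite /gnorm gsupZ rmorphM /= cabsE. Qed.
Let gnorm_eq0 (x : galg) : gnorm x = 0 -> x = 0.
Proof. by move=> /(congr1 (@complex.Re _)) /gsup_eq0. Qed.

HB.instance Definition _ := Lmodule_isNormed.Build C galg gnormD gnormZ gnorm_eq0.

Lemma gnormE (x : galg) : `|x| = (gsup x)%:C%C. Proof. by []. Qed.

Lemma galg_complete (F : set_system galg) : ProperFilter F -> cauchy F -> cvg F.
Proof.
move=> FF /cauchyP Fc.
have near_ball (e : R) : 0 < e -> exists x : galg, F [set y | gsup (x - y) < e].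
  move=> e0; have e0' : 0 < e%:C%C :> C by rewrite ltcR.
  have [x Fx] := Fc _ e0'; exists x; apply: filterS Fx => y.
  by rewrite -ball_normE /= gnormE ltcR.
have lim s : exists l : C, forall e : R, 0 < e -> F [set y | cabs (l - gval y s) < e].
  pose ev (y : galg) : complex_line R := gval y s.
  have : cvg (ev @ F).
    apply: cauchy_cvg; apply/cauchyP => _ /gt0C[e e0 ->].
    have [x Fx] := near_ball e e0; exists (ev x).
    change (F (ev @^-1` ball (ev x) e%:C%C)); apply: filterS Fx => y /= h.
    rewrite -ball_normE /=; change (`|gval x s - gval y s| < e%:C%C).
    by rewrite -cabsE ltcR -gvalB (le_lt_trans (gsup_ge _ _)).
  move=> /cvg_ex[l /cvgrPdist_lt Fl]; exists l => e e0.
  have e0' : 0 < e%:C%C :> C by rewrite ltcR.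
  apply: filterS (Fl _ e0') => y /=.
  change (`|(l : C) - gval y s| < e%:C%C -> cabs ((l : C) - gval y s) < e).
  by rewrite -cabsE ltcR.
have [L LP] := choice lim.
have unif (e : R) (x : galg) : F [set y | gsup (x - y) < e] ->
    forall s, cabs (L s - gval x s) <= e.
  move=> Fx s; apply/ler_addgt0Pr => d d0.
  have [y [/= xy Ly]] := filter_ex (filterI Fx (LP s d d0)).
  rewrite -[L s](subrK (gval y s)) -addrA (le_trans (cabsD _ _)) //.
  rewrite [e + d]addrC lerD //; first exact: ltW.
  by rewrite cabsB -gvalB (le_trans (gsup_ge _ _)) // ltW.
have aL : approximable L.
  move=> e e0; have e2 : 0 < e / 2 by rewrite divr_gt0.
  have [x /unif Fx] := near_ball _ e2; have [f hf d] := gvalP x e2.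
  exists f => // s; rewrite -[L s](subrK (gval x s)) -addrA.
  by rewrite (le_trans (cabsD _ _)) // (splitr e) lerD.
apply/cvg_ex; exists (gin aL); apply/cvgrPdist_lt => _ /gt0C[e e0 ->].
(* Two such errors add up to [e / 2]: pointwise bounds reach the supremum only as [<=], and a strict
   bound by [e] is wanted. *)
have e4 : 0 < e / 4 by rewrite divr_gt0.
have [x Fx] := near_ball _ e4; apply: filterS (Fx) => y /= h.
rewrite gnormE ltcR; apply: (@le_lt_trans _ _ (e / 4 + e / 4)); last lra.
apply: gsup_le => s; rewrite gvalB -[gval (gin aL) s](subrK (gval x s)) -addrA.
rewrite (le_trans (cabsD _ _)) // lerD //; first exact: unif.
by rewrite -gvalB (le_trans (gsup_ge _ _)) // ltW.
Qed.

HB.instance Definition _ := Uniform_isComplete.Build galg galg_complete.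

Definition galg_cstar : cstarAlgebra R.
Proof.
refine (@CstarAlgebra R galg gmul gstar _ _ _ _ _ _ _ _ _ _ _).
- by move=> x y z; apply: gval_inj; apply/funext => s /=; rewrite mulrA.
- by move=> x y z; apply: gval_inj; apply/funext => s /=; rewrite mulrDl.
- by move=> x y z; apply: gval_inj; apply/funext => s /=; rewrite mulrDr.
- by move=> c x y; apply: gval_inj; apply/funext => s /=; rewrite mulrA.
- by move=> c x y; apply: gval_inj; apply/funext => s /=; rewrite mulrCA.
- by move=> x; apply: gval_inj; apply/funext => s /=; rewrite conjCK.
- by move=> x y; apply: gval_inj; apply/funext => s /=; rewrite rmorphD.
- by move=> c x; apply: gval_inj; apply/funext => s /=; rewrite rmorphM.
- by move=> x y; apply: gval_inj; apply/funext => s /=; rewrite rmorphM mulrC.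
- move=> x y; rewrite !gnormE -rmorphM lecR; apply: gsup_le => s /=.
  by rewrite cabsM ler_pM ?cabs_ge0 // gsup_ge.
- move=> x; rewrite !gnormE -rmorphXn; congr (_%:C%C).
  apply: le_anti; apply/andP; split.
    apply: gsup_le => s /=; rewrite cabsM cabs_conj -expr2.
    by rewrite ler_sqr ?nnegrE ?cabs_ge0 ?gsup_ge0 // gsup_ge.
  rewrite -[leRHS]sqr_sqrtr ?gsup_ge0 // ler_sqr ?nnegrE ?gsup_ge0 ?sqrtr_ge0 //.
  apply: gsup_le => s; rewrite -[leLHS]ger0_norm ?cabs_ge0 // -sqrtr_sqr.
  apply: ler_wsqrtr; have := gsup_ge (gmul (gstar x) x) s.
  by rewrite /= cabsM cabs_conj -expr2.
Defined.

Definition gemb f : galg :=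
  if pselect (L1 f) is left h then gin (approximable_gtrans h) else 0.

Lemma gembE f s : L1 f -> gval (gemb f) s = gtrans f s.
Proof. by rewrite /gemb; case: pselect. Qed.

Lemma sup_le_rep_norm A f : L1 f ->
  (forall s, ((cabs (gtrans f s))%:E <= rep_norm mu A f)%E) ->
  ((gsup (gemb f))%:E <= rep_norm mu A f)%E.
Proof.
move=> Lf; case: (rep_norm mu A f) => [r||] h.
- by rewrite lee_fin; apply: gsup_le => s; rewrite gembE // -lee_fin.
- exact: leey.
- by have := h sph_triv.
Qed.

Lemma rep_norm_hecke f : hecke f -> rep_norm mu hecke f = (gsup (gemb f))%:E.
Proof.
move=> hf; have Lf := hecke_L1 hp hf; apply: le_anti; apply/andP; split.
  apply: ge_ereal_sup => _ [H [pi [piP ->]]].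
  apply: (star_rep_hecke_le hp gp piP hf); first exact: gsup_ge0.
  move=> w sw; have := gsup_ge (gemb f) (exist _ w sw).
  by rewrite gembE.
apply: sup_le_rep_norm => // s; exact: (hecke_chi_le_rep_norm hp (svalP s)).
Qed.

Lemma star_rep_hecke_of_L1 (H : hilbertType R) (pi : (G -> C) -> {linear H -> H}) :
  star_rep mu L1 pi -> star_rep mu hecke pi.
Proof.
have hL f : hecke f -> L1 f by exact: (hecke_L1 hp).
move=> [h1 h2 h3 h4 h5]; split.
- by move=> f /hL; exact: h1.
- by move=> f1 f2 /hL ? /hL ?; exact: h2.
- by move=> c f /hL ?; exact: h3.
- by move=> f1 f2 /hL ? /hL ?; exact: h4.
- by move=> f /hL ?; exact: h5.
Qed.

(** For the upper bound, [f] is replaced by a close Hecke function [g], at which the restricted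
    representation obeys [rep_norm_hecke]. Contractivity, of representations and of the transform,
    bounds each of the two errors by [e / 2]. *)
Lemma rep_norm_L1 f : L1 f -> rep_norm mu L1 f = (gsup (gemb f))%:E.
Proof.
move=> Lf; apply: le_anti; apply/andP; split; last first.
  apply: sup_le_rep_norm => // s.
  apply: (@cabs_le_rep_norm _ _ mu L1 (fun f => gtrans f s)) => //.
  - by move=> f1 f2; exact: gtransD.
  - by move=> c f'; exact: gtransZ.
  - by move=> f1 f2; exact: gtransM.
  - by move=> f'; exact: gtransS.
apply: ge_ereal_sup => _ [H [pi [piP ->]]].
have fin f' : L1 f' -> (opnorm (pi f') < +oo)%E by case: piP => h _ _ _ _; exact: h.
rewrite (opnE (fin _ Lf)) lee_fin; apply/ler_addgt0Pr => e e0.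
have e2 : 0 < e / 2 by rewrite divr_gt0.
have [g hg dg] := hecke_dense hp Lf e2; have Lg := hecke_L1 hp hg.
have Lfg := L1B hp Lf Lg.
have le1' : opn (pi f) <= opn (pi g) + opn (pi (fun x => f x - g x)).
  have := rep_opnD (L1D hp) piP Lg Lfg.
  by have -> : (fun x => g x + (f x - g x)) = f by apply/funext => x; rewrite addrC subrK.
have le2 : opn (pi g) <= gsup (gemb g).
  rewrite -lee_fin -(opnE (fin _ Lg)) -rep_norm_hecke //.
  apply: ereal_sup_ubound; exists H, pi; split=> //; exact: star_rep_hecke_of_L1.
have le3 : opn (pi (fun x => f x - g x)) <= e / 2.
  rewrite -lee_fin -(opnE (fin _ Lfg)).
  apply: le_trans (star_rep_L1_le hp gp piP Lfg) _.
  by rewrite lee_fin ltW.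
have le4 : gsup (gemb g) <= gsup (gemb f) + e / 2.
  apply: gsup_le => s; rewrite gembE //.
  have -> : gtrans g s = gtrans f s - gtrans (fun x => f x - g x) s.
    by rewrite gtransB // opprB addrC subrK.
  rewrite (le_trans (cabsD _ _)) // cabsN lerD //.
    by rewrite -gembE // gsup_ge.
  by apply: le_trans (gtrans_le s Lfg) _; exact: ltW.
move: le1' le2 le3 le4.
move: (opn _) (opn _) (opn _) (gsup _) (gsup _) => *; lra.
Qed.

Lemma gemb_hecke_dense (v : galg) (e : R) : 0 < e ->
  exists2 w, [set gemb f | f in hecke] w & cnorm (v - w) < e.
Proof.
move=> e0; have e2 : 0 < e / 2 by rewrite divr_gt0.
have [f hf d] := gvalP v e2; exists (gemb f); first by exists f.
have Lf := hecke_L1 hp hf.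
rewrite /cnorm gnormE /=; apply: (@le_lt_trans _ _ (e / 2)); last lra.
by apply: gsup_le => s; rewrite gvalB gembE.
Qed.

(** Ends in [Defined] so that carrier and embedding unfold: [hecke_completion] reuses the laws
    proved here, and in [bounded_iso] the canonical map becomes the identity of [galg]. *)
Definition L1_completion : cstar_completion mu L1.
Proof.
refine (@CstarCompletion R G mu L1 galg_cstar gemb _ _ _ _ _ _).
- move=> f1 f2 h1 h2; apply: gval_inj; apply/funext => s.
  by rewrite gvalD !gembE ?gtransD //; exact: (L1D hp).
- move=> c f h; apply: gval_inj; apply/funext => s.
  by rewrite gvalZ !gembE ?gtransZ //; exact: (L1Z hp).
- move=> f1 f2 h1 h2; apply: gval_inj; apply/funext => s /=.
  by rewrite !gembE ?gtransM //; exact: (L1_conv hp).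
- move=> f h; apply: gval_inj; apply/funext => s /=.
  by rewrite !gembE ?gtransS //; exact: (L1_invol hp).
- by move=> f h; rewrite gnormE rep_norm_L1.
- apply: dense_cnorm => v e e0; have [_ [f hf <-] d] := gemb_hecke_dense v e0.
  by exists (gemb f) => //; exists f => //; exact: (hecke_L1 hp).
Defined.

Definition hecke_completion : cstar_completion mu hecke.
Proof.
refine (@CstarCompletion R G mu hecke galg_cstar gemb _ _ _ _ _ _).
- by move=> f1 f2 /(hecke_L1 hp) ? /(hecke_L1 hp) ?; exact: (completion_embD L1_completion).
- by move=> c f /(hecke_L1 hp) ?; exact: (completion_embZ L1_completion).
- by move=> f1 f2 /(hecke_L1 hp) ? /(hecke_L1 hp) ?; exact: (completion_embM L1_completion).
- by move=> f /(hecke_L1 hp) ?; exact: (completion_emb_star L1_completion).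
- by move=> f h; rewrite gnormE rep_norm_hecke.
- by apply: dense_cnorm => v e e0; exact: gemb_hecke_dense.
Defined.

Lemma bounded_universal : universal_completion_exists mu U.
Proof. by move=> f hf; rewrite rep_norm_hecke // ltry. Qed.

Lemma bounded_iso : canonical_surjection_iso mu U.
Proof.
exists hecke_completion, L1_completion.
exists (idfun : {linear galg -> galg}).
by split=> //; exists idfun.
Qed.

End Completion.

Theorem theorem3p2 (R : realType) (G : topologicalGroupType)
  (hausdorffG : hausdorff_space G)
  (locally_compactG : locally_compact [set: G])
  (unimodularG : unimodular R G)
  (U : set G) (subgroupU : subgroup U) (compactU : compact U) (openU : open U)
  (mu : {measure set (borel G) -> \bar R})
  (haar_mu : haar_measure mu) (muU : mu U = 1%E)
  (gelfandGU : gelfand_pair mu U) :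
  (forall omega : G -> R[i], star_spherical mu U omega ->
     bounded_fun (omega : G -> R[i]^o))
  <-> (universal_completion_exists mu U /\ canonical_surjection_iso mu U).
Proof.
have hp := HeckePair hausdorffG unimodularG subgroupU compactU openU haar_mu muU.
split=> [bdd|[_ iso] w sw]; last exact: (iso_bounded hp iso sw).
(* The hypothesis bounds each spherical function separately; the common bound 1 is what makes the
   transforms uniformly controlled by the L1-norm. *)
have le1 w : star_spherical mu U w -> forall x, cabs (w x) <= 1.
  move=> sw; have /bounded_cabsP[M hM] := bdd w sw.
  by apply: (bounded_spherical_le1 hp _ hM); case: sw.
by split; [exact: (bounded_universal hp gelfandGU le1)|exact: (bounded_iso hp gelfandGU le1)].
Qed.
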